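(* In the finite-stratum model described in the context, let $\tau_n\downarrow0$ be deterministic with $\sqrt n\tau_n\to\infty$, and let $\widehat\Psi_{\mathrm{eff}}$ be the estimator defined in the context. Then $$\sqrt n\{\widehat\Psi_{\mathrm{eff}}-\Psi(P)\}=n^{-1/2}\sum_{i=1}^n\tilde\psi_\kappa(O_i)+o_{P^n}(1),$$ and $\widehat\Psi_{\mathrm{eff}}$ is regular and efficient along $\mathcal H_\kappa$. For any optimal rule $d$, the fixed-rule estimate $\sum_x\hat p_x\hat\mu_{d(x)}(x)$, defined by the same fallback convention on exceptional samples, is regular along $C_d$ and attains $V_d$ (limit law $N(0,V_d)$). For every $h\in\mathcal T$ and every DQM path with score $h$, $$\sqrt n\{\widehat\Psi_{\mathrm{eff}}-\Psi(P_{n,h})\}\rightsquigarrow N(\delta(h),V_\kappa)\quad\text{under }P^n_{n,h},$$ $$\delta(h)=\sum_xp_x\Big\{\sum_{a\in\mathcal A^*(x)}w_a^*(x)\dot\mu_{a,h}(x)-\max_{a\in\mathcal A^*(x)}\dot\mu_{a,h}(x)\Big\}\le0.$$ Equality $\delta(h)=0$ holds exactly when $h\in\mathcal H_\kappa$.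
   Context: Model. $O=(X,A,Y)$ with $X\in\{1,\dots,J\}$, $A\in\{1,\dots,K\}$, $Y\in\mathbb R$. For fixed $B_0<\infty$, $\epsilon>0$, $\mathcal P$ is the set of all laws $Q$ of $O$ with $|Y|\le B_0$ and $Q(A=a\mid X)\ge\epsilon$ for all $a$. $P\in\mathcal P$ is fixed with $\pi_a(X):=P(A=a\mid X)\ge\epsilon+\eta$ for some $\eta>0$, $p_x:=P(X=x)>0$ for every $x$, and $\sigma_a^2(x):=\operatorname{Var}(Y\mid X=x,A=a)>0$. $O_1,\dots,O_n$ are i.i.d.; $\mathcal T=L_2^0(P)$. $\mu_a(x)=\mathbb E[Y\mid X=x,A=a]$, $q(x)=\max_a\mu_a(x)$, $\Psi(P)=\mathbb E\,q(X)$ (and similarly under $Q$), $\mathcal A^*(x)=\arg\max_a\mu_a(x)$, $R_a(O)=\frac{\mathbf 1\{A=a\}}{\pi_a(X)}\{Y-\mu_a(X)\}$, $c_a(x)=\sigma_a^2(x)/\pi_a(x)$, $\dot\mu_{a,h}(x)=\mathbb E\{R_ah\mid X=x\}$; $w_a^*(x)=c_a(x)^{-1}/\sum_{b\in\mathcal A^*(x)}c_b(x)^{-1}$ for $a\in\mathcal A^*(x)$, $0$ otherwise. $\mathcal H_\kappa=\{h\in\mathcal T:\dot\mu_{a,h}(x)=\dot\mu_{b,h}(x)\ \forall x,\ a,b\in\mathcal A^*(x)\}$; $\tilde\psi_\kappa(O)=q(X)-\Psi(P)+\sum_aw_a^*(X)R_a(O)$; $V_\kappa=\operatorname{Var}\{q(X)\}+\sum_xp_x\{\sum_{a\in\mathcal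 A^*(x)}\pi_a(x)/\sigma_a^2(x)\}^{-1}$. An optimal rule $d$ has $d(x)\in\mathcal A^*(x)$ for all $x$; $C_d=\{h\in\mathcal T:\dot\mu_{d(x),h}(x)\ge\dot\mu_{a,h}(x)\ \forall x,\ a\in\mathcal A^*(x)\}$; $V_d=\operatorname{Var}\{q(X)\}+\sum_xp_xc_{d(x)}(x)$. Estimator. $\hat p_x,\hat\pi_a(x),\hat\mu_a(x),\hat\sigma_a^2(x)$ are the empirical stratum frequencies, treatment proportions, cell means and cell variances (cell size as divisor). $\widehat{\mathcal A}(x)=\{a:\max_b\hat\mu_b(x)-\hat\mu_a(x)\le\tau_n\}$, $$\hat w_a(x)=\frac{\mathbf 1\{a\in\widehat{\mathcal A}(x)\}\hat\pi_a(x)/\hat\sigma_a^2(x)}{\sum_{b\in\widehat{\mathcal A}(x)}\hat\pi_b(x)/\hat\sigma_b^2(x)},\qquad \widehat\Psi_{\mathrm{eff}}=\sum_x\hat p_x\sum_a\hat w_a(x)\hat\mu_a(x).$$ Fallback convention: on the event that a treatment cell is empty or an empirical cell variance is zero, the estimator is the overall sample mean of $Y$. A DQM path with score $h$ is a map $t\mapsto P_{t,h}\in\mathcal P$, $t\in[0,\varepsilon)$, $P_{0,h}=P$, with $\int[(dP_{t,h}^{1/2}-dP^{1/2})/t-\tfrac12h\,dP^{1/2}]^2\to0$; $P_{n,h}:=P_{n^{-1/2},h}$, $P^n_{n,h}$ its $n$-fold product. $T_n$ is regular along a convex cone $C$ with limit law $L$ if $\sqrt n\{T_n-\Psi(P_{n,h})\}\rightsquigarrow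 L$ under $P^n_{n,h}$ for all $h\in C$ and all DQM paths with score $h$; efficient along $\mathcal H_\kappa$ means $C=\mathcal H_\kappa$, $L=N(0,V_\kappa)$. *)

(* Defs.v *)
From HB Require Import structures.
From mathcomp Require Import all_boot all_order all_algebra.
From mathcomp Require Import all_classical all_reals all_analysis.

Set Implicit Arguments.
Unset Strict Implicit.
Unset Printing Implicit Defensive.

Import Order.TTheory GRing.Theory Num.Def Num.Theory.
Import numFieldNormedType.Exports.

Local Open Scope classical_set_scope.
Local Open Scope ring_scope.

(* Finite index types carry the discrete sigma-algebra; measurable types are
   pointed, hence 'I_n.+1. *)
HB.instance Definition _ (n : nat) := isPointed.Build 'I_n.+1 ord0.
HB.instance Definition _ (n : nat) := @isMeasurable.Build default_measure_display
  'I_n.+1 discrete_measurable discrete_measurable0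
  discrete_measurableC discrete_measurableU.

Section iid_law.
Context {d : measure_display} {T : measurableType d} {R : realType}.

Definition tuple_cons (n : nat) (z : T * n.-tuple T) : n.+1.-tuple T :=
  [tuple of z.1 :: z.2].

Lemma measurable_tuple_cons (n : nat) :
  measurable_fun [set: T * n.-tuple T] (@tuple_cons n).
Proof. exact: measurable_cons. Qed.

HB.instance Definition _ (n : nat) :=
  isMeasurableFun.Build _ _ _ _ (@tuple_cons n) (@measurable_tuple_cons n).

(* The n-fold product of P on the product sigma-algebra of n.-tuple T; see
   iid_lawE for its values on rectangles. *)
Fixpoint iid_law (P : probability T R) (n : nat) : probability (n.-tuple T) R :=
  match n with
  | 0 => \d_ ([tuple] : 0.-tuple T)
  | m.+1 => distribution (P \x iid_law P m)%E (@tuple_cons m)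
  end.

Lemma iid_lawE (P : probability T R) (n : nat) (A : 'I_n -> set T) :
  (forall i, measurable (A i)) ->
  iid_law P n [set s | forall i, A i (tnth s i)] = (\prod_(i < n) P (A i))%E.
Proof.
elim: n A => [|n IHn] A mA.
  by rewrite big_ord0 /= diracE mem_set// => -[].
rewrite big_ord_recl /= /distribution /= /pushforward.
pose B := [set s : n.-tuple T | forall i, A (lift ord0 i) (tnth s i)].
have mB : measurable B.
  rewrite (_ : B = \bigcap_(i in [set: 'I_n])
                     ((@tnth _ T)^~ i @^-1` A (lift ord0 i))).
    apply: fin_bigcap_measurable => // i _.
    by rewrite -[X in measurable X]setTI; exact: measurable_tnth.
  apply/seteqP; split=> s /= As i; first by move=> _; exact: As.
  exact: As.
rewrite -IHn// -product_measure1E//; congr (_ _).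
apply/seteqP; split=> -[y s] /=.
  move=> As; split; first exact: (As ord0).
  by move=> i; have := As (lift ord0 i); rewrite /tuple_cons tnthS.
move=> [Ay As] i; case: (unliftP ord0 i) => [j ->|->]; last exact: Ay.
rewrite /tuple_cons tnthS; exact: As.
Qed.

End iid_law.

Section maximum.
Context {R : realType} {I : finType}.

Definition maxover (A : {pred I}) (f : I -> R) : R :=
  sup [set r | exists2 a, a \in A & r = f a].

Lemma maxoverP (A : {pred I}) (f : I -> R) (a0 : I) : a0 \in A ->
  (exists2 a, a \in A & maxover A f = f a) /\
  (forall a, a \in A -> f a <= maxover A f).
Proof.
move=> Aa0; case: (arg_maxP f Aa0) => m Am fm.
have ubm : ubound [set r | exists2 a, a \in A & r = f a] (f m).
  by move=> _ [a Aa ->]; exact: fm.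
have -> : maxover A f = f m.
  apply/eqP; rewrite eq_le; apply/andP; split.
    by apply: ge_sup => //; exists (f m), m.
  by apply: ub_le_sup; [exists (f m) | exists m].
by split; [exists m | exact: fm].
Qed.

End maximum.

(* Weak convergence to L of the laws of the statistics S n under Pn n, and
   convergence of S n to 0 in Pn n-probability; both require the statistics to
   be measurable. *)
Section convergence.
Context {d : nat -> measure_display} {T : forall n, measurableType (d n)}.
Context {R : realType}.
Implicit Types (Pn : forall n, probability (T n) R) (S : forall n, T n -> R).

Definition cvg_in_law Pn S (L : probability (measurableTypeR R) R) : Prop :=
  (forall n, measurable_fun setT (S n)) /\
  forall f : R -> R, continuous f -> bounded_fun f ->
    (\int[Pn n]_s f (S n s)) @[n --> \oo] --> \int[L]_y f y.

Definition cvg_to0_in_prob Pn S : Prop :=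
  (forall n, measurable_fun setT (S n)) /\
  forall e : R, 0 < e ->
    Pn n [set s | e < `|S n s|] @[n --> \oo] --> 0%E.

End convergence.

(* N(m, V), parameterized by the variance: normal_prob takes the standard
   deviation (and is not the point mass when it vanishes, so V must be > 0). *)
Definition normal_law {R : realType} (m V : R) :
  probability (measurableTypeR R) R := normal_prob m (Num.sqrt V).

(* An observation (X, A, Y), with J.+1 strata and K.+1 treatments. *)
Notation obs J K R := ('I_J.+1 * 'I_K.+1 * R)%type.

Section model.
Context {R : realType} {J K : nat}.
Local Notation O := (obs J K R).
Implicit Types (P Q : probability O R) (x : 'I_J.+1) (a : 'I_K.+1).
Implicit Types (o : O) (h : O -> R) (d : 'I_J.+1 -> 'I_K.+1).

Definition strat o : 'I_J.+1 := o.1.1.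
Definition treat o : 'I_K.+1 := o.1.2.
Definition outcome o : R := o.2.

Definition stratum x : set O := [set o | strat o = x].
Definition cell x a : set O := [set o | strat o = x /\ treat o = a].

(* E_Q[f | E] for an event E, with value 0 when Q E = 0. *)
Definition cond_mean Q (f : O -> R) (E : set O) : R :=
  (\int[Q]_(o in E) f o) / fine (Q E).

Definition pr Q x : R := fine (Q (stratum x)).
Definition prop Q a x : R := fine (Q (cell x a)) / fine (Q (stratum x)).
Definition mean Q a x : R := cond_mean Q outcome (cell x a).
Definition var Q a x : R :=
  cond_mean Q (fun o => (outcome o - mean Q a x) ^+ 2) (cell x a).

(* The bounds |Y| <= B0 and Q(A = a | X) >= eps hold Q-almost surely; the
   latter only concerns strata of positive probability. *)
Definition in_model (B0 eps : R) Q : Prop :=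
  Q [set o | B0 < `|outcome o|] = 0%E /\
  forall x, 0 < pr Q x -> forall a, eps <= prop Q a x.

Definition qmax Q x : R := maxover predT (mean Q ^~ x).
Definition Psi Q : R := fine ('E_Q[fun o => qmax Q (strat o)])%E.

Definition optimal P x : {pred 'I_K.+1} :=
  [pred a | [forall b, mean P b x <= mean P a x]].

Definition resid P a o : R :=
  (treat o == a)%:R / prop P a (strat o) * (outcome o - mean P a (strat o)).
Definition cvar P a x : R := var P a x / prop P a x.
Definition mean_dot P h a x : R :=
  cond_mean P (fun o => resid P a o * h o) (stratum x).
Definition wstar P a x : R :=
  if a \in optimal P x
  then (cvar P a x)^-1 / \sum_(b in optimal P x) (cvar P b x)^-1 else 0.

(* L_2^0(P) *)
Definition tangent P : set (O -> R) :=
  [set h | h \in Lfun P 2%:E /\ ('E_P[h] = 0)%E].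

Definition H_kappa P : set (O -> R) :=
  [set h | tangent P h /\
    forall x a b, a \in optimal P x -> b \in optimal P x ->
      mean_dot P h a x = mean_dot P h b x].
Definition psi_kappa P o : R :=
  qmax P (strat o) - Psi P + \sum_a wstar P a (strat o) * resid P a o.
Definition V_kappa P : R :=
  fine 'V_P[fun o => qmax P (strat o)] +
  \sum_x pr P x * (\sum_(a in optimal P x) prop P a x / var P a x)^-1.

Definition optimal_rule P d : Prop := forall x, d x \in optimal P x.
Definition C_rule P d : set (O -> R) :=
  [set h | tangent P h /\
    forall x a, a \in optimal P x -> mean_dot P h a x <= mean_dot P h (d x) x].
Definition V_rule P d : R :=
  fine 'V_P[fun o => qmax P (strat o)] + \sum_x pr P x * cvar P (d x) x.

Definition delta P h : R :=
  \sum_x pr P x *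
    ((\sum_(a in optimal P x) wstar P a x * mean_dot P h a x)
     - maxover (optimal P x) (mean_dot P h ^~ x)).

(* A path is a total function of t, constrained only on some [0, e[. *)
Definition is_density (m : {measure set O -> \bar R}) Q (f : O -> R) : Prop :=
  [/\ measurable_fun setT f, forall o, 0 <= f o &
      forall E, measurable E -> Q E = (\int[m]_(o in E) (f o)%:E)%E].

(* The DQM integral at t is computed with densities f t of path t and g t of P
   with respect to a common dominating measure m t; its value does not depend
   on the choice of (m t, f t, g t). *)
Definition dqm_path (B0 eps : R) P h (path : R -> probability O R) : Prop :=
  exists2 e : R, 0 < e &
  [/\ forall t, 0 <= t < e -> in_model B0 eps (path t),
      forall E, measurable E -> path 0 E = P E &
      exists (m : R -> {sigma_finite_measure set O -> \bar R})
             (f g : R -> O -> R),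
        (forall t, 0 < t < e ->
          is_density (m t) (path t) (f t) /\ is_density (m t) P (g t)) /\
        (\int[m t]_o
          (((Num.sqrt (f t o) - Num.sqrt (g t o)) / t
            - 2^-1 * h o * Num.sqrt (g t o)) ^+ 2)%:E)%E @[t --> 0^'+] --> 0%E].

Definition local_law (path : R -> probability O R) (n : nat) :
  probability O R := path (Num.sqrt n%:R)^-1.

Definition local_cvg (path : R -> probability O R)
    (T : forall n, n.-tuple O -> R) (L : probability (measurableTypeR R) R) :=
  cvg_in_law (fun n => iid_law (local_law path n) n)
    (fun n s => Num.sqrt n%:R * (T n s - Psi (local_law path n))) L.

Definition regular_along (B0 eps : R) P (T : forall n, n.-tuple O -> R)
    (C : set (O -> R)) (L : probability (measurableTypeR R) R) : Prop :=
  forall h, C h -> forall path, dqm_path B0 eps P h path ->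
    local_cvg path T L.

Definition asymptotically_linear P (T : forall n, n.-tuple O -> R)
    (psi : O -> R) : Prop :=
  cvg_to0_in_prob (iid_law P)
    (fun n s => Num.sqrt n%:R * (T n s - Psi P)
                - (Num.sqrt n%:R)^-1 * \sum_(i < n) psi (tnth s i)).

End model.

Section estimators.
Context {R : realType} {J K : nat}.
Local Notation O := (obs J K R).
Implicit Types (s : seq O) (x : 'I_J.+1) (a : 'I_K.+1).

Definition n_stratum s x : nat := count (fun o => strat o == x) s.
Definition n_cell s x a : nat :=
  count (fun o => (strat o == x) && (treat o == a)) s.

Definition pr_hat s x : R := (n_stratum s x)%:R / (size s)%:R.
Definition prop_hat s a x : R := (n_cell s x a)%:R / (n_stratum s x)%:R.
Definition mean_hat s a x : R :=
  (\sum_(o <- s | (strat o == x) && (treat o == a)) outcome o)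
  / (n_cell s x a)%:R.
Definition var_hat s a x : R :=
  (\sum_(o <- s | (strat o == x) && (treat o == a))
     (outcome o - mean_hat s a x) ^+ 2) / (n_cell s x a)%:R.

Definition sample_mean s : R := (\sum_(o <- s) outcome o) / (size s)%:R.
Definition exceptional s : bool :=
  [exists x, exists a, (n_cell s x a == 0%N) || (var_hat s a x == 0)].

Definition optimal_hat (tau : R) s x : {pred 'I_K.+1} :=
  [pred a | maxover predT (mean_hat s ^~ x) - mean_hat s a x <= tau].
Definition w_hat (tau : R) s a x : R :=
  (a \in optimal_hat tau s x)%:R * (prop_hat s a x / var_hat s a x)
  / \sum_(b in optimal_hat tau s x) prop_hat s b x / var_hat s b x.

Definition Psi_eff (tau : nat -> R) (n : nat) (s : n.-tuple O) : R :=
  if exceptional s then sample_mean s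
  else \sum_x pr_hat s x * \sum_a w_hat (tau n) s a x * mean_hat s a x.

Definition Psi_rule (d : 'I_J.+1 -> 'I_K.+1) (n : nat) (s : n.-tuple O) : R :=
  if exceptional s then sample_mean s
  else \sum_x pr_hat s x * mean_hat s (d x) x.

End estimators.

(* Main.v *)
(* All cell probabilities, cell means and cell variances, under a law or in a
   sample, are smooth functions of the moments E[1{X = x, A = a} Y^k] with
   k <= 2.  Differentiability in quadratic mean gives the derivative of the
   expectation of any bounded function along the path, hence of these moments
   and, since the maximum of finitely many differentiable functions has a
   directional derivative, of Psi.  On samples whose empirical moments lie
   within M / sqrt n of the true ones, tau_n eventually separates optimal from
   suboptimal treatments, the estimated weights converge, and
   sum_a w_a mu_a is linearized using only that the weights sum to 1 and vanish
   off the optimal treatments; Chebyshev's inequality under the local laws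
   themselves makes such samples likely.  No contiguity is used: the limit law
   comes from Lindeberg's theorem for the triangular array of samples drawn
   from the local laws, and the shift delta(h) is the difference between the
   derivatives of the linearization and of Psi. *)
Require Import Defs.
From mathcomp Require Import all_boot all_order all_algebra.
From mathcomp Require Import all_classical all_reals all_analysis.
From mathcomp Require Import measurable_realfun ring lra.

Set Implicit Arguments.
Unset Strict Implicit.
Unset Printing Implicit Defensive.

Import Order.TTheory GRing.Theory Num.Def Num.Theory.
Import numFieldNormedType.Exports.

Local Open Scope classical_set_scope.
Local Open Scope ring_scope.

(** * Densities and bounded integrands *)

(** The obstacle is ties between treatments. A local law may break a tie at order 1 / sqrt n, and
    the threshold [tau], being of larger order, does not see it: the estimator keeps the tied set of
    P and is linear with the same weights for every score, whereas Psi follows the directional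
    derivative of a maximum. The expansions are deterministic. They are proved for an arbitrary
    filter and an arbitrary rate N, then used twice: for n tending to infinity with the moments of
    the local laws, which gives the derivative of Psi, and for large good samples with their
    empirical moments, which gives the estimators. Probability enters the remainders only in
    [remainder_in_prob]. As differentiability in quadratic mean keeps the moments of the local laws
    within O(1 / sqrt n) of those of P, one family of good samples is likely under all of them,
    which is what contiguity would otherwise provide. The influence functions are bounded after
    clipping, so the central limit step needs only a Taylor remainder with fourth moments. It is
    carried out with convolution operators on test functions instead of characteristic functions. *)

Section density.
Local Open Scope ereal_scope.
Context {d : measure_display} {T : measurableType d} {R : realType}.
Variables (m nu : {measure set T -> \bar R}) (g : T -> R).
Hypotheses (mg : measurable_fun setT g) (g0 : forall x, (0 <= g x)%R).
Hypothesis nuE : forall E, measurable E -> nu E = \int[m]_(x in E) (g x)%:E.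

Import HBNNSimple.

Let nnsfun_density (h : {nnsfun T >-> R}) :
  \int[nu]_x (h x)%:E = \int[m]_x ((h x)%:E * (g x)%:E).
Proof.
under [LHS]eq_integral do rewrite fimfunE -fsumEFin//.
rewrite [LHS]ge0_integral_fsum//; last 2 first.
  - by move=> r; exact/measurable_EFinP/measurableT_comp.
  - by move=> n x _; rewrite EFinM nnfun_muleindic_ge0.
under [RHS]eq_integral => x _.
  rewrite fimfunE -fsumEFin// ge0_mule_fsuml; last first.
    by move=> r; rewrite EFinM nnfun_muleindic_ge0.
  over.
rewrite [RHS]ge0_integral_fsum//; last 2 first.
  - move=> r; apply: emeasurable_funM; last exact/measurable_EFinP.
    by apply/measurable_EFinP; exact/measurableT_comp.
  - move=> n x _; apply: mule_ge0; last by rewrite lee_fin.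
    by rewrite EFinM nnfun_muleindic_ge0.
apply: eq_fsbigr => r _.
rewrite integralZl_indic_nnsfun// integral_indic// setIT nuE//.
have [r0|r0] := ltP r 0%R.
  rewrite preimage_nnfun0// integral_set0 mule0 integral0_eq// => x _.
  by rewrite indic0 mulr0 mul0e.
rewrite integral_mkcond -ge0_integralZl//; last 2 first.
- apply/(measurable_restrictT _ _).1 => //; apply/measurable_EFinP.
  exact: measurable_funS mg.
- by move=> x _; apply: erestrict_ge0 => y _; rewrite lee_fin.
apply: eq_integral => x _; rewrite EFinM -muleA; congr (_ * _).
by rewrite patchE indicE; case: ifPn => _; rewrite ?mul1e ?mul0e.
Qed.

(** Simple functions first, then monotone convergence. The density is a given real function and [m]
    any measure, so this serves both the normal laws and the dominating measures of a DQM path. *)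
Lemma ge0_integral_density (f : T -> \bar R) : measurable_fun setT f ->
  (forall x, 0 <= f x) -> \int[nu]_x f x = \int[m]_x (f x * (g x)%:E).
Proof.
move=> mf f0; pose f_ := nnsfun_approx measurableT mf.
transitivity (limn (fun n => \int[nu]_x (f_ n x)%:E)).
  rewrite -monotone_convergence//=.
  - apply: eq_integral => x _; apply/esym/cvg_lim => //=.
    by apply: cvg_nnsfun_approx => //.
  - by move=> n; apply: measurableT_comp.
  - by move=> n x _; rewrite lee_fin.
  - by move=> x _ a b ab; rewrite lee_fin//; exact/lefP/nd_nnsfun_approx.
rewrite [RHS](_ : _ = limn (fun n => \int[m]_x ((f_ n x)%:E * (g x)%:E))).
  by congr (limn _); apply/funext => n; exact: nnsfun_density.
rewrite -monotone_convergence//=.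
- apply: eq_integral => x _; apply/esym/cvg_lim => //=.
  apply: cvgeZr => //.
  exact: (@cvg_nnsfun_approx _ _ _ _ measurableT f mf _ x I).
- move=> n; apply: emeasurable_funM; exact/measurable_EFinP.
- by move=> n x _; rewrite mule_ge0// lee_fin.
- move=> x _ a b ab; rewrite lee_wpmul2r ?lee_fin//.
  exact/lefP/nd_nnsfun_approx.
Unshelve. all: by end_near. Qed.

Lemma integrable_density (f : T -> R) : nu.-integrable setT (EFin \o f) ->
  m.-integrable setT (EFin \o (fun x => f x * g x)%R).
Proof.
move=> /integrableP[mf]; rewrite ge0_integral_density//; last first.
  exact: measurableT_comp.
move=> fi; apply/integrableP; split.
  by apply/measurable_EFinP/measurable_funM => //; exact/measurable_EFinP.
move: fi; congr (_ < _); apply: eq_integral => x _ /=.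
by rewrite normrM (ger0_norm (g0 x)) EFinM.
Qed.

(** Positive and negative parts are transferred separately, so no integrability is involved: both
    sides are [fine] of the same extended real. *)
Lemma Rintegral_density (f : T -> R) : measurable_fun setT f ->
  (\int[nu]_x f x = \int[m]_x (f x * g x))%R.
Proof.
move=> /measurable_EFinP mf.
rewrite /Rintegral; congr fine; rewrite integralE [RHS]integralE.
rewrite !ge0_integral_density//; [|exact: measurable_funeneg|exact: measurable_funepos].
congr (_ - _); apply: eq_integral => x _; rewrite ?funeposE ?funenegE/=.
  by rewrite -EFin_max -EFinM maxr_pMl// mul0r EFin_max.
by rewrite -EFin_max -EFinM maxr_pMl// mul0r mulNr EFin_max.
Qed.

End density.

Section bounded_integrals.
Context {d : measure_display} {T : measurableType d} {R : realType}.
Variable P : probability T R.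
Implicit Types f g : T -> R.

Lemma bounded_integrable f (M : R) : measurable_fun setT f ->
  (forall x, `|f x| <= M) -> P.-integrable setT (EFin \o f).
Proof.
move=> mf fM; apply: measurable_bounded_integrable => //.
  by rewrite -ge0_fin_numE// fin_num_measure.
exists M; split; first exact: num_real.
by move=> r Mr x _ /=; rewrite (le_trans (fM x))// ltW.
Qed.

Lemma le_integrableR f g : measurable_fun setT f ->
  (forall x, `|f x| <= `|g x|) -> P.-integrable setT (EFin \o g) ->
  P.-integrable setT (EFin \o f).
Proof.
move=> mf fg; apply: le_integrable => //; first exact/measurable_EFinP.
by move=> x _; rewrite /= lee_fin.
Qed.

Lemma integrableDR f g : P.-integrable setT (EFin \o f) ->
  P.-integrable setT (EFin \o g) -> P.-integrable setT (EFin \o (f \+ g)).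
Proof. by move=> fi gi; have := integrableD measurableT fi gi. Qed.

Lemma integrableBR f g : P.-integrable setT (EFin \o f) ->
  P.-integrable setT (EFin \o g) -> P.-integrable setT (EFin \o (f \- g)).
Proof. by move=> fi gi; have := integrableB measurableT fi gi. Qed.

Lemma integrableZR k f : P.-integrable setT (EFin \o f) ->
  P.-integrable setT (EFin \o (fun x => k * f x)).
Proof. by move=> fi; have := integrableZl measurableT k fi. Qed.

Lemma integrable_cstR (k : R) : P.-integrable setT (EFin \o (fun=> k)).
Proof. exact: finite_measure_integrable_cst. Qed.

Lemma Rintegral_cstT (k : R) : \int[P]_x k = k.
Proof. by rewrite Rintegral_cst//= probability_setT mulr1. Qed.

Lemma le_Rintegral_bound f g : P.-integrable setT (EFin \o f) ->
  P.-integrable setT (EFin \o g) ->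
  (forall x, `|f x| <= g x) -> `|\int[P]_x f x| <= \int[P]_x g x.
Proof.
move=> fi gi fg; apply: le_trans (le_normr_Rintegral _ fi) _ => //.
apply: le_Rintegral => //; exact: integrable_norm.
Qed.

Lemma Rintegral_bounded f (M : R) : measurable_fun setT f ->
  (forall x, `|f x| <= M) -> `|\int[P]_x f x| <= M.
Proof.
move=> mf fM; rewrite -[leRHS]Rintegral_cstT.
by apply: le_Rintegral_bound => //; [exact: bounded_integrable fM|exact: integrable_cstR].
Qed.

End bounded_integrals.

(** * Normal laws *)

Section gaussian.
Context {R : realType}.
Local Notation leb := (@lebesgue_measure R).
Implicit Types (m v : R) (f : R -> R).

Let sd_neq0 v : 0 < v -> Num.sqrt v != 0.
Proof. by move=> v0; rewrite gt_eqF// sqrtr_gt0. Qed.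

Lemma normal_pdf_sqrtE m v x : 0 < v ->
  normal_pdf m (Num.sqrt v) x =
  (Num.sqrt (v * pi *+ 2))^-1 * expR (- (x - m) ^+ 2 / (v *+ 2)).
Proof.
move=> v0; rewrite normal_pdfE ?sd_neq0//= /normal_peak /normal_fun.
by rewrite sqr_sqrtr ?ltW.
Qed.

Lemma ge0_integral_normal m v (f : R -> \bar R) : measurable_fun setT f ->
  (forall x, (0 <= f x)%E) ->
  (\int[normal_law m v]_x f x =
   \int[leb]_x (f x * (normal_pdf m (Num.sqrt v) x)%:E))%E.
Proof.
move=> mf f0.
apply: (@ge0_integral_density _ _ _ leb (normal_prob m (Num.sqrt v))) => //.
- exact: measurable_normal_pdf.
- by move=> x; exact: normal_pdf_ge0.
Qed.

Lemma ge0_integral_shift (f : R -> R) c : continuous f -> (forall x, 0 <= f x) ->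
  (\int[leb]_x (f x)%:E = \int[leb]_x (f (x + c))%:E)%E.
Proof.
move=> cf f0.
have F' : ((fun x : R => x + c)^`())%classic = cst 1.
  apply/funext => x; rewrite derive1E deriveD// derive_id derive_cst addr0//.
have dF x : derivable (fun x : R => x + c) x 1 by apply: derivableD.
rewrite (@increasing_ge0_integration_by_substitutionT _ (fun x => x + c) f) //.
- by apply: eq_integral => x _; rewrite F' /= mulr1.
- by move=> x y; rewrite ltrD2r.
- by rewrite F' => x; exact: cvg_cst.
- by rewrite F'; exact: is_cvg_cst.
- by rewrite F'; exact: is_cvg_cst.
- exact: cvg_addrr_Ny.
- exact: cvg_addrr.
Qed.

Lemma ge0_normal_shift m v f : 0 < v -> continuous f -> (forall x, 0 <= f x) ->
  (\int[normal_law m v]_x (f x)%:E = \int[normal_law 0 v]_x (f (m + x))%:E)%E.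
Proof.
move=> v0 cf f0.
have mf := continuous_measurable_fun cf.
have cfm : continuous (fun x => f (m + x)).
  move=> x; apply: continuous_comp; last exact: cf.
  by apply: cvgD; [exact: cvg_cst|exact: cvg_id].
have mfm := continuous_measurable_fun cfm.
rewrite ge0_integral_normal; [|exact/measurable_EFinP|by move=> x; rewrite lee_fin].
rewrite ge0_integral_normal; [|exact/measurable_EFinP|by move=> x; rewrite lee_fin].
under eq_integral do rewrite -EFinM.
rewrite (@ge0_integral_shift (fun x => f x * normal_pdf m (Num.sqrt v) x) m).
- apply: eq_integral => x _; rewrite -EFinM !normal_pdf_sqrtE// addrC.
  by rewrite (addrC m) addrK subr0.
- move=> x; apply: cvgM; first exact: cf.
  by apply: continuous_normal_pdf; exact: sd_neq0.
- by move=> x; rewrite mulr_ge0// normal_pdf_ge0.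
Qed.

(** For independent Y ~ N(0, s) and Z ~ N(0, t), the joint density of (Y, Y + Z) at (y, w) is
    factored in two ways; on the right stand the density of the sum and the conditional density of Y
    given the sum. The algebra is completing the square. *)
Lemma normal_pdf_mul (s t y w : R) : 0 < s -> 0 < t ->
  normal_pdf 0 (Num.sqrt s) y * normal_pdf y (Num.sqrt t) w =
  normal_pdf 0 (Num.sqrt (s + t)) w *
  normal_pdf (w * s / (s + t)) (Num.sqrt (s * t / (s + t))) y.
Proof.
move=> s0 t0; have st0 : 0 < s + t by rewrite addr_gt0.
have r0 : 0 < s * t / (s + t) by rewrite divr_gt0// mulr_gt0.
rewrite !normal_pdf_sqrtE//.
rewrite mulrACA [RHS]mulrACA -!expRD -!invfM -!sqrtrM; last 2 first.
- by rewrite mulrn_wge0// mulr_ge0 ?pi_ge0// ltW.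
- by rewrite mulrn_wge0// mulr_ge0 ?pi_ge0// ltW.
congr ((Num.sqrt _)^-1 * expR _); field.
  by rewrite gt_eqF.
by rewrite !gt_eqF.
Qed.

Lemma ge0_normal_convolution (s t : R) f : 0 < s -> 0 < t ->
  continuous f -> (forall x, 0 <= f x) ->
  (\int[normal_law 0 s]_y \int[normal_law 0 t]_z (f (y + z))%:E =
   \int[normal_law 0 (s + t)]_w (f w)%:E)%E.
Proof.
move=> s0 t0 cf f0; have st0 : 0 < s + t by rewrite addr_gt0.
have r0 : 0 < s * t / (s + t) by rewrite divr_gt0// mulr_gt0.
have mf := continuous_measurable_fun cf.
under eq_integral do rewrite -ge0_normal_shift//.
have mpdf : measurable_fun [set: R * R]
    (fun z : R * R => normal_pdf z.1 (Num.sqrt t) z.2).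
  under eq_fun do rewrite normal_pdf_sqrtE//.
  apply: measurable_funM => //; apply: measurableT_comp => //.
  apply: measurable_funM => //; apply: measurableT_comp => //.
  apply: measurable_funX; apply: measurable_funB; [exact: measurable_snd|exact: measurable_fst].
pose F := fun z : R * R => ((f z.2)%:E * (normal_pdf z.1 (Num.sqrt t) z.2)%:E *
   (normal_pdf 0 (Num.sqrt s) z.1)%:E)%E.
have mF0 : measurable_fun [set: R * R] (fun z : R * R =>
   ((f z.2)%:E * (normal_pdf z.1 (Num.sqrt t) z.2)%:E)%E).
  apply: emeasurable_funM; apply/measurable_EFinP => //.
  apply: measurableT_comp => //; exact: measurable_snd.
have mF : measurable_fun setT F.
  apply: emeasurable_funM => //.
  apply/measurable_EFinP; apply: measurableT_comp; last exact: measurable_fst.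
  exact: measurable_normal_pdf.
have F0 z : (0 <= F z)%E by rewrite /F -!EFinM lee_fin !mulr_ge0// normal_pdf_ge0.
(* In the coordinates y and w = y + z, Tonelli lets y be integrated first; by [normal_pdf_mul] that
   integral is the mass 1 of a conditional normal density. *)
transitivity (\int[leb]_y \int[leb]_w F (y, w))%E.
  have H y : (\int[normal_law y t]_w (f w)%:E =
      \int[leb]_w ((f w)%:E * (normal_pdf y (Num.sqrt t) w)%:E))%E.
    by rewrite ge0_integral_normal//; exact/measurable_EFinP.
  under eq_integral do rewrite H.
  rewrite ge0_integral_normal; last 2 first.
  - apply: (@measurable_fun_fubini_tonelli_F _ _ _ _ _ leb (fun z : R * R =>
     ((f z.2)%:E * (normal_pdf z.1 (Num.sqrt t) z.2)%:E)%E)) => //.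
    by move=> z; rewrite -EFinM lee_fin mulr_ge0// normal_pdf_ge0.
  - move=> x; apply: integral_ge0 => w _.
    by rewrite -EFinM lee_fin mulr_ge0// normal_pdf_ge0.
  apply: eq_integral => y _.
  rewrite -ge0_integralZr//.
  - apply: emeasurable_funM; apply/measurable_EFinP => //.
    exact: measurable_normal_pdf.
  - by move=> x _; rewrite -EFinM lee_fin mulr_ge0// normal_pdf_ge0.
  - by rewrite lee_fin normal_pdf_ge0.
rewrite (@fubini_tonelli _ _ _ _ _ leb leb F)//.
rewrite ge0_integral_normal; [|exact/measurable_EFinP|by move=> x; rewrite lee_fin].
apply: eq_integral => w _.
under eq_integral => y _.
  rewrite /F/= -muleA -!EFinM (mulrC (normal_pdf y _ w)) normal_pdf_mul// mulrA EFinM.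
  over.
rewrite ge0_integralZl//.
- by rewrite integral_normal_pdf mule1.
- by apply/measurable_EFinP; exact: measurable_normal_pdf.
- by move=> y _; rewrite lee_fin normal_pdf_ge0.
- by rewrite lee_fin mulr_ge0// normal_pdf_ge0.
Qed.

End gaussian.

Section ftc_line.
Context {R : realType}.
Local Notation leb := (@lebesgue_measure R).

(** The fundamental theorem on [-(n+1), n+1], passed to the limit by dominated convergence; n + 1
    keeps the interval nondegenerate. The first two normal moments are computed with it. *)
Lemma integral_derive_line (f F : R -> R) : continuous f ->
  (forall x : R, is_derive x 1 F (f x)) -> leb.-integrable setT (EFin \o f) ->
  F n%:R @[n --> \oo] --> 0 -> F (- n%:R) @[n --> \oo] --> 0 ->
  (\int[leb]_x (f x)%:E = 0)%E.
Proof.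
move=> cf dF intf F1 F2.
have cF : continuous F.
  move=> x; apply: differentiable_continuous; apply/derivable1_diffP.
  by case: (dF x).
pose f_ n := (EFin \o f) \_ `[(- n.+1%:R) : R, n.+1%:R].
have mf : measurable_fun setT (EFin \o f) by case/integrableP : intf.
have mf_ n : measurable_fun setT (f_ n).
  apply/(measurable_restrictT _ _).1 => //.
  exact: measurable_funS mf.
have [||_ _] := @dominated_convergence _ _ _ leb setT measurableT f_ (EFin \o f)
  (abse \o (EFin \o f)) mf_ mf _ (integrable_abse intf).
- apply: aeW => x _; apply: (@cvg_trans _ (cst (f x)%:E @ \oo)); last exact: cvg_cst.
  apply: near_eq_cvg; near=> n; rewrite /f_ patchE mem_set//=.
  rewrite in_itv/= -ler_norml; near: n.
  have [k kx] : exists k : nat, `|x| <= k%:R.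
    by exists (truncn `|x|).+1; rewrite ltW// truncnS_gt.
  exists k => // n /= kn; rewrite (le_trans kx)// ler_nat.
  exact: leq_trans kn _.
- apply: aeW => x n _; rewrite /f_ patchE; case: ifPn => _ //=.
  by rewrite lee_fin normr0 normr_ge0.
rewrite /= => H; have {}H := cvg_lim _ H.
rewrite -H//; apply: cvg_lim => //.
have E n : (\int[leb]_x f_ n x = (F n.+1%:R - F (- n.+1%:R))%:E)%E.
  rewrite -[LHS]integral_mkcond EFinB (@continuous_FTC2 _ f F)//.
  - by rewrite gtrN.
  - exact: continuous_subspaceT.
  - split; first by move=> x _; case: (dF x).
    + by apply: cvg_at_right_filter; exact: cF.
    + by apply: cvg_at_left_filter; exact: cF.
  - by move=> x _; rewrite derive1E; case: (dF x).
under eq_fun do rewrite E.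
apply: (@cvg_comp _ _ _ (fun n => F n.+1%:R - F (- n.+1%:R)) EFin _ (nbhs (0:R))) => //.
rewrite -(subr0 0); apply: cvgB.
  by rewrite (cvg_shiftS (fun n => F n%:R)).
by rewrite (cvg_shiftS (fun n => F (- n%:R))).
Unshelve. all: by end_near. Qed.

End ftc_line.

Section gaussian_moments.
Context {R : realType}.
Local Notation leb := (@lebesgue_measure R).
Variable v : R.
Hypothesis v0 : 0 < v.
Local Notation N := (normal_law 0 v).

(** Completing the square turns exp(t y) times the N(0, v) density into exp(t^2 v / 2) times the N(t
    v, v) density, whose mass is 1. *)
Lemma normal_mgf (t : R) :
  (\int[N]_y (expR (t * y))%:E = (expR (t ^+ 2 * v / 2))%:E)%E.
Proof.
have me : measurable_fun setT (fun y : R => expR (t * y)).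
  by apply: measurableT_comp => //; apply: measurable_funM.
rewrite ge0_integral_normal; last 2 first.
- exact/measurable_EFinP.
- by move=> y; rewrite lee_fin expR_ge0.
rewrite -[RHS]mule1 -(integral_normal_pdf (t * v) (Num.sqrt v)) -ge0_integralZl//.
- apply: eq_integral => y _; rewrite -!EFinM !normal_pdf_sqrtE//.
  rewrite mulrCA [in RHS]mulrCA -!expRD; congr ((_ * expR _)%:E).
  by field; rewrite gt_eqF.
- by apply/measurable_EFinP; exact: measurable_normal_pdf.
- by move=> y _; rewrite lee_fin normal_pdf_ge0.
Qed.

(* [(z / 4) ^+ 4 <= expR z] for [z >= 0], and 4 ^ 4 = 256. *)
Let expR_ge_pow4 (z : R) : z ^+ 4 <= 256 * (expR z + expR (- z)).
Proof.
wlog z0 : z / 0 <= z.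
  move=> W; have [|/ltW z0] := leP 0 z; first exact: W.
  have := W (- z); rewrite oppr_ge0 opprK => /(_ z0).
  by rewrite (_ : (- z) ^+ 4 = z ^+ 4) 1?[X in _ * X]addrC//; ring.
have : (z / 4) ^+ 4 <= expR (z / 4) ^+ 4.
  rewrite lerXn2r ?nnegrE ?expR_ge0 ?divr_ge0//.
  by rewrite (le_trans _ (expR_ge1Dx _))// lerDr.
rewrite -expRM_natl (_ : 4%:R * (z / 4) = z) => [h|]; last by field.
have : z ^+ 4 / 256 <= expR z + expR (- z).
  rewrite (le_trans _ (le_trans h _))// ?lerDl ?expR_ge0//.
  by rewrite expr_div_n -natrX.
by rewrite ler_pdivrMr// mulrC.
Qed.

(** At the scale 1 / sqrt v both exponentials integrate to the constant exp(1/2), so the fourth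
    moment comes out of order v^2. *)
Lemma pow4_le_mgf (y : R) : y ^+ 4 <= 256 * v ^+ 2 *
  (expR ((Num.sqrt v)^-1 * y) + expR (- (Num.sqrt v)^-1 * y)).
Proof.
have s0 : 0 < Num.sqrt v by rewrite sqrtr_gt0.
have := expR_ge_pow4 ((Num.sqrt v)^-1 * y).
rewrite -mulNr exprMn exprVn (_ : Num.sqrt v ^+ 4 = v ^+ 2); last first.
  by rewrite -[in RHS](@sqr_sqrtr _ v) ?ltW// -exprM.
by rewrite ler_pdivrMl ?exprn_gt0// mulrA (mulrC (v ^+ 2)).
Qed.

Let mX k : measurable_fun setT (fun y : R => y ^+ k).
Proof. exact: measurable_funX. Qed.

Lemma integrable_expR_normal (t : R) :
  N.-integrable setT (EFin \o (fun y : R => expR (t * y))).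
Proof.
apply/integrableP; split.
  by apply/measurable_EFinP; apply: measurableT_comp => //; apply: measurable_funM.
under eq_integral do rewrite /= ger0_norm ?expR_ge0//.
by rewrite normal_mgf ltry.
Qed.

Let dom := fun y : R => 256 * v ^+ 2 *
  (expR ((Num.sqrt v)^-1 * y) + expR (- (Num.sqrt v)^-1 * y)).

Let integrable_dom : N.-integrable setT (EFin \o dom).
Proof. by apply: integrableZR; apply: integrableDR; exact: integrable_expR_normal. Qed.

Lemma integrable_normal_pow4 : N.-integrable setT (EFin \o (fun y : R => y ^+ 4)).
Proof.
apply: le_integrableR integrable_dom => // y.
have y40 : 0 <= y ^+ 4 by rewrite exprn_even_ge0.
by rewrite (ger0_norm y40) (le_trans (pow4_le_mgf y))// ler_norm.
Qed.

(** 512 = 2 * 256 counts the two exponentials. What matters is the order v^2: n normal steps of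
    variance V / n then contribute O(1 / n) to the Taylor remainder. *)
Lemma normal_moment4 : \int[N]_y (y ^+ 4) <= 512 * expR (2^-1) * v ^+ 2.
Proof.
apply: (@le_trans _ _ (\int[N]_y dom y)).
  apply: le_Rintegral => //; first exact: integrable_normal_pow4.
  by move=> y _; exact: pow4_le_mgf.
have mgf t : t ^+ 2 = v^-1 -> \int[N]_y (expR (t * y)) = expR 2^-1.
  move=> tv; rewrite /Rintegral normal_mgf//= tv mulVf ?gt_eqF//.
  by rewrite div1r.
rewrite /dom RintegralZl//; last by apply: integrableDR; exact: integrable_expR_normal.
rewrite RintegralD//; [|exact: integrable_expR_normal..].
have sv : (Num.sqrt v)^-1 ^+ 2 = v^-1 by rewrite exprVn sqr_sqrtr// ltW.
rewrite !mgf ?sqrrN//.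
by rewrite le_eqVlt; apply/orP; left; apply/eqP; ring.
Qed.

Let integrable_pow k : (k <= 4)%N -> N.-integrable setT (EFin \o (fun y : R => y ^+ k)).
Proof.
move=> k4.
have I : N.-integrable setT (EFin \o ((fun=> 1) \+ (fun y : R => y ^+ 4))).
  by apply: integrableDR; [exact: integrable_cstR|exact: integrable_normal_pow4].
apply: le_integrableR I => // y /=.
have y40 : 0 <= y ^+ 4 by rewrite exprn_even_ge0.
rewrite [leRHS]ger0_norm ?addr_ge0// normrX.
have [y1|y1] := leP `|y| 1.
  by rewrite (@le_trans _ _ 1)// ?exprn_ile1// lerDl.
have -> : y ^+ 4 = `|y| ^+ 4 by rewrite -normrX ger0_norm.
by rewrite (@le_trans _ _ (`|y| ^+ 4))// ?lerDr// ler_weXn2l// ltW.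
Qed.

Lemma integrable_normal_id : N.-integrable setT (EFin \o (fun y : R => y)).
Proof. exact: (@integrable_pow 1). Qed.

Lemma integrable_normal_sqr : N.-integrable setT (EFin \o (fun y : R => y ^+ 2)).
Proof. exact: integrable_pow. Qed.

Lemma integrable_normal_density (f : R -> R) : N.-integrable setT (EFin \o f) ->
  leb.-integrable setT (EFin \o (fun x => f x * normal_pdf 0 (Num.sqrt v) x)).
Proof.
apply: (@integrable_density _ _ _ leb (normal_prob 0 (Num.sqrt v))) => //.
- exact: measurable_normal_pdf.
- by move=> x; exact: normal_pdf_ge0.
Qed.

Lemma Rintegral_normal (f : R -> R) : measurable_fun setT f ->
  \int[N]_x f x = \int[leb]_x (f x * normal_pdf 0 (Num.sqrt v) x).
Proof.
apply: (@Rintegral_density _ _ _ leb (normal_prob 0 (Num.sqrt v))) => //.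
- exact: measurable_normal_pdf.
- by move=> x; exact: normal_pdf_ge0.
Qed.

Local Notation phi := (normal_pdf 0 (Num.sqrt v)).

Let phiE : phi = fun x => (Num.sqrt (v * pi *+ 2))^-1 * expR (- x ^+ 2 / (v *+ 2)).
Proof. by apply/funext => x; rewrite normal_pdf_sqrtE// subr0. Qed.

Let dphi (x : R) : is_derive x 1 phi (- (x / v) * phi x).
Proof.
rewrite phiE; apply: is_derive_eq.
rewrite /GRing.scale/=; move: (_^-1) (expR _) => c e.
by field; rewrite gt_eqF.
Qed.

Let cphi : continuous phi.
Proof. by apply: continuous_normal_pdf; rewrite gt_eqF// sqrtr_gt0. Qed.

(** From exp u >= 1 + u at u = x^2 / (2 v), the product x^2 exp(-u) is at most 2 v. Hence x phi(x)
    is O(1 / |x|) and the boundary terms below vanish. *)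
Let phi_tail (x : R) : `|x * phi x| * `|x| <= (Num.sqrt (v * pi *+ 2))^-1 * (v *+ 2).
Proof.
set c := _^-1.
have c0 : 0 <= c by rewrite invr_ge0 sqrtr_ge0.
rewrite normrM (ger0_norm (normal_pdf_ge0 _ _ _)) mulrAC -normrM -expr2.
rewrite (ger0_norm (sqr_ge0 _)) phiE -/c mulrCA ler_wpM2l//.
rewrite mulNr expRN ler_pdivrMr ?expR_gt0//.
have v20 : 0 < v *+ 2 by rewrite mulrn_wgt0.
have := expR_ge1Dx (x ^+ 2 / (v *+ 2)).
rewrite -(ler_pM2l v20); apply: le_trans.
by rewrite mulrDr mulr1 mulrCA divff ?gt_eqF// mulr1 lerDr ltW.
Qed.

Let phi_even x : phi (- x) = phi x.
Proof. by rewrite phiE sqrrN. Qed.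

Let phi_tail0 : (fun n : nat => n%:R * phi n%:R) @ \oo --> 0.
Proof.
apply: (@squeeze_cvgr _ _ _ _ (fun=> 0)
  (fun n : nat => (Num.sqrt (v * pi *+ 2))^-1 * (v *+ 2) * n%:R^-1)).
- near=> n; have n0 : 0 < n%:R :> R by rewrite ltr0n; near: n; exists 1%N.
  rewrite mulr_ge0 ?normal_pdf_ge0//= ler_pdivlMr//.
  have := phi_tail n%:R; rewrite (gtr0_norm n0).
  by rewrite ger0_norm// mulr_ge0 ?normal_pdf_ge0.
- exact: cvg_cst.
- rewrite -[X in _ --> X](mulr0 ((Num.sqrt (v * pi *+ 2))^-1 * (v *+ 2))).
  apply: cvgM; first exact: cvg_cst.
  by apply/gtr0_cvgV0; [near=> n; rewrite ltr0n; near: n; exists 1%N|exact: cvgr_idn].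
Unshelve. all: by end_near. Qed.

Let phi0 : (fun n : nat => phi n%:R) @ \oo --> 0.
Proof.
apply: (@squeeze_cvgr _ _ _ _ (fun=> 0) (fun n : nat => n%:R * phi n%:R)) => //.
- near=> n; have n1 : 1 <= n%:R :> R by rewrite ler1n; near: n; exists 1%N.
  by rewrite normal_pdf_ge0/= ler_peMl// normal_pdf_ge0.
- exact: cvg_cst.
Unshelve. all: by end_near. Qed.

Lemma normal_mean0 : \int[N]_y y = 0.
Proof.
rewrite Rintegral_normal// /Rintegral.
have dF (x : R) : is_derive x 1 (fun x => - v * phi x) (x * phi x).
  have := dphi x => ?; apply: is_derive_eq.
  by rewrite /GRing.scale/= ?mulr0 ?addr0; field; rewrite gt_eqF.
rewrite (integral_derive_line _ dF)//.
- by move=> x; apply: cvgM; [exact: cvg_id|exact: cphi].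
- exact: (integrable_normal_density integrable_normal_id).
- rewrite -[X in _ --> X](mulr0 (- v)); apply: cvgM; first exact: cvg_cst.
  exact: phi0.
- rewrite -[X in _ --> X](mulr0 (- v)); apply: cvgM; first exact: cvg_cst.
  by under eq_fun do rewrite phi_even; exact: phi0.
Qed.

Lemma normal_variance : \int[N]_y (y ^+ 2) = v.
Proof.
apply/eqP; rewrite -subr_eq0 -[X in _ - X](@Rintegral_cstT _ _ _ N) -RintegralB//; last 2 first.
- exact: integrable_normal_sqr.
- exact: integrable_cstR.
apply/eqP.
have I : N.-integrable setT (EFin \o ((fun y : R => y ^+ 2) \- (fun=> v))).
  by apply: integrableBR; [exact: integrable_normal_sqr|exact: integrable_cstR].
rewrite (@Rintegral_normal (fun y => y ^+ 2 - v)); last first.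
  by apply: measurable_funB.
(* Integration by parts in closed form: - v y phi is an antiderivative of (y^2 - v) phi, so y^2 - v
   integrates to 0. *)
have dF (x : R) : is_derive x 1 (fun x => - v * (x * phi x)) ((x ^+ 2 - v) * phi x).
  have := dphi x => ?; apply: is_derive_eq.
  by rewrite /GRing.scale/= ?mulr0 ?addr0 ?mulr1; field; rewrite gt_eqF.
rewrite /Rintegral (integral_derive_line _ dF)//.
- move=> x; apply: cvgM; last exact: cphi.
  by apply: cvgB; [exact: sqr_continuous|exact: cvg_cst].
- exact: (integrable_normal_density I).
- rewrite -[X in _ --> X](mulr0 (- v)); apply: cvgM; first exact: cvg_cst.
  exact: phi_tail0.
- rewrite -[X in _ --> X](mulr0 (- v)); apply: cvgM; first exact: cvg_cst.
  under eq_fun do rewrite phi_even mulNr.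
  have := cvgN phi_tail0; rewrite oppr0; apply.
Qed.

End gaussian_moments.

(** * Trotter's proof of Lindeberg's theorem *)

Section test_functions.
Context {R : realType}.
Implicit Types f g : R -> R.

Definition ucont f := forall e, 0 < e ->
  exists2 dl, 0 < dl & forall x y, `|x - y| <= dl -> `|f x - f y| <= e.

Definition compact_supp f := continuous f /\
  exists A : R, forall x, A < `|x| -> f x = 0.

Lemma ucont_continuous f : ucont f -> continuous f.
Proof.
move=> uf x; apply/cvgrPdist_le => e e0.
have [dl dl0 H] := uf e e0; near=> y; apply: H.
by near: y; apply: cvgr_dist_le => //; exact: cvg_id.
Unshelve. all: by end_near. Qed.

Lemma compact_supp_bounded f : compact_supp f ->
  exists2 M, 0 <= M & forall x, `|f x| <= M.
Proof.
move=> [cf [A fA]].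
have [M [_ H]] : bounded_set (f @` `[-A, A]).
  apply: compact_bounded; apply: continuous_compact; last exact: segment_compact.
  exact: continuous_subspaceT.
exists (`|M| + 1); first by rewrite addr_ge0.
move=> x; have [xA|/fA ->] := leP `|x| A; last by rewrite normr0 addr_ge0.
apply: (H (`|M| + 1)); first by rewrite ltr_pwDr// ler_norm.
by exists x => //=; rewrite in_itv/= -ler_norml.
Qed.

(** Compactness of [-A, A] yields one radius valid at all its points. A pair with a point inside is
    handled there; a pair outside has both values 0. *)
Lemma compact_supp_ucont f : compact_supp f -> ucont f.
Proof.
move=> [cf [A fA]] e e0.
have /compact_near_coveringP cK := @segment_compact R (- A) A.
have : \forall d \near 0^'+, `[-A, A] `<=`
    (fun x => forall y, `|x - y| <= d -> `|f x - f y| <= e).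
  apply: cK => x _.
  have /cvgrPdist_le/(_ (e / 2)) := cf x; rewrite divr_gt0// => /(_ isT).
  case=> r /= r0 H.
  near=> x' d.
  have xx' : `|x - x'| < r / 2.
    near: x'; exists (r / 2) => /=; first by rewrite divr_gt0.
    by move=> z.
  have dr : d <= r / 2 by near: d; apply: nbhs_right_le; rewrite divr_gt0.
  move=> y x'y.
  have xy : `|x - y| < r.
    rewrite (le_lt_trans (ler_distD x' _ _))// [ltRHS]splitr ltr_leD//.
    exact: le_trans dr.
  rewrite (le_trans (ler_distD (f x) _ _))// [leRHS]splitr lerD//.
    rewrite distrC; apply: H => /=; rewrite (lt_le_trans xx')//.
    by rewrite ler_pdivrMr// ler_peMr ?ltW// ltrDr.
  by apply: H.
move=> near_d; near (0 : R)^'+ => d; exists d => //.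
have Hd : `[-A, A] `<=` (fun x => forall y, `|x - y| <= d -> `|f x - f y| <= e).
  by near: d.
move=> x y xy; have [xA|xA] := leP `|x| A.
  by apply: Hd => //; rewrite /= in_itv/= -ler_norml.
have [yA|yA] := leP `|y| A.
  by rewrite distrC; apply: Hd; rewrite ?[`|y - x|]distrC//= in_itv/= -ler_norml.
by rewrite !fA// subrr normr0 ltW.
Unshelve. all: by end_near. Qed.

Lemma compact_supp_integrable f : compact_supp f ->
  (@lebesgue_measure R).-integrable setT (EFin \o f).
Proof.
move=> cf; have [M M0 fM] := compact_supp_bounded cf.
case: cf => cf [A fA].
have mf := continuous_measurable_fun cf.
have -> : EFin \o f = (EFin \o f) \_ `[- A, A].
  apply/funext => x; rewrite patchE; case: ifPn => //.
  rewrite notin_setE/= in_itv/= -ler_norml => /negP; rewrite -ltNge => /fA ->.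
  by [].
apply/(integrable_mkcond _ _).1 => //.
apply: continuous_compact_integrable => //; first exact: segment_compact.
exact: continuous_subspaceT.
Qed.

Lemma compact_supp_antiderivative f : compact_supp f ->
  exists G : R -> R, forall x : R, is_derive x 1 G (f x).
Proof.
move=> cf; have fi := compact_supp_integrable cf.
exists (fun x => \int[lebesgue_measure]_(t in `]-oo, x]) f t) => x.
have [||||] := @continuous_FTC1 R f -oo%O x (x + 1).
- by rewrite ltrDl.
- exact: integrableS fi.
- by rewrite ltNyr.
- exact: cf.1.
- move=> dF dE; apply: DeriveDef => //.
  by rewrite -dE derive1E.
Qed.

Lemma mvt_le (g g' : R -> R) (c y : R) : (forall x : R, is_derive x 1 g (g' x)) ->
  (forall z, `|z| <= `|y| -> `|g' z| <= c) -> `|g y - g 0| <= c * `|y|.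
Proof.
move=> dg bg.
have cg : continuous g.
  by move=> x; apply/differentiable_continuous/derivable1_diffP; case: (dg x).
have [y0|y0|->] := ltgtP y 0; last by rewrite subrr !normr0 mulr0.
- have [|z] := @MVT R g g' y 0 y0 (fun x _ => dg x).
    exact: continuous_subspaceT.
  rewrite in_itv/= => /andP[yz z0] E; rewrite distrC E normrM sub0r normrN.
  rewrite ler_wpM2r// bg// !ltr0_norm ?lerN2 ?ltW//.
- have [|z] := @MVT R g g' 0 y y0 (fun x _ => dg x).
    exact: continuous_subspaceT.
  rewrite in_itv/= => /andP[z0 zy] E; rewrite E normrM subr0.
  by rewrite ler_wpM2r// bg// !gtr0_norm// ltW.
Qed.

(* F is the average of f over a short window; averaging twice gives a function
   with a uniformly continuous second derivative. *)
Lemma smoothing f (e : R) : 0 < e -> compact_supp f ->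
  exists F (c : R), [/\ compact_supp F, 0 < c, forall x, `|F x - f x| <= e &
    forall x : R, is_derive x 1 F (c^-1 * (f (x + c) - f x))].
Proof.
move=> e0 cf; have [dl dl0 fdl] := compact_supp_ucont cf e0.
have [G dG] := compact_supp_antiderivative cf.
pose F x := dl^-1 * (G (x + dl) - G x).
have dF (x : R) : is_derive x 1 F (dl^-1 * (f (x + dl) - f x)).
  have := dG x => ?.
  have dGd : is_derive x 1 (fun x => G (x + dl)) (f (x + dl)).
    have := @is_derive1_comp R G (fun x => x + dl) x _ _ (dG (x + dl)) _.
    by move=> /(_ 1 _); rewrite mulr1; apply; apply: is_derive_eq; rewrite addr0.
  apply: is_derive_eq.
  by rewrite /GRing.scale/=.
(* By the mean value theorem the average [F x] is a value of f inside the window; closeness to f and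
   compact support both follow from this. *)
have Fmv x : exists2 z, x < z < x + dl & F x = f z.
  have [||z] := @MVT R G f x (x + dl) _ (fun x _ => dG x).
  - by rewrite ltrDl.
  - apply: continuous_subspaceT => y.
    by apply/differentiable_continuous/derivable1_diffP; case: (dG y).
  rewrite in_itv/= => xz E; exists z => //.
  by rewrite /F E (addrC x) addrK mulrCA mulVf ?mulr1// gt_eqF.
have cF : continuous F.
  by move=> x; apply/differentiable_continuous/derivable1_diffP; case: (dF x).
exists F, dl; split => //.
  case: cf => _ [A fA]; split => //; exists (A + dl) => x xA.
  have [z /andP[xz zx] ->] := Fmv x; apply: fA.
  move: xA; rewrite -ltrBrDr => /lt_le_trans; apply.
  rewrite lerBlDr -{1}(subrK z x) (le_trans (ler_normD _ _))// addrC lerD2l.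
  by rewrite ltr0_norm ?subr_lt0// opprB lerBlDr addrC ltW.
move=> x; have [z /andP[xz zx] ->] := Fmv x; apply: fdl.
by rewrite gtr0_norm ?subr_gt0// lerBlDr addrC ltW.
Qed.

End test_functions.

Section taylor.
Context {R : realType}.

(** For |y| <= dl the modulus of continuity of F2 bounds the error by e y^2; for |y| > dl the sup
    bound gives 2 K y^2, which is at most 2 K y^4 / dl^2. Adding the two cases leaves a bound that
    can be integrated without truncation. *)
Lemma taylor2 (F F1 F2 : R -> R) (x y e dl K : R) :
  (forall x : R, is_derive x 1 F (F1 x)) ->
  (forall x : R, is_derive x 1 F1 (F2 x)) -> 0 < dl -> 0 <= e ->
  (forall a b, `|a - b| <= dl -> `|F2 a - F2 b| <= e) ->
  (forall a, `|F2 a| <= K) ->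
  `|F (x + y) - F x - F1 x * y - F2 x / 2 * y ^+ 2| <=
  e * y ^+ 2 + 2 * K / dl ^+ 2 * y ^+ 4.
Proof.
move=> dF dF1 dl0 e0 F2e F2K.
have K0 : 0 <= K by exact: le_trans (F2K 0).
have shift (H H1 : R -> R) : (forall x : R, is_derive x 1 H (H1 x)) ->
    forall z : R, is_derive z 1 (fun z => H (x + z)) (H1 (x + z)).
  move=> dH z; have := @is_derive1_comp R H (fun z => x + z) z _ _ (dH (x + z)) _.
  by move=> /(_ 1 _); rewrite mulr1; apply; apply: is_derive_eq; rewrite add0r mulr1.
(* Here c bounds the oscillation of F2 around x; applying the mean value bound twice turns it into c
   y^2. *)
suff main c : 0 <= c -> (forall z, `|z| <= `|y| -> `|F2 (x + z) - F2 x| <= c) ->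
    `|F (x + y) - F x - F1 x * y - F2 x / 2 * y ^+ 2| <= c * y ^+ 2.
  have y20 : 0 <= y ^+ 2 by exact: sqr_ge0.
  have y40 : 0 <= y ^+ 4 by rewrite exprn_even_ge0.
  have [ydl|ydl] := leP `|y| dl.
    apply: (@le_trans _ _ (e * y ^+ 2)).
      apply: main => // z zy; apply: F2e; rewrite addrC addKr.
      exact: le_trans ydl.
    by rewrite lerDl mulr_ge0// divr_ge0 ?sqr_ge0// mulr_ge0.
  apply: (@le_trans _ _ (2 * K * y ^+ 2)).
    apply: main => [|z _]; first by rewrite mulr_ge0.
    by rewrite (le_trans (ler_normB _ _))// mulr_natl mulr2n lerD.
  apply: ler_wpDl; first by rewrite mulr_ge0.
  rewrite -!mulrA ler_wpM2l// ler_wpM2l// ler_pdivlMl ?exprn_gt0//.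
  rewrite (_ : 4 = 2 + 2)%N// exprD ler_wpM2r//.
  by rewrite -(@real_normK _ y) ?num_real// lerXn2r ?nnegrE// ?ltW.
move=> c0 Fc.
pose g1 z := F1 (x + z) - F1 x - F2 x * z.
pose g z := F (x + z) - F x - F1 x * z - F2 x / 2 * z ^+ 2.
have dg (z : R) : is_derive z 1 g (g1 z).
  have := shift _ _ dF z => ?; apply: is_derive_eq.
  by rewrite /GRing.scale/= /g1; field.
have dg1 (z : R) : is_derive z 1 g1 (F2 (x + z) - F2 x).
  have := shift _ _ dF1 z => ?; apply: is_derive_eq.
  by rewrite /GRing.scale/=; field.
have g00 : g 0 = 0 by rewrite /g addr0 subrr; ring.
have g10 : g1 0 = 0 by rewrite /g1 addr0 subrr; ring.
rewrite -/(g y) -[g y]subr0 -g00 -(@real_normK _ y) ?num_real// expr2 mulrA.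
apply: mvt_le dg _ => z zy.
rewrite -[g1 z]subr0 -g10 (le_trans (mvt_le (c := c) dg1 _))//.
  by move=> w wz; apply: Fc; exact: le_trans zy.
by rewrite ler_wpM2l.
Qed.

End taylor.

Section translation_operator.
Context {d : measure_display} {T : measurableType d} {R : realType}.
Variables (P : probability T R) (X : T -> R).
Hypothesis mX : measurable_fun setT X.
Implicit Types f g : R -> R.

(** The convolution operator of the law of X, as in Trotter's argument: composing the operators of
    independent variables gives the operator of their sum. *)
Definition trop {d : measure_display} {T : measurableType d}
  (P : probability T R) (X : T -> R) f : R -> R := fun x => \int[P]_o f (x + X o).

(** A class of test functions that [trop] maps into itself, so that iterates can be formed; compact
    support would be lost after one step. *)
Definition bucont f := ucont f /\ exists M, forall x, `|f x| <= M.

Lemma compact_supp_bucont f : compact_supp f -> bucont f.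
Proof.
move=> cf; split; first exact: compact_supp_ucont.
by have [M _ fM] := compact_supp_bounded cf; exists M.
Qed.

Lemma bucont_measurable f : bucont f -> measurable_fun setT f.
Proof. by move=> [uf _]; apply: continuous_measurable_fun; exact: ucont_continuous. Qed.

Lemma trop_measurable f x : bucont f -> measurable_fun setT (fun o => f (x + X o)).
Proof.
move=> bf; apply: measurableT_comp; first exact: bucont_measurable.
exact: measurable_funD.
Qed.

Lemma trop_integrable f x : bucont f ->
  P.-integrable setT (EFin \o (fun o => f (x + X o))).
Proof.
move=> bf; have [_ [M fM]] := bf.
by apply: bounded_integrable (trop_measurable x bf) _ => o; exact: fM.
Qed.

Lemma trop_sub f g c : bucont f -> bucont g -> (forall x, `|f x - g x| <= c) ->
  forall x, `|trop P X f x - trop P X g x| <= c.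
Proof.
move=> bf bg fgc x; rewrite /trop -RintegralB//; [|exact: trop_integrable..].
apply: Rintegral_bounded => //.
by apply: measurable_funB; exact: trop_measurable.
Qed.

Lemma bucont_shift f c : bucont f -> bucont (fun x => f (x + c)).
Proof.
move=> [uf [M fM]]; split; last by exists M.
move=> e /uf[dl dl0 H]; exists dl => // x y xy; apply: H.
by rewrite opprD addrACA subrr addr0.
Qed.

Lemma trop_bucont f : bucont f -> bucont (trop P X f).
Proof.
move=> bf; have [uf [M fM]] := bf; split.
  move=> e e0; have [dl dl0 H] := uf e e0; exists dl => // x y xy.
  rewrite /trop -RintegralB//; [|exact: trop_integrable..].
  apply: Rintegral_bounded.
    by apply: measurable_funB; exact: trop_measurable.
  by move=> o; apply: H; rewrite opprD addrACA subrr addr0.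
by exists M => x; apply: Rintegral_bounded => //; exact: trop_measurable.
Qed.

Lemma iter_trop_bucont n f : bucont f -> bucont (iter n (trop P X) f).
Proof. by move=> bf; elim: n => //= n; exact: trop_bucont. Qed.

Lemma iter_trop_sub n f g c : bucont f -> bucont g -> (forall x, `|f x - g x| <= c) ->
  forall x, `|iter n (trop P X) f x - iter n (trop P X) g x| <= c.
Proof.
move=> bf bg fgc; elim: n => //= n IH.
by apply: trop_sub => //; exact: iter_trop_bucont.
Qed.

(** The linear term integrates to zero, so one step of the operator depends on X only through its
    second moment, up to the integrated remainder of [taylor2]. Centered variables of equal variance
    are interchangeable at this order. *)
Lemma trop_taylor (F F1 F2 : R -> R) (x e dl K : R) : bucont F ->
  (forall x : R, is_derive x 1 F (F1 x)) ->
  (forall x : R, is_derive x 1 F1 (F2 x)) -> 0 < dl -> 0 <= e ->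
  (forall a b, `|a - b| <= dl -> `|F2 a - F2 b| <= e) ->
  (forall a, `|F2 a| <= K) ->
  P.-integrable setT (EFin \o X) ->
  P.-integrable setT (EFin \o (fun o => X o ^+ 2)) ->
  P.-integrable setT (EFin \o (fun o => X o ^+ 4)) ->
  \int[P]_o X o = 0 ->
  `|trop P X F x - F x - F2 x / 2 * \int[P]_o (X o ^+ 2)| <=
  e * \int[P]_o (X o ^+ 2) + 2 * K / dl ^+ 2 * \int[P]_o (X o ^+ 4).
Proof.
move=> bF dF dF1 dl0 e0 F2e F2K X1 X2 X4 EX.
have iF := trop_integrable x bF.
have i0 : P.-integrable setT (EFin \o (fun=> F x)) by exact: integrable_cstR.
have i1 := integrableZR (F1 x) X1.
have i2 := integrableZR (F2 x / 2) X2.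
have i3 := integrableBR iF i0.
have i4 := integrableBR i3 i1.
have i5 := integrableBR i4 i2.
have -> : trop P X F x - F x - F2 x / 2 * \int[P]_o (X o ^+ 2) =
    \int[P]_o (F (x + X o) - F x - F1 x * X o - F2 x / 2 * X o ^+ 2).
  rewrite RintegralB// RintegralB// RintegralB// RintegralZl// RintegralZl//.
  by rewrite Rintegral_cstT EX mulr0 subr0.
have j1 := integrableZR e X2.
have j2 := integrableZR (2 * K / dl ^+ 2) X4.
have -> : e * \int[P]_o (X o ^+ 2) + 2 * K / dl ^+ 2 * \int[P]_o (X o ^+ 4) =
    \int[P]_o (e * X o ^+ 2 + 2 * K / dl ^+ 2 * X o ^+ 4).
  by rewrite RintegralD// RintegralZl// RintegralZl.
apply: le_Rintegral_bound => //; first exact: integrableDR.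
by move=> o; exact: taylor2 dF dF1 dl0 e0 F2e F2K.
Qed.

End translation_operator.

Section fubini_bounded.
Context {d1 d2 : measure_display} {T1 : measurableType d1} {T2 : measurableType d2}.
Context {R : realType}.
Variables (P : probability T1 R) (Q : probability T2 R) (f : T1 * T2 -> R) (M : R).
Hypotheses (mf : measurable_fun setT f) (fM : forall z, `|f z| <= M).

Let fi : (P \x Q)%E.-integrable setT (EFin \o f).
Proof. exact: (@bounded_integrable _ _ _ (P \x Q)%E _ M). Qed.

Let inner x : (\int[Q]_y (f (x, y))%:E = (\int[Q]_y f (x, y))%:E)%E.
Proof.
rewrite /Rintegral fineK//; apply: integrable_fin_num => //.
apply: bounded_integrable (fun y => fM (x, y)).
by apply: measurableT_comp => //; exact: pair1_measurable.
Qed.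

Lemma Rintegral_prod : \int[(P \x Q)%E]_z f z = \int[P]_x \int[Q]_y f (x, y).
Proof.
rewrite /Rintegral -integral12_prod_meas1//; congr fine.
by apply: eq_integral => x _; rewrite /fubini_F/= inner.
Qed.

Lemma Rintegral_Fubini :
  \int[P]_x \int[Q]_y f (x, y) = \int[Q]_y \int[P]_x f (x, y).
Proof.
rewrite -Rintegral_prod /Rintegral -integral21_prod_meas1//; congr fine.
apply: eq_integral => y _; rewrite /fubini_G/= fineK//.
apply: integrable_fin_num => //.
apply: bounded_integrable (fun x => fM (x, y)).
by apply: measurableT_comp => //; exact: pair2_measurable.
Qed.

End fubini_bounded.

Section trotter.
Context {d1 d2 : measure_display} {T1 : measurableType d1} {T2 : measurableType d2}.
Context {R : realType}.
Variables (P : probability T1 R) (X : T1 -> R) (Q : probability T2 R) (Y : T2 -> R).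
Hypotheses (mX : measurable_fun setT X) (mY : measurable_fun setT Y).

Lemma trop_commute (f : R -> R) : bucont f ->
  trop P X (trop Q Y f) = trop Q Y (trop P X f).
Proof.
move=> bf; have [uf [M fM]] := bf; apply/funext => x; rewrite /trop.
rewrite (@Rintegral_Fubini _ _ _ _ _ P Q (fun z => f (x + X z.1 + Y z.2)) M)//.
  by apply: eq_Rintegral => y _; apply: eq_Rintegral => z _; rewrite addrAC.
apply: measurableT_comp; first exact: bucont_measurable.
apply: measurable_funD; last first.
  by apply: measurableT_comp => //; exact: measurable_snd.
apply: measurable_funD => //.
by apply: measurableT_comp => //; exact: measurable_fst.
Qed.

Lemma iter_trop_commute n (f : R -> R) : bucont f ->
  trop P X (iter n (trop Q Y) f) = iter n (trop Q Y) (trop P X f).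
Proof.
move=> bf; elim: n => //= n IH; rewrite trop_commute ?IH//.
exact: iter_trop_bucont.
Qed.

(* [A^n - B^n] telescopes into n differences [A - B] between commuting
   contractions. *)
Lemma trotter_le n (f : R -> R) c : bucont f ->
  (forall x, `|trop P X f x - trop Q Y f x| <= c) ->
  forall x, `|iter n (trop P X) f x - iter n (trop Q Y) f x| <= n%:R * c.
Proof.
move=> bf fc; elim: n => [|n IH] x; first by rewrite /= subrr normr0 mul0r.
rewrite [iter n.+1 _ _]iterS [X in _ - X x]iterS.
rewrite (le_trans (ler_distD (trop P X (iter n (trop Q Y) f) x) _ _))//.
rewrite -natr1 mulrDl mul1r lerD//.
  by apply: trop_sub => //; apply: iter_trop_bucont.
rewrite iter_trop_commute// -iterS iterSr.
by apply: iter_trop_sub => //; exact: trop_bucont.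
Qed.

End trotter.

Section iid_integrals.
Context {d : measure_display} {T : measurableType d} {R : realType}.
Variable P : probability T R.

Lemma Rintegral_iid_cons n (g : n.+1.-tuple T -> R) (M : R) :
  measurable_fun setT g -> (forall s, `|g s| <= M) ->
  \int[iid_law P n.+1]_s g s = \int[P]_y \int[iid_law P n]_s g (tuple_cons (y, s)).
Proof.
move=> mg gM.
rewrite -(@Rintegral_prod _ _ _ _ _ P (iid_law P n) (fun z => g (tuple_cons z)) M)//; last first.
  by apply: measurableT_comp => //; exact: measurable_tuple_cons.
rewrite /Rintegral/=; congr fine.
rewrite integral_distribution//=; first exact/measurable_EFinP.
apply: (@bounded_integrable _ _ _ (P \x iid_law P n)%E (g \o @tuple_cons _ _ n) M);
    last by move=> z; exact: gM.
by apply: measurableT_comp => //; exact: measurable_tuple_cons.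
Qed.

Lemma Rintegral_iid0 (g : 0.-tuple T -> R) : measurable_fun setT g ->
  \int[iid_law P 0]_s g s = g [tuple].
Proof.
move=> mg; rewrite /Rintegral/= integral_dirac//; last exact/measurable_EFinP.
by rewrite diracE in_setT mul1e.
Qed.

Variable X : T -> R.
Hypothesis mX : measurable_fun setT X.

Lemma measurable_iid_sum n :
  measurable_fun setT (fun s : n.-tuple T => \sum_(i < n) X (tnth s i)).
Proof.
by apply: measurable_sum => i; apply: measurableT_comp => //; exact: measurable_tnth.
Qed.

Lemma iid_sum_cons n y (s : n.-tuple T) :
  \sum_(i < n.+1) X (tnth (tuple_cons (y, s)) i) = X y + \sum_(i < n) X (tnth s i).
Proof.
rewrite big_ord_recl; congr (_ + _).
by apply: eq_bigr => i _; rewrite /tuple_cons tnthS.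
Qed.

(** Independence enters here: peeling the first coordinate off the product law is one application of
    [trop]. *)
Lemma Rintegral_iid_sum n (f : R -> R) x : bucont f ->
  \int[iid_law P n]_s f (x + \sum_(i < n) X (tnth s i)) = iter n (trop P X) f x.
Proof.
move=> bf; have [uf [M fM]] := bf.
have mf k y : measurable_fun setT
    (fun s : k.-tuple T => f (y + \sum_(i < k) X (tnth s i))).
  apply: measurableT_comp; first exact: bucont_measurable.
  by apply: measurable_funD => //; exact: measurable_iid_sum.
elim: n x => [|n IH] x; first by rewrite Rintegral_iid0// big_ord0 addr0.
rewrite (@Rintegral_iid_cons _ _ M)// iterS; apply: eq_Rintegral => y _.
by rewrite -IH; apply: eq_Rintegral => s _; rewrite iid_sum_cons addrA.
Qed.

End iid_integrals.

Section normal_semigroup.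
Context {R : realType}.
Implicit Types f : R -> R.

Let ntrop (v : R) := trop (normal_law 0 v) (fun x : R => x).

Let ntrop_EFin (v M x : R) (g : R -> R) : bucont g ->
  (\int[normal_law 0 v]_z (g (z + x) + M)%:E = (ntrop v g x + M)%:E)%E.
Proof.
move=> bg; have [_ [C gC]] := bg.
have mf : measurable_fun setT (fun z : R => g (z + x)).
  apply: measurableT_comp; first exact: bucont_measurable.
  exact: measurable_funD.
have fi : (normal_law 0 v).-integrable setT (EFin \o (fun z : R => g (z + x))).
  apply: (@bounded_integrable _ _ _ (normal_law 0 v) (fun z : R => g (z + x)) C mf) => z.
  exact: gC.
transitivity (\int[normal_law 0 v]_z (g (z + x) + M))%:E.
  rewrite /Rintegral fineK//; apply: integrable_fin_num => //.
  by apply: integrableDR => //; exact: integrable_cstR.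
rewrite RintegralD//; last exact: integrable_cstR.
rewrite Rintegral_cstT; congr (_ + _)%:E.
by apply: eq_Rintegral => z _; rewrite addrC.
Qed.

Lemma trop_normal_add (s t : R) f : 0 < s -> 0 < t -> bucont f ->
  ntrop s (ntrop t f) = ntrop (s + t) f.
Proof.
move=> s0 t0 bf; apply/funext => x.
have bx : bucont (fun y => f (y + x)) by exact: bucont_shift.
have [ux [M fM]] := bx.
have cf := ucont_continuous ux.
(* [ge0_normal_convolution] concerns nonnegative functions; adding the bound M makes it applicable,
   and M cancels at the end. *)
have cfM : continuous (fun y => f (y + x) + M).
  by move=> y; apply: cvgD; [exact: cf|exact: cvg_cst].
have fM0 y : 0 <= f (y + x) + M.
  by have := fM y; rewrite ler_norml => /andP[+ _]; rewrite -subr_ge0 opprK.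
have L : (\int[normal_law 0 s]_y \int[normal_law 0 t]_z (f (y + z + x) + M)%:E =
    (ntrop s (ntrop t f) x + M)%:E)%E.
  rewrite -ntrop_EFin; last exact: trop_bucont.
  apply: eq_integral => y _; rewrite -ntrop_EFin//.
  by apply: eq_integral => z _; rewrite (addrC y) addrA.
have E := etrans (esym L) (ge0_normal_convolution s0 t0 cfM fM0).
exact: (addIr M (EFin_inj (etrans E (ntrop_EFin (s + t) M x bf)))).
Qed.

Lemma iter_trop_normal n v f : 0 < v -> bucont f ->
  iter n.+1 (ntrop v) f = ntrop (n.+1%:R * v) f.
Proof.
move=> v0 bf; elim: n => [|n IH].
  by have -> : 1%:R * v = v by exact: mul1r.
have nv0 : 0 < n.+1%:R * v by rewrite mulr_gt0.
have E : v + n.+1%:R * v = n.+2%:R * v by rewrite -[in RHS]natr1; ring.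
exact: (etrans (congr1 (ntrop v) IH)
  (etrans (trop_normal_add v0 nv0 bf) (congr1 (ntrop^~ f) E))).
Qed.

(** N(0, V) is the n-th convolution power of N(0, V / n). The normal integral thus becomes n steps,
    to be compared one by one with those of the sample. *)
Lemma iter_trop_normal_div n V f : (0 < n)%N -> 0 < V -> bucont f ->
  iter n (trop (normal_law 0 (V / n%:R)) (fun x : R => x)) f 0 =
  \int[normal_law 0 V]_y f y.
Proof.
case: n => [//|n] _ V0 bf.
have v0 : 0 < V / n.+1%:R by rewrite divr_gt0.
have E : n.+1%:R * (V / n.+1%:R) = V by rewrite mulrC divfK.
have H : ntrop V f 0 = \int[normal_law 0 V]_y f y.
  by apply: eq_Rintegral => y _; rewrite add0r.
exact: (etrans (congr1 (fun g => g 0)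
  (etrans (iter_trop_normal n v0 bf) (congr1 (ntrop^~ f) E))) H).
Qed.

End normal_semigroup.

Section clt.
Context {d : measure_display} {T : measurableType d} {R : realType}.
Implicit Types f : R -> R.

Lemma bucont_lincomb (a : R) f g : bucont f -> bucont g ->
  bucont (fun x => a * (f x - g x)).
Proof.
move=> [uf [M fM]] [ug [N gN]]; split; last first.
  exists (`|a| * (M + N)) => x; rewrite normrM ler_wpM2l//.
  by rewrite (le_trans (ler_normB _ _))// lerD.
move=> e e0; have e'0 : 0 < e / (2 * (`|a| + 1)).
  by rewrite divr_gt0// mulr_gt0// ltr_wpDl.
have [d1 d10 H1] := uf _ e'0; have [d2 d20 H2] := ug _ e'0.
exists (minr d1 d2); first by rewrite lt_min d10.
move=> x y; rewrite le_min => /andP[/H1 h1 /H2 h2].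
rewrite -mulrBr normrM.
have -> : f x - g x - (f y - g y) = (f x - f y) - (g x - g y) by ring.
apply: (@le_trans _ _ ((`|a| + 1) * (e / (2 * (`|a| + 1)) + e / (2 * (`|a| + 1))))).
  by apply: ler_pM => //; [rewrite lerDl|rewrite (le_trans (ler_normB _ _))// lerD].
by rewrite le_eqVlt; apply/orP; left; apply/eqP; field; rewrite gt_eqF// ltr_wpDl.
Qed.

Lemma smoothing2 f (e : R) : 0 < e -> compact_supp f ->
  exists F F1 F2 : R -> R, [/\ bucont F, bucont F2, forall x, `|F x - f x| <= e,
    forall x : R, is_derive x 1 F (F1 x) & forall x : R, is_derive x 1 F1 (F2 x)].
Proof.
move=> e0 cf; have e20 : 0 < e / 2 by rewrite divr_gt0.
have [G [c [cG c0 Gf dG]]] := smoothing e20 cf.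
have [F [k [cF k0 FG dF]]] := smoothing e20 cG.
pose G' x := c^-1 * (f (x + c) - f x).
have bG' : bucont G'.
  have bf := compact_supp_bucont cf.
  by apply: bucont_lincomb => //; exact: bucont_shift.
exists F, (fun x => k^-1 * (G (x + k) - G x)), (fun x => k^-1 * (G' (x + k) - G' x)).
split => //.
- exact: compact_supp_bucont.
- by apply: bucont_lincomb => //; exact: bucont_shift.
- by move=> x; rewrite (le_trans (ler_distD (G x) _ _))// [leRHS]splitr lerD.
move=> x; have := dG x => ?.
have dGk : is_derive x 1 (fun x => G (x + k)) (G' (x + k)).
  have := @is_derive1_comp R G (fun x => x + k) x _ _ (dG (x + k)) _.
  by move=> /(_ 1 _); rewrite mulr1; apply; apply: is_derive_eq; rewrite addr0.
by apply: is_derive_eq; rewrite /GRing.scale/=.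
Qed.

Variables (Q : nat -> probability T R) (psi : nat -> T -> R) (C V : R).
Hypotheses (mpsi : forall n, measurable_fun setT (psi n)).
Hypothesis psiC : forall n o, `|psi n o| <= C.
Hypothesis psi0 : forall n, \int[Q n]_o psi n o = 0.
Hypothesis psiV : (\int[Q n]_o (psi n o ^+ 2)) @[n --> \oo] --> V.
Hypothesis V0 : 0 < V.

Let S n (s : n.-tuple T) := (Num.sqrt n%:R)^-1 * \sum_(i < n) psi n (tnth s i).

Let C0 : 0 <= C.
Proof. exact: le_trans (psiC 0 point). Qed.

(** Replacing f by its smoothing F costs e on each side, because the operators are contractions. The
    rest is n times a one-step error made of the mismatch of variances, the modulus of continuity of
    F2 and the fourth moments. *)
Let clt_bound f F F1 F2 (e e' dl K : R) n : (0 < n)%N ->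
  compact_supp f -> bucont F -> (forall x, `|F x - f x| <= e) ->
  (forall x : R, is_derive x 1 F (F1 x)) ->
  (forall x : R, is_derive x 1 F1 (F2 x)) -> 0 < dl -> 0 <= e' ->
  (forall a b, `|a - b| <= dl -> `|F2 a - F2 b| <= e') ->
  (forall a, `|F2 a| <= K) ->
  `|\int[iid_law (Q n) n]_s f (S s) - \int[normal_law 0 V]_y f y| <=
  2 * e + (K / 2 * `|\int[Q n]_o (psi n o ^+ 2) - V| +
    e' * (\int[Q n]_o (psi n o ^+ 2) + V) +
    2 * K / dl ^+ 2 * (C ^+ 2 * \int[Q n]_o (psi n o ^+ 2) +
      512 * expR 2^-1 * V ^+ 2) / n%:R).
Proof.
move=> n0 cf bF Ff dF dF1 dl0 e'0 F2e F2K.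
set Vn := \int[Q n]_o (psi n o ^+ 2).
have n0R : 0 < n%:R :> R by rewrite ltr0n.
pose X o := (Num.sqrt n%:R)^-1 * psi n o.
have mX : measurable_fun setT X by exact: measurable_funM.
have mXk k : measurable_fun setT (fun o => X o ^+ k) by exact: measurable_funX.
have sn2 : (Num.sqrt n%:R)^-1 ^+ 2 = n%:R^-1 :> R by rewrite exprVn sqr_sqrtr ?ler0n.
have XC o : `|X o| <= (Num.sqrt n%:R)^-1 * C.
  by rewrite normrM ger0_norm ?invr_ge0 ?sqrtr_ge0// ler_wpM2l ?invr_ge0 ?sqrtr_ge0.
have iXk k : (Q n).-integrable setT (EFin \o (fun o => X o ^+ k)).
  apply: (@bounded_integrable _ _ _ _ _ (((Num.sqrt n%:R)^-1 * C) ^+ k)) => // o.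
  by rewrite normrX lerXn2r ?nnegrE// mulr_ge0// invr_ge0 sqrtr_ge0.
have ipsi k : (Q n).-integrable setT (EFin \o (fun o => psi n o ^+ k)).
  apply: (@bounded_integrable _ _ _ _ _ (C ^+ k)) => [|o].
    exact: measurable_funX.
  by rewrite normrX lerXn2r ?nnegrE.
have EX : \int[Q n]_o X o = 0 by rewrite RintegralZl ?psi0 ?mulr0//; exact: (ipsi 1%N).
have EX2 : \int[Q n]_o (X o ^+ 2) = Vn / n%:R.
  rewrite -sn2 mulrC -RintegralZl//.
  by apply: eq_Rintegral => o _; rewrite /X exprMn.
have Vn0 : 0 <= Vn by apply: Rintegral_ge0 => o _; exact: sqr_ge0.
(* |X| <= C / sqrt n gives X^4 <= (C^2 / n) X^2, hence a fourth moment of order 1 / n^2. *)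
have EX4 : \int[Q n]_o (X o ^+ 4) <= C ^+ 2 * Vn / n%:R / n%:R.
  apply: (@le_trans _ _ (\int[Q n]_o (C ^+ 2 / n%:R * X o ^+ 2))).
    apply: le_Rintegral => //; first exact: integrableZR.
    move=> o _; rewrite (_ : 4 = 2 + 2)%N// exprD ler_wpM2r ?sqr_ge0//.
    rewrite -sn2 -exprMn mulrC -(@real_normK _ (X o)) ?num_real//.
    by rewrite lerXn2r ?nnegrE// mulr_ge0// invr_ge0 sqrtr_ge0.
  rewrite RintegralZl// EX2 (_ : C ^+ 2 / n%:R * (Vn / n%:R) = C ^+ 2 * Vn / n%:R / n%:R)//.
  by field; rewrite gt_eqF.
have Sn (s : n.-tuple T) : S s = 0 + \sum_(i < n) X (tnth s i).
  by rewrite add0r /S mulr_sumr.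
have bf := compact_supp_bucont cf.
have Ef : \int[iid_law (Q n) n]_s f (S s) = iter n (trop (Q n) X) f 0.
  by rewrite -Rintegral_iid_sum//; apply: eq_Rintegral => s _; rewrite Sn.
pose v := V / n%:R; have v0 : 0 < v by rewrite divr_gt0.
pose B := trop (normal_law 0 v) (fun x : R => x).
have EN : \int[normal_law 0 V]_y f y = iter n B f 0.
  exact: (esym (iter_trop_normal_div n0 V0 bf)).
rewrite Ef EN.
have f1 : `|iter n (trop (Q n) X) f 0 - iter n (trop (Q n) X) F 0| <= e.
  by apply: iter_trop_sub => // x; rewrite distrC.
have f2 : `|iter n B F 0 - iter n B f 0| <= e by apply: iter_trop_sub.
have f3 : `|iter n (trop (Q n) X) F 0 - iter n B F 0| <= K / 2 * `|Vn - V| + e' * (Vn + V) +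
    2 * K / dl ^+ 2 * (C ^+ 2 * Vn + 512 * expR 2^-1 * V ^+ 2) / n%:R.
  pose r := K / 2 * `|Vn - V| / n%:R + e' * (Vn + V) / n%:R +
    2 * K / dl ^+ 2 * (C ^+ 2 * Vn + 512 * expR 2^-1 * V ^+ 2) / n%:R / n%:R.
  have rE : n%:R * r = K / 2 * `|Vn - V| + e' * (Vn + V) +
    2 * K / dl ^+ 2 * (C ^+ 2 * Vn + 512 * expR 2^-1 * V ^+ 2) / n%:R.
    by rewrite /r; field; rewrite !gt_eqF.
  rewrite -rE; apply: trotter_le; [exact: mX|exact: measurable_id|exact: bF|] => x.
  have tA := @trop_taylor _ _ _ (Q n) X mX F F1 F2 x e' dl K bF dF dF1 dl0 e'0 F2e F2K
    (iXk 1%N) (iXk 2) (iXk 4) EX.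
  have tB := @trop_taylor _ _ _ (normal_law 0 v) (fun x : R => x) _ F F1 F2 x
    e' dl K bF dF dF1 dl0 e'0 F2e F2K (integrable_normal_id v0)
    (integrable_normal_sqr v0) (integrable_normal_pow4 v0) (normal_mean0 v0).
  move: tB => /(_ (@measurable_id _ _ _)).
  rewrite EX2 in tA; rewrite normal_variance// => tB.
  have K0 : 0 <= K by exact: le_trans (F2K 0).
  have K2 : 0 <= 2 * K / dl ^+ 2 by rewrite divr_ge0 ?sqr_ge0// mulr_ge0.
  have tA' := le_trans tA (lerD (lexx _) (ler_wpM2l K2 EX4)).
  have tB' := le_trans tB (lerD (lexx _) (ler_wpM2l K2 (normal_moment4 v0))).
  have tV : `|F2 x / 2 * (Vn / n%:R) - F2 x / 2 * v| <= K / 2 * `|Vn - V| / n%:R.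
    have ni0 : 0 <= n%:R^-1 :> R by rewrite invr_ge0 ltW.
    have -> : F2 x / 2 * (Vn / n%:R) - F2 x / 2 * v = F2 x / 2 * (Vn - V) / n%:R.
      by rewrite /v; ring.
    rewrite normrM (ger0_norm ni0); apply: ler_wpM2r => //.
    rewrite normrM; apply: ler_wpM2r => //.
    by rewrite normrM (ger0_norm (_ : 0 <= 2^-1))//; apply: ler_wpM2r.
  have -> : trop (Q n) X F x - B F x =
    (trop (Q n) X F x - F x - F2 x / 2 * (Vn / n%:R)) -
    (B F x - F x - F2 x / 2 * v) + (F2 x / 2 * (Vn / n%:R) - F2 x / 2 * v) by ring.
  apply: le_trans (ler_normD _ _) _.
  apply: le_trans (lerD (le_trans (ler_normB _ _) (lerD tA' tB')) tV) _.
  rewrite le_eqVlt; apply/orP; left; apply/eqP; rewrite /r /v.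
  by field; rewrite !gt_eqF.
have -> : iter n (trop (Q n) X) f 0 - iter n B f 0 =
  (iter n (trop (Q n) X) f 0 - iter n (trop (Q n) X) F 0) +
  (iter n B F 0 - iter n B f 0) +
  (iter n (trop (Q n) X) F 0 - iter n B F 0) by ring.
rewrite (le_trans (ler_normD _ _))// lerD// (le_trans (ler_normD _ _))//.
by rewrite mulr_natl mulr2n lerD.
Qed.

Lemma clt f : compact_supp f ->
  (\int[iid_law (Q n) n]_s f (S s)) @[n --> \oo] --> \int[normal_law 0 V]_y f y.
Proof.
move=> cf; apply/cvgrPdist_le => e e0.
have e40 : 0 < e / 4 by rewrite divr_gt0.
have [F [F1 [F2 [bF [uF2 [K F2K]] Ff dF dF1]]]] := smoothing2 e40 cf.
(* As the variances tend to V, the term e' (Vn + V) tends to 2 V e' = e / 4, which lies below the e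
   / 2 left over by the smoothing cost 2 (e / 4). *)
pose e' := e / (8 * V).
have e'0 : 0 < e' by rewrite divr_gt0// mulr_gt0.
have [dl dl0 H] := uF2 _ e'0.
pose r n := K / 2 * `|\int[Q n]_o (psi n o ^+ 2) - V| +
    e' * (\int[Q n]_o (psi n o ^+ 2) + V) +
    2 * K / dl ^+ 2 * (C ^+ 2 * \int[Q n]_o (psi n o ^+ 2) +
      512 * expR 2^-1 * V ^+ 2) / n%:R.
have ni : (n%:R^-1 : R) @[n --> \oo] --> 0.
  by apply/gtr0_cvgV0; [near=> n; rewrite ltr0n; near: n; exists 1%N|exact: cvgr_idn].
have rl : r n @[n --> \oo] --> K / 2 * 0 + e' * (V + V) + 2 * K / dl ^+ 2 * (C ^+ 2 * V +
      512 * expR 2^-1 * V ^+ 2) * 0.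
  apply: cvgD; first apply: cvgD.
  - apply: cvgM; first exact: cvg_cst.
    rewrite -[X in _ --> X](normr0 R) -[X in `|X|](subrr V).
    by apply: cvg_norm; apply: cvgB => //; exact: cvg_cst.
  - apply: cvgM; first exact: cvg_cst.
    by apply: cvgD => //; exact: cvg_cst.
  - apply: cvgM => //; apply: cvgM; first exact: cvg_cst.
    apply: cvgD; last exact: cvg_cst.
    by apply: cvgM => //; exact: cvg_cst.
have r_le : \forall n \near \oo, r n <= e / 2.
  apply: (cvgr_le _ rl); rewrite mulr0 add0r mulr0 addr0.
  rewrite (_ : e' * (V + V) = e / 4); last by rewrite /e'; field; rewrite gt_eqF.
  by rewrite ltr_pM2l// ltf_pV2 ?posrE// ltr_nat.
near=> n; rewrite distrC.
have n0 : (0 < n)%N by near: n; exists 1%N.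
apply: le_trans (clt_bound n0 cf bF Ff dF dF1 dl0 (ltW e'0) H F2K) _.
rewrite -/(r n).
have rn : r n <= e / 2 by near: n.
have := lerD (lexx (2 * (e / 4))) rn.
by move/le_trans; apply; rewrite le_eqVlt; apply/orP; left; apply/eqP; field.
Unshelve. all: by end_near. Qed.

End clt.

(** * Weak convergence *)

Section cutoff.
Context {R : realType}.

Definition cutoff (A x : R) : R := maxr 0 (minr 1 (A + 1 - `|x|)).

Lemma cutoff_ge0 A x : 0 <= cutoff A x.
Proof. by rewrite /cutoff le_max lexx. Qed.

Lemma cutoff_le1 A x : cutoff A x <= 1.
Proof. by rewrite /cutoff ge_max ler01 ge_min lexx. Qed.

Lemma cutoff_eq1 A x : `|x| <= A -> cutoff A x = 1.
Proof.
move=> xA; rewrite /cutoff min_l ?max_r//.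
by rewrite lerBrDr addrC lerD2r.
Qed.

Lemma cutoff_eq0 A x : A + 1 < `|x| -> cutoff A x = 0.
Proof.
by move=> xA; rewrite /cutoff max_l// ge_min subr_le0 (ltW xA) orbT.
Qed.

Lemma continuous_cutoff A : continuous (cutoff A).
Proof.
move=> x; apply: (@continuous_max _ _ (fun=> 0) (fun x => minr 1 (A + 1 - `|x|))).
  exact: cvg_cst.
apply: (@continuous_min _ _ (fun=> 1) (fun x => A + 1 - `|x|)); first exact: cvg_cst.
apply: cvgB; first exact: cvg_cst.
exact: norm_continuous.
Qed.

Lemma compact_supp_cutoffM (f : R -> R) A : continuous f ->
  compact_supp (fun x => f x * cutoff A x).
Proof.
move=> cf; split; first by move=> x; apply: cvgM; [exact: cf|exact: continuous_cutoff].
by exists (A + 1) => x /cutoff_eq0 ->; rewrite mulr0.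
Qed.

Lemma cvg_cutoff (L : probability (measurableTypeR R) R) :
  (\int[L]_x cutoff n%:R x) @[n --> \oo] --> (1 : R).
Proof.
have mc n : measurable_fun setT (cutoff (n%:R : R)).
  by apply: continuous_measurable_fun; exact: continuous_cutoff.
have [|||||_ _] := @dominated_convergence _ (measurableTypeR R) R L setT measurableT
    (fun n x => (cutoff n%:R x)%:E) (cst 1%E) (cst 1%E).
- by move=> n; apply/measurable_EFinP; exact: mc.
- exact: measurable_cst.
- apply: aeW => x _; apply: (@cvg_trans _ (cst 1%:E @ \oo)); last exact: cvg_cst.
  apply: near_eq_cvg; near=> n; rewrite /= cutoff_eq1//; near: n.
  by apply: nbhs_infty_ger; exact: num_real.
- exact: (@finite_measure_integrable_cst _ _ _ L setT 1).
- apply: aeW => x n _ /=; rewrite lee_fin ger0_norm ?cutoff_ge0//.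
  exact: cutoff_le1.
have -> : (\int[L]_x cst 1%E x = 1%:E)%E.
  by rewrite integral_cst// mul1e; exact: probability_setT.
by move=> H; exact: (fine_cvg H).
Unshelve. all: by end_near. Qed.

End cutoff.

Lemma measurable_gt_set (d : measure_display) (T : measurableType d) (R : realType)
    (X : T -> R) (c : R) : measurable_fun setT X -> measurable [set s | c < X s].
Proof.
move=> mX; rewrite (_ : [set s | _] = setT `&` X @^-1` `]c, +oo[); last first.
  by rewrite setTI; apply/seteqP; split => x /=; rewrite in_itv/= andbT.
exact: mX.
Qed.

Section weak_convergence.
Context {d : nat -> measure_display} {T : forall n, measurableType (d n)}.
Context {R : realType}.
Variables (Pn : forall n, probability (T n) R) (L : probability (measurableTypeR R) R).

Definition cvg_compact_supp (S : forall n, T n -> R) := forall f, compact_supp f ->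
  (\int[Pn n]_s f (S n s)) @[n --> \oo] --> \int[L]_y f y.

(** Tightness is automatic: [cutoff A] has compact support, so its integrals under [Pn] converge to
    its integral under L, which is close to 1 for large A. No mass escapes, and a bounded f may be
    replaced by its truncation. *)
Lemma cvg_compact_supp_law (S : forall n, T n -> R) :
  (forall n, measurable_fun setT (S n)) -> cvg_compact_supp S -> cvg_in_law Pn S L.
Proof.
move=> mS SL; split => // f cf bf.
have [M M0 fM] : exists2 M, 0 < M & forall x, `|f x| <= M.
  have [M [_ H]] := bf; exists (`|M| + 1); first by rewrite ltr_wpDl.
  by move=> x; apply: (H (`|M| + 1)) => //; rewrite ltr_pwDr// ler_norm.
have mf : measurable_fun setT f by exact: continuous_measurable_fun.
have bound (d' : measure_display) (T' : measurableType d') (P' : probability T' R)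
    (X : T' -> R) A : measurable_fun setT X ->
    `|\int[P']_s f (X s) - \int[P']_s (f (X s) * cutoff A (X s))| <=
    M * (1 - \int[P']_s cutoff A (X s)).
  move=> mX.
  have mc : measurable_fun setT (fun s => cutoff A (X s)).
    apply: measurableT_comp mX; apply: continuous_measurable_fun.
    exact: continuous_cutoff.
  have mfX : measurable_fun setT (fun s => f (X s)) by exact: measurableT_comp.
  have c1 s : `|cutoff A (X s)| <= 1.
    by rewrite ger0_norm ?cutoff_ge0 ?cutoff_le1.
  have i1 : P'.-integrable setT (EFin \o (fun s => f (X s))).
    exact: (@bounded_integrable _ _ _ P' _ M).
  have i2 : P'.-integrable setT (EFin \o (fun s => f (X s) * cutoff A (X s))).
    apply: (@bounded_integrable _ _ _ P' _ M); first exact: measurable_funM.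
    by move=> s; rewrite normrM -[leRHS]mulr1 ler_pM.
  have i3 : P'.-integrable setT (EFin \o (fun s => cutoff A (X s))).
    exact: (@bounded_integrable _ _ _ P' _ 1).
  have i4 := @integrable_cstR _ _ _ P' 1.
  have i5 := integrableBR i4 i3.
  rewrite -RintegralB// -[in leRHS](@Rintegral_cstT _ _ _ P' 1) -RintegralB//.
  rewrite -RintegralZl//; apply: le_Rintegral_bound => //.
  - exact: (integrableBR i1 i2).
  - exact: (integrableZR M i5).
  - move=> s; rewrite -[X in X - _]mulr1 -mulrBr normrM ler_pM// ger0_norm//.
    by rewrite subr_ge0 cutoff_le1.
apply/cvgrPdist_le => e e0.
have [A HA] : exists A, M * (1 - \int[L]_x cutoff A x) <= e / 4.
  have H := @cvg_cutoff _ L.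
  have {H} : M * (1 - \int[L]_x cutoff n%:R x) @[n --> \oo] --> M * (1 - 1).
    by apply: cvgM; [exact: cvg_cst|apply: cvgB => //; exact: cvg_cst].
  rewrite subrr mulr0 => H.
  have e40 : 0 < e / 4 by rewrite divr_gt0.
  have [n _ Hn] := cvgr_le _ H _ e40.
  by exists n%:R; apply: (Hn n) => /=.
have cA : compact_supp (cutoff A).
  have : compact_supp (fun x => (fun=> 1 : R) x * cutoff A x).
    by apply: compact_supp_cutoffM => x; exact: cvg_cst.
  by under eq_fun do rewrite mul1r.
have cfA := compact_supp_cutoffM A cf.
have H1 : \forall n \near \oo, M * (1 - \int[Pn n]_s cutoff A (S n s)) <= e / 4 + e / 4.
  have H : M * (1 - \int[Pn n]_s cutoff A (S n s)) @[n --> \oo] -->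
     M * (1 - \int[L]_x cutoff A x).
    by apply: cvgM; [exact: cvg_cst|apply: cvgB; [exact: cvg_cst|exact: SL]].
  apply: (cvgr_le _ H); rewrite (le_lt_trans HA)// ltrDl divr_gt0//.
have /cvgrPdist_le H2 := SL _ cfA.
have e40 : 0 < e / 4 by rewrite divr_gt0.
near=> n.
have h1 : `|\int[Pn n]_s f (S n s) - \int[Pn n]_s (f (S n s) * cutoff A (S n s))|
    <= e / 4 + e / 4.
  by apply: le_trans (@bound _ _ (Pn n) (S n) A (mS n)) _; near: n; exact: H1.
have h2 : `|\int[L]_y (f y * cutoff A y) -
    \int[Pn n]_s (f (S n s) * cutoff A (S n s))| <= e / 4.
  by near: n; exact: H2.
have h3 := le_trans (@bound _ _ L (fun x => x) A (@measurable_id _ _ _)) HA.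
have -> : \int[L]_y f y - \int[Pn n]_s f (S n s) =
  (\int[L]_y f y - \int[L]_y (f y * cutoff A y)) +
  (\int[L]_y (f y * cutoff A y) - \int[Pn n]_s (f (S n s) * cutoff A (S n s))) -
  (\int[Pn n]_s f (S n s) - \int[Pn n]_s (f (S n s) * cutoff A (S n s))) by ring.
rewrite (le_trans (ler_normB _ _))// (le_trans (lerD (ler_normD _ _) (lexx _)))//.
apply: le_trans (lerD (lerD h3 h2) h1) _.
by rewrite le_eqVlt; apply/orP; left; apply/eqP; field.
Unshelve. all: by end_near. Qed.

(** Uniform continuity handles the event where [S] and [A] are close; on its complement the crude
    bound 2 M meets a vanishing probability. *)
Lemma slutsky (S A : forall n, T n -> R) :
  (forall n, measurable_fun setT (S n)) -> (forall n, measurable_fun setT (A n)) ->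
  (forall e : R, 0 < e -> Pn n [set s | e < `|S n s - A n s|] @[n --> \oo] --> 0%E) ->
  cvg_compact_supp A -> cvg_compact_supp S.
Proof.
move=> mS mA SA AL f cf; have bf := compact_supp_bucont cf.
have mf := bucont_measurable bf.
have [M M0 fM] := compact_supp_bounded cf.
apply/cvgrPdist_le => e e0.
have e40 : 0 < e / 4 by rewrite divr_gt0.
have [dl dl0 fdl] := compact_supp_ucont cf e40.
have mE n : measurable [set s | dl < `|S n s - A n s|].
  apply: measurable_gt_set; apply: measurableT_comp => //; exact: measurable_funB.
have bound n : `|\int[Pn n]_s f (S n s) - \int[Pn n]_s f (A n s)| <=
    e / 4 + 2 * M * fine (Pn n [set s | dl < `|S n s - A n s|]).
  have mfS : measurable_fun setT (fun s => f (S n s)) by exact: measurableT_comp.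
  have mfA : measurable_fun setT (fun s => f (A n s)) by exact: measurableT_comp.
  have i1 : (Pn n).-integrable setT (EFin \o (fun s => f (S n s))).
    exact: (@bounded_integrable _ _ _ _ _ M).
  have i2 : (Pn n).-integrable setT (EFin \o (fun s => f (A n s))).
    exact: (@bounded_integrable _ _ _ _ _ M).
  have i3 : (Pn n).-integrable setT (EFin \o \1_[set s | dl < `|S n s - A n s|]).
    exact: integrable_indic.
  have i4 := integrableZR (2 * M) i3.
  have i5 := @integrable_cstR _ _ _ (Pn n) (e / 4).
  have -> : e / 4 + 2 * M * fine (Pn n [set s | dl < `|S n s - A n s|]) =
     \int[Pn n]_s (e / 4 + 2 * M * \1_[set s | dl < `|S n s - A n s|] s).
    rewrite RintegralD// Rintegral_cstT RintegralZl//; congr (_ + _ * _).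
    by rewrite /Rintegral integral_indic// setIT.
  rewrite -RintegralB//; apply: le_Rintegral_bound => //.
  - exact: (integrableBR i1 i2).
  - exact: (integrableDR i5 i4).
  move=> s; rewrite indicE; case: (boolP (s \in _)) => [_|].
    rewrite mulr1 (le_trans (ler_normB _ _))// mulr_natl mulr2n.
    by rewrite ler_wpDl ?(ltW e40)// lerD.
  rewrite notin_setE/= => /negP; rewrite -leNgt => h.
  by rewrite mulr0 addr0; exact: fdl.
have /cvgrPdist_le H2 := AL _ cf.
have e20 : 0 < e / 2 by rewrite divr_gt0.
have H1 : \forall n \near \oo,
    2 * M * fine (Pn n [set s | dl < `|S n s - A n s|]) <= e / 4.
  have /fine_cvg H := SA _ dl0.
  have {}H : 2 * M * fine (Pn n [set s | dl < `|S n s - A n s|]) @[n --> \oo] --> 2 * M * 0.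
    by apply: cvgM => //; exact: cvg_cst.
  by apply: (cvgr_le _ H); rewrite mulr0.
near=> n.
have h2 : `|\int[L]_y f y - \int[Pn n]_s f (A n s)| <= e / 2 by near: n; exact: H2.
have h1 : 2 * M * fine (Pn n [set s | dl < `|S n s - A n s|]) <= e / 4 by near: n.
have -> : \int[L]_y f y - \int[Pn n]_s f (S n s) =
  (\int[L]_y f y - \int[Pn n]_s f (A n s)) -
  (\int[Pn n]_s f (S n s) - \int[Pn n]_s f (A n s)) by ring.
apply: le_trans (ler_normB _ _) _.
apply: le_trans (lerD h2 (le_trans (bound n) (lerD (lexx _) h1))) _.
by rewrite le_eqVlt; apply/orP; left; apply/eqP; field.
Unshelve. all: by end_near. Qed.

End weak_convergence.

Section clt_law.
Context {d : measure_display} {T : measurableType d} {R : realType}.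

Lemma Rintegral_normal_shift (c v : R) (f : R -> R) : 0 < v -> bucont f ->
  \int[normal_law c v]_y f y = \int[normal_law 0 v]_y f (y + c).
Proof.
move=> v0 bf; have [uf [M fM]] := bf.
have cf := ucont_continuous uf.
have mf := bucont_measurable bf.
have cfM : continuous (fun y => f y + M).
  by move=> y; apply: cvgD; [exact: cf|exact: cvg_cst].
have fM0 y : 0 <= f y + M.
  by have := fM y; rewrite ler_norml => /andP[+ _]; rewrite -subr_ge0 opprK.
have E (m : R) (g : R -> R) : measurable_fun setT g -> (forall x, `|g x| <= M) ->
    (\int[normal_law m v]_y (g y + M)%:E = (\int[normal_law m v]_y g y + M)%:E)%E.
  move=> mg gM; have ig := @bounded_integrable _ _ _ (normal_law m v) g M mg gM.
  have iM := @integrable_cstR _ _ _ (normal_law m v) M.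
  have := RintegralD measurableT ig iM; rewrite Rintegral_cstT => <-.
  rewrite [in RHS]/Rintegral fineK; first by [].
  apply: integrable_fin_num; first exact: measurableT.
  exact: (integrableDR ig iM).
have mfc : measurable_fun setT (fun y : R => f (y + c)).
  by apply: measurableT_comp => //; exact: measurable_funD.
have E1 := E c f mf fM.
have E2 := E 0 _ mfc (fun y : R => fM (y + c)).
have E3 : (\int[normal_law 0 v]_x (f (c + x) + M)%:E =
   \int[normal_law 0 v]_x (f (x + c) + M)%:E)%E.
  by apply: eq_integral => x _; rewrite (addrC c).
have H := etrans (esym E1) (etrans (ge0_normal_shift c v0 cfM fM0) (etrans E3 E2)).
exact: (addIr M (EFin_inj H)).
Qed.

Variables (Q : nat -> probability T R) (psi : nat -> T -> R) (C V c : R).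
Hypotheses (mpsi : forall n, measurable_fun setT (psi n)).
Hypothesis psiC : forall n o, `|psi n o| <= C.
Hypothesis psi0 : forall n, \int[Q n]_o psi n o = 0.
Hypothesis psiV : (\int[Q n]_o (psi n o ^+ 2)) @[n --> \oo] --> V.
Hypothesis V0 : 0 < V.

Lemma clt_slutsky (S : forall n, n.-tuple T -> R) :
  (forall n, measurable_fun setT (S n)) ->
  (forall e : R, 0 < e -> iid_law (Q n) n [set s | e < `|S n s -
     ((Num.sqrt n%:R)^-1 * \sum_(i < n) psi n (tnth s i) + c)|] @[n --> \oo] --> 0%E) ->
  cvg_in_law (fun n => iid_law (Q n) n) S (normal_law c V).
Proof.
move=> mS SA; apply: (cvg_compact_supp_law mS).
apply: (slutsky mS _ SA).
  move=> n; apply: measurable_funD; last exact: measurable_cst.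
  apply: measurable_funM; first exact: measurable_cst.
  exact: measurable_iid_sum.
move=> f cf.
have cfc : compact_supp (fun y => f (y + c)).
  case: cf => cf [A fA]; split.
    move=> y; apply: continuous_comp; last exact: cf.
    by apply: cvgD; [exact: cvg_id|exact: cvg_cst].
  exists (A + `|c|) => x xA; apply: fA.
  rewrite -ltrBrDr in xA; apply: lt_le_trans xA _.
  by rewrite lerBlDr -[X in `|X|](addrK c) (le_trans (ler_normB _ _)).
rewrite (Rintegral_normal_shift c V0 (compact_supp_bucont cf)).
exact: (clt mpsi psiC psi0 psiV V0 cfc).
Qed.

End clt_law.

(** * Differentiability in quadratic mean *)

Section dqm.
Context {d : measure_display} {T : measurableType d} {R : realType}.

Section fixed_t.
Variables (m : {measure set T -> \bar R}) (P Q : probability T R) (f g h u : T -> R).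
Variables (t M : R).
Hypotheses (mf : measurable_fun setT f) (f0 : forall o, 0 <= f o).
Hypothesis Qf : forall E, measurable E -> Q E = (\int[m]_(o in E) (f o)%:E)%E.
Hypotheses (mg : measurable_fun setT g) (g0 : forall o, 0 <= g o).
Hypothesis Pg : forall E, measurable E -> P E = (\int[m]_(o in E) (g o)%:E)%E.
Hypotheses (mh : measurable_fun setT h) (t0 : 0 < t).
Hypothesis h2 : P.-integrable setT (EFin \o (fun o => h o ^+ 2)).
Hypotheses (mu : measurable_fun setT u) (uM : forall o, `|u o| <= M).

Let r o := (Num.sqrt (f o) - Num.sqrt (g o)) / t - 2^-1 * h o * Num.sqrt (g o).

Hypothesis Ifin : (\int[m]_o (r o ^+ 2)%:E < +oo)%E.

(** With a = sqrt f and b = sqrt g, the definition of r reads a = b + t (r + h b / 2), whence (a^2 -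
    b^2) / t - h b^2 = 2 b r + t (r + h b / 2)^2. The integral of r^2 is the DQM remainder and that
    of b^2 is 1; the free weight k balances the two in the cross term. *)
Lemma dqm_mean_bound (k : R) : 0 < k ->
  `|(\int[Q]_o u o - \int[P]_o u o) / t - \int[P]_o (u o * h o)| <=
  M * (k + fine (\int[m]_o (r o ^+ 2)%:E)%E * (k^-1 + 2 * t) +
       t / 2 * \int[P]_o (h o ^+ 2)).
Proof.
move=> k0.
have msqrt : measurable_fun setT (@Num.sqrt R).
  by apply: continuous_measurable_fun; exact: sqrt_continuous.
have msf : measurable_fun setT (fun o => Num.sqrt (f o)) by exact: measurableT_comp msqrt mf.
have msg : measurable_fun setT (fun o => Num.sqrt (g o)) by exact: measurableT_comp msqrt mg.
have mr : measurable_fun setT r.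
  apply: measurable_funB; first by apply: measurable_funM => //; exact: measurable_funB.
  by apply: measurable_funM => //; exact: measurable_funM.
have M0 : 0 <= M by exact: le_trans (uM point).
have iQu : Q.-integrable setT (EFin \o u) by exact: (@bounded_integrable _ _ _ _ _ M).
have iPu : P.-integrable setT (EFin \o u) by exact: (@bounded_integrable _ _ _ _ _ M).
have iPh : P.-integrable setT (EFin \o (fun o => u o * h o)).
  have i1 := integrableZR M (integrableDR (integrable_cstR P 1) h2).
  apply: le_integrableR i1; first exact: measurable_funM.
  move=> o /=; rewrite normrM [leRHS]normrM (ger0_norm M0) ler_pM//.
  rewrite [leRHS]ger0_norm ?addr_ge0 ?sqr_ge0//.
  rewrite -(@real_normK _ (h o)) ?num_real//.
  have [h1|h1] := leP `|h o| 1; first by rewrite ler_wpDr// sqr_ge0.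
  by rewrite ler_wpDl// expr2 ler_peMl// ltW.
have i1 := integrable_density mf f0 Qf iQu.
have i2 := integrable_density mg g0 Pg iPu.
have i3 := integrable_density mg g0 Pg iPh.
have i4 := integrable_density mg g0 Pg (integrable_cstR P 1).
have i5 := integrable_density mg g0 Pg h2.
have i6 : m.-integrable setT (EFin \o (fun o => r o ^+ 2)).
  apply/integrableP; split; first by apply/measurable_EFinP; exact: measurable_funX.
  move: Ifin; congr (_ < _)%E; apply: eq_integral => o _ /=.
  by rewrite ger0_norm ?sqr_ge0.
have -> : \int[Q]_o u o = \int[m]_o (u o * f o) by exact: Rintegral_density.
have -> : \int[P]_o u o = \int[m]_o (u o * g o) by exact: Rintegral_density.
have -> : \int[P]_o (u o * h o) = \int[m]_o (u o * h o * g o).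
  by apply: Rintegral_density => //; exact: measurable_funM.
have E1 : \int[m]_o (1 * g o) = 1.
  rewrite -(@Rintegral_density _ _ _ m P g mg g0 Pg (fun=> 1))// ?Rintegral_cstT//.
have E2 : \int[m]_o (h o ^+ 2 * g o) = \int[P]_o (h o ^+ 2).
  rewrite (@Rintegral_density _ _ _ m P g mg g0 Pg (fun o => h o ^+ 2))//.
  exact: measurable_funX.
have IR (a b : T -> R) : m.-integrable setT (EFin \o a) -> m.-integrable setT (EFin \o b) ->
    m.-integrable setT (EFin \o (a \+ b)).
  by move=> ia ib; have := integrableD measurableT ia ib.
have IB (a b : T -> R) : m.-integrable setT (EFin \o a) -> m.-integrable setT (EFin \o b) ->
    m.-integrable setT (EFin \o (a \- b)).
  by move=> ia ib; have := integrableB measurableT ia ib.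
have IZ (c : R) (a : T -> R) : m.-integrable setT (EFin \o a) ->
    m.-integrable setT (EFin \o (fun x => c * a x)).
  by move=> ia; have := integrableZl measurableT c ia.
have j1 := IB _ _ (IZ t^-1 _ (IB _ _ i1 i2)) i3.
pose G o := M * (k * (1 * g o) + (k^-1 + 2 * t) * r o ^+ 2 + t / 2 * (h o ^+ 2 * g o)).
have j2 : m.-integrable setT (EFin \o G).
  exact: (IZ M _ (IR _ _ (IR _ _ (IZ k _ i4) (IZ (k^-1 + 2 * t) _ i6)) (IZ (t / 2) _ i5))).
have -> : (\int[m]_o (u o * f o) - \int[m]_o (u o * g o)) / t - \int[m]_o (u o * h o * g o) =
   \int[m]_o (t^-1 * (u o * f o - u o * g o) - u o * h o * g o).
  have := RintegralB measurableT (IZ t^-1 _ (IB _ _ i1 i2)) i3 => /= ->.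
  have := RintegralZl t^-1 measurableT (IB _ _ i1 i2) => /= ->.
  by rewrite (RintegralB measurableT i1 i2) mulrC.
have -> : M * (k + fine (\int[m]_o (r o ^+ 2)%:E)%E * (k^-1 + 2 * t) +
       t / 2 * \int[P]_o (h o ^+ 2)) = \int[m]_o G o.
  rewrite /G.
  have := RintegralZl M measurableT
    (IR _ _ (IR _ _ (IZ k _ i4) (IZ (k^-1 + 2 * t) _ i6)) (IZ (t / 2) _ i5)) => /= ->.
  have := RintegralD measurableT (IR _ _ (IZ k _ i4) (IZ (k^-1 + 2 * t) _ i6))
    (IZ (t / 2) _ i5) => /= ->.
  have := RintegralD measurableT (IZ k _ i4) (IZ (k^-1 + 2 * t) _ i6) => /= ->.
  rewrite (RintegralZl _ measurableT i4) (RintegralZl _ measurableT i5).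
  by rewrite (RintegralZl _ measurableT i6) E1 E2 mulr1 (mulrC (fine _)).
apply: le_trans (le_normr_Rintegral measurableT j1) _.
apply: le_Rintegral => //; first exact: integrable_norm.
move=> o _ /=.
set a := Num.sqrt (f o); set b := Num.sqrt (g o).
have fa : f o = a ^+ 2 by rewrite sqr_sqrtr.
have gb : g o = b ^+ 2 by rewrite sqr_sqrtr.
have b0 : 0 <= b by exact: sqrtr_ge0.
have ab : a = b + t * (r o + 2^-1 * h o * b).
  by rewrite /r -/a -/b; field; rewrite gt_eqF.
have -> : t^-1 * (u o * f o - u o * g o) - u o * h o * g o =
    u o * (2 * b * r o + t * (r o + 2^-1 * h o * b) ^+ 2).
  by rewrite fa ab gb; field; rewrite gt_eqF.
rewrite normrM /G; apply: ler_pM => //.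
rewrite (le_trans (ler_normD _ _))// gb mul1r.
(* AM-GM with weight k *)
have x1 : `|2 * b * r o| <= k * b ^+ 2 + k^-1 * r o ^+ 2.
  rewrite ler_norml; apply/andP; split.
    rewrite -subr_ge0 (_ : _ - _ = k * (b + k^-1 * r o) ^+ 2); last by field; rewrite gt_eqF.
    by rewrite mulr_ge0 ?sqr_ge0// ltW.
  rewrite -subr_ge0 (_ : _ - _ = k * (b - k^-1 * r o) ^+ 2); last by field; rewrite gt_eqF.
  by rewrite mulr_ge0 ?sqr_ge0// ltW.
have x2 : `|t * (r o + 2^-1 * h o * b) ^+ 2| <= t * (2 * r o ^+ 2 + 2^-1 * (h o ^+ 2 * b ^+ 2)).
  rewrite ger0_norm; last by rewrite mulr_ge0 ?sqr_ge0// ltW.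
  apply: ler_wpM2l; first exact: ltW.
  rewrite -subr_ge0.
  rewrite (_ : _ - _ = (r o - 2^-1 * h o * b) ^+ 2); last by field.
  exact: sqr_ge0.
apply: le_trans (lerD x1 x2) _.
by rewrite le_eqVlt; apply/orP; left; apply/eqP; field; rewrite gt_eqF.
Qed.

End fixed_t.

End dqm.

Section sqrt_nat.
Context {R : realType}.

Lemma sqrt_cvgy : (Num.sqrt n%:R : R) @[n --> \oo] --> +oo.
Proof.
apply/cvgryPge => A; near=> n.
have nA : `|A| ^+ 2 <= n%:R by near: n; apply: nbhs_infty_ger; exact: num_real.
rewrite (le_trans (ler_norm A))// -[leLHS]sqrtr_sqr -(@real_normK _ A) ?num_real//.
by rewrite ler_sqrt// (le_trans _ nA)// sqr_ge0.
Unshelve. all: by end_near. Qed.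

Lemma sqrt_inv_cvg0 : (Num.sqrt n%:R)^-1 @[n --> \oo] --> (0 : R).
Proof.
apply/gtr0_cvgV0; last exact: sqrt_cvgy.
by near=> n; rewrite sqrtr_gt0 ltr0n; near: n; exists 1%N.
Unshelve. all: by end_near. Qed.

Lemma sqrt_invn_cvg0 : (Num.sqrt n%:R)^-1 @[n --> \oo] --> (0 : R)^'+.
Proof.
move=> A [e /= e0 HA].
suff : \forall n \near \oo, A ((Num.sqrt n%:R)^-1) by [].
near=> n.
have p : 0 < (Num.sqrt n%:R)^-1 :> R.
  by rewrite invr_gt0 sqrtr_gt0 ltr0n; near: n; exists 1%N.
apply: HA; last exact: p.
rewrite /= sub0r normrN.
by near: n; have /cvgr0Pnorm_lt H := sqrt_inv_cvg0; exact: H.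
Unshelve. all: by end_near. Qed.

End sqrt_nat.

Section dqm_path.
Context {R : realType} {J K : nat}.
Local Notation O := (obs J K R).
Variables (B0 eps : R) (P : probability O R) (h : O -> R) (path : R -> probability O R).
Hypotheses (hP : tangent P h) (hpath : dqm_path B0 eps P h path).

Lemma tangent_measurable : measurable_fun setT h.
Proof. by have [/sub_Lfun_mfun] := hP; rewrite inE. Qed.

Lemma tangent_sqr_integrable : P.-integrable setT (EFin \o (fun o => h o ^+ 2)).
Proof. by have [/Lfun2_integrable_sqr] := hP. Qed.

Lemma tangent_integrable : P.-integrable setT (EFin \o h).
Proof.
have i1 := integrableDR (integrable_cstR P 1) tangent_sqr_integrable.
apply: le_integrableR i1; first exact: tangent_measurable.
move=> o /=; rewrite [leRHS]ger0_norm ?addr_ge0 ?sqr_ge0//.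
rewrite -(@real_normK _ (h o)) ?num_real//.
have [h1|h1] := leP `|h o| 1; first by rewrite ler_wpDr// sqr_ge0.
by rewrite ler_wpDl// expr2 ler_peMl// ltW.
Qed.

Variables (u : O -> R) (M : R).
Hypotheses (mu : measurable_fun setT u) (uM : forall o, `|u o| <= M).

Lemma dqm_mean :
  (\int[path t]_o u o - \int[P]_o u o) / t @[t --> 0^'+] --> \int[P]_o (u o * h o).
Proof.
have [e e0 [_ _ [m [f [g [dens I0]]]]]] := hpath.
have M0 : 0 <= M by exact: le_trans (uM point).
apply/cvgrPdist_le => c c0.
pose H := \int[P]_o (h o ^+ 2).
have H0 : 0 <= H by apply: Rintegral_ge0 => o _; exact: sqr_ge0.
(* M k is the only term of the bound that survives as t tends to 0, and it is at most c / 4; M + 1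
   avoids a division by zero. *)
pose k := c / (4 * (M + 1)).
have M10 : 0 < M + 1 by rewrite ltr_wpDl.
have k0 : 0 < k by rewrite divr_gt0// mulr_gt0.
have Mk : M * k <= c / 4.
  rewrite /k (_ : c / (4 * (M + 1)) = (M + 1)^-1 * (c / 4)); last first.
    by field; rewrite gt_eqF.
  rewrite mulrA ler_piMl//; first by rewrite divr_ge0// ltW.
  by rewrite ler_pdivrMr// mul1r lerDl.
pose I t := (\int[m t]_o (((Num.sqrt (f t o) - Num.sqrt (g t o)) / t
            - 2^-1 * h o * Num.sqrt (g t o)) ^+ 2)%:E)%E.
(* Convergence to 0 in the extended reals also makes the integral finite for small t, which
   [dqm_mean_bound] requires. *)
have /fine_cvgP[Ifin Icvg] : I t @[t --> 0^'+] --> 0%E by exact: I0.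
have rcvg : M * (k + fine (I t) * (k^-1 + 2 * t) + t / 2 * H) @[t --> 0^'+] -->
    M * (k + 0 * (k^-1 + 2 * 0) + 0 / 2 * H).
  have tcvg : t @[t --> (0:R)^'+] --> (0:R) by apply: cvg_at_right_filter; exact: cvg_id.
  apply: cvgM; first exact: cvg_cst.
  apply: cvgD; first apply: cvgD; first exact: cvg_cst.
    apply: cvgM; first exact: Icvg.
    by apply: cvgD; [exact: cvg_cst|apply: cvgM => //; exact: cvg_cst].
  apply: cvgM; last exact: cvg_cst.
  by apply: cvgM => //; exact: cvg_cst.
have rle : \forall t \near 0^'+, M * (k + fine (I t) * (k^-1 + 2 * t) + t / 2 * H) <= c.
  apply: (cvgr_le _ rcvg); rewrite mul0r addr0 !mul0r addr0.
  apply: le_lt_trans Mk _.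
  by rewrite ltr_pdivrMr// ltr_pMr// ltr1n.
near=> t.
have t0 : 0 < t by near: t; exact: nbhs_right_gt.
have te : t < e by near: t; exact: nbhs_right_lt.
have [|[mf f0 Qf] [mg g0 Pg]] := dens t; first by rewrite t0 te.
rewrite distrC.
have Ifint : I t \is a fin_num by near: t.
have It : (I t < +oo)%E by rewrite -ge0_fin_numE// integral_ge0// => o _; rewrite lee_fin sqr_ge0.
apply: le_trans (dqm_mean_bound mf f0 Qf mg g0 Pg tangent_measurable t0
  tangent_sqr_integrable mu uM It k0) _.
by near: t.
Unshelve. all: by end_near. Qed.

Lemma local_mean :
  Num.sqrt n%:R * (\int[local_law path n]_o u o - \int[P]_o u o) @[n --> \oo] -->
  \int[P]_o (u o * h o).
Proof.
have := cvg_comp _ _ sqrt_invn_cvg0 dqm_mean.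
apply: cvg_trans; apply: near_eq_cvg; near=> n.
by rewrite /= invrK mulrC.
Unshelve. all: by end_near. Qed.

End dqm_path.

(** * Sums over i.i.d. samples: null events, second moments, Chebyshev's inequality *)

Section iid_moments.
Context {d : measure_display} {T : measurableType d} {R : realType}.
Variables (P : probability T R).

Lemma iid_null (N : set T) n : measurable N -> P N = 0%E ->
  iid_law P n [set s | exists i, N (tnth s i)] = 0%E.
Proof.
move=> mN PN.
have E : iid_law P n [set s | forall i, (~` N) (tnth s i)] = 1%E.
  rewrite (@iid_lawE _ _ _ P n (fun=> ~` N)); last by move=> _; exact: measurableC.
  by rewrite probability_setC// PN sube0 big1.
have mE : measurable [set s : n.-tuple T | forall i, (~` N) (tnth s i)].
  rewrite (_ : [set s | _] = \bigcap_(i in [set: 'I_n])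
      ((@tnth _ T)^~ i @^-1` (~` N))).
    apply: fin_bigcap_measurable => // i _.
    by rewrite -[X in measurable X]setTI; apply: measurable_tnth => //; exact: measurableC.
  by apply/seteqP; split => s /= h i //; [move=> _; exact: h|exact: h].
have -> : [set s | exists i, N (tnth s i)] =
    ~` [set s : n.-tuple T | forall i, (~` N) (tnth s i)].
  apply/seteqP; split => s /=.
    by move=> [i Ni] /(_ i).
  by move=> /existsNP[i /contrapT Ni]; exists i.
by rewrite probability_setC// E subee.
Qed.

Variables (X : T -> R) (C : R).
Hypotheses (mX : measurable_fun setT X) (XC : forall o, `|X o| <= C).

Let S n (s : n.-tuple T) := \sum_(i < n) X (tnth s i).

Let C0 : 0 <= C. Proof. exact: le_trans (XC point). Qed.

Let SC n (s : n.-tuple T) : `|S s| <= n%:R * C.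
Proof.
rewrite /S (le_trans (ler_norm_sum _ _ _))// (le_trans (ler_sum _ (fun i _ => XC _)))//.
by rewrite sumr_const card_ord mulr_natl.
Qed.

Let iS n : (iid_law P n).-integrable setT (EFin \o @S n).
Proof.
by apply: (@bounded_integrable _ _ _ (iid_law P n) (@S n) (n%:R * C));
  [exact: measurable_iid_sum|exact: SC].
Qed.

Let iS2 n : (iid_law P n).-integrable setT (EFin \o (fun s => @S n s ^+ 2)).
Proof.
apply: (@bounded_integrable _ _ _ _ _ ((n%:R * C) ^+ 2)).
  by apply: measurable_funX; exact: measurable_iid_sum.
by move=> s; rewrite normrX lerXn2r ?nnegrE ?mulr_ge0.
Qed.

Let iX : P.-integrable setT (EFin \o X).
Proof. exact: (@bounded_integrable _ _ _ _ _ _ mX XC). Qed.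

Let iX2 : P.-integrable setT (EFin \o (fun o => X o ^+ 2)).
Proof.
apply: (@bounded_integrable _ _ _ _ _ (C ^+ 2)); first exact: measurable_funX.
by move=> s; rewrite normrX lerXn2r ?nnegrE.
Qed.

Lemma iid_sum_mean n : \int[iid_law P n]_s S s = n%:R * \int[P]_o X o.
Proof.
elim: n => [|n IH].
  by rewrite Rintegral_iid0 ?mul0r /S ?big_ord0//; exact: measurable_iid_sum.
rewrite (Rintegral_iid_cons _ (@measurable_iid_sum _ _ _ X mX n.+1) (@SC n.+1)).
under eq_Rintegral => y _.
  under eq_Rintegral do rewrite iid_sum_cons.
  rewrite (RintegralD measurableT (integrable_cstR _ (X y)) (iS n)) Rintegral_cstT IH.
  over.
rewrite (RintegralD measurableT iX (integrable_cstR _ _)) Rintegral_cstT.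
by rewrite -natr1; ring.
Qed.

Lemma iid_sum_sqr n : \int[P]_o X o = 0 ->
  \int[iid_law P n]_s S s ^+ 2 = n%:R * \int[P]_o (X o ^+ 2).
Proof.
move=> X0; elim: n => [|n IH].
  rewrite Rintegral_iid0 ?mul0r /S ?big_ord0 ?expr0n//.
  by apply: measurable_funX; exact: measurable_iid_sum.
have bS (s : n.+1.-tuple T) : `|S s ^+ 2| <= (n.+1%:R * C) ^+ 2.
  by rewrite normrX lerXn2r ?nnegrE ?mulr_ge0.
have mS2 : measurable_fun setT (fun s : n.+1.-tuple T => S s ^+ 2).
  by apply: measurable_funX; exact: measurable_iid_sum.
rewrite (Rintegral_iid_cons _ mS2 bS).
under eq_Rintegral => y _.
  under eq_Rintegral do rewrite /S iid_sum_cons sqrrD -/(S _) -mulrnAl.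
  rewrite (RintegralD measurableT (integrableDR (integrable_cstR _ (X y ^+ 2))
    (integrableZR (X y *+ 2) (iS n))) (iS2 n)).
  rewrite (RintegralD measurableT (integrable_cstR _ (X y ^+ 2))
    (integrableZR (X y *+ 2) (iS n))).
  rewrite (RintegralZl _ measurableT (iS n)) iid_sum_mean X0 !mulr0 addr0 IH.
  rewrite Rintegral_cstT.
  over.
rewrite (RintegralD measurableT iX2 (integrable_cstR _ _)) Rintegral_cstT.
by rewrite -natr1; ring.
Qed.

(** The variance is bounded through the sup bound C alone, so the estimate is uniform over laws that
    vary with n. *)
Lemma iid_chebyshev n (M : R) : (0 < n)%N -> 0 < M -> \int[P]_o X o = 0 ->
  (iid_law P n [set s | (M < `|(Num.sqrt n%:R)^-1 * S s|)%R] <= (C ^+ 2 / M ^+ 2)%:E)%E.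
Proof.
move=> n0 M0 X0; set E := [set s | _].
have n0R : 0 < n%:R :> R by rewrite ltr0n.
have mE : measurable E.
  apply: measurable_gt_set; apply: measurableT_comp => //.
  by apply: measurable_funM => //; exact: measurable_iid_sum.
have fE : iid_law P n E \is a fin_num by exact: fin_num_measure.
rewrite -(fineK fE) lee_fin ler_pdivlMr ?exprn_gt0//.
have iE : (iid_law P n).-integrable setT (EFin \o \1_E) by exact: integrable_indic.
have -> : fine (iid_law P n E) * M ^+ 2 = \int[iid_law P n]_s (M ^+ 2 * \1_E s).
  rewrite (RintegralZl _ measurableT iE) mulrC; congr (_ * _).
  by rewrite /Rintegral integral_indic// setIT.
have -> : C ^+ 2 = \int[P]_o C ^+ 2 by rewrite Rintegral_cstT.
apply: (@le_trans _ _ (\int[P]_o (X o ^+ 2))); last first.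
  apply: le_Rintegral => //; first exact: integrable_cstR.
  by move=> o _; rewrite -(@real_normK _ (X o)) ?num_real// lerXn2r ?nnegrE.
have -> : \int[P]_o (X o ^+ 2) = \int[iid_law P n]_s (n%:R^-1 * S s ^+ 2).
  rewrite (RintegralZl _ measurableT (iS2 n)) iid_sum_sqr//.
  by rewrite mulrA mulVf ?gt_eqF// mul1r.
apply: le_Rintegral => //.
- exact: (integrableZR (M ^+ 2) iE).
- exact: (integrableZR n%:R^-1 (iS2 n)).
move=> s _; rewrite indicE; case: (boolP (s \in E)) => [|_].
  rewrite inE /E/= => Ms; rewrite mulr1.
  have -> : n%:R^-1 * S s ^+ 2 = `|(Num.sqrt n%:R)^-1 * S s| ^+ 2.
    by rewrite real_normK ?num_real// exprMn exprVn sqr_sqrtr ?ler0n.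
  by rewrite lerXn2r ?nnegrE ?(ltW M0) ?(ltW Ms).
by rewrite mulr0 mulr_ge0 ?sqr_ge0// invr_ge0 ltW.
Qed.

End iid_moments.

(** * Cell moments *)

Section functionals.
Context {R : realType} {J K : nat}.
(* [th k x a] plays the part of E[1{X = x, A = a} Y^k], k <= 2, for a law or for
   a sample. *)
Definition moments := nat -> 'I_J.+1 -> 'I_K.+1 -> R.
Implicit Types (th : moments) (x : 'I_J.+1) (a : 'I_K.+1).

Definition tpr th x : R := \sum_a th 0%N x a.
Definition tprop th a x : R := th 0%N x a / tpr th x.
Definition tmean th a x : R := th 1%N x a / th 0%N x a.
Definition tvar th a x : R := th 2%N x a / th 0%N x a - tmean th a x ^+ 2.
Definition tq th x : R := maxover predT (tmean th ^~ x).
Definition topt th x : {pred 'I_K.+1} :=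
  [pred a | [forall b, tmean th b x <= tmean th a x]].

Lemma toptP th a x : reflect (forall b, tmean th b x <= tmean th a x) (a \in topt th x).
Proof. exact: forallP. Qed.

Lemma topt_max th a x : a \in topt th x -> tmean th a x = tq th x.
Proof.
move=> /toptP am; have [[b _ qb] ub] := @maxoverP R _ predT (tmean th ^~ x) a isT.
by apply/eqP; rewrite eq_le ub//= /tq qb am.
Qed.

Lemma topt_nonempty th x : exists a, a \in topt th x.
Proof.
have [[b _ qb] ub] := @maxoverP R _ predT (tmean th ^~ x) ord0 isT.
by exists b; apply/toptP => a; rewrite -qb ub.
Qed.

Lemma maxover_ge (A : {pred 'I_K.+1}) (f : 'I_K.+1 -> R) a : a \in A -> f a <= maxover A f.
Proof. by move=> aA; have [_] := maxoverP f aA; apply. Qed.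

Lemma maxover_ex (A : {pred 'I_K.+1}) (f : 'I_K.+1 -> R) a0 : a0 \in A ->
  exists2 a, a \in A & maxover A f = f a.
Proof. by move=> aA; have [] := maxoverP f aA. Qed.

End functionals.

(** * Deterministic expansions of functionals of cell moments along a filter *)

Section bounded_near.
Context {R : realType} {Z : Type} (F : set_system Z) {FF : Filter F}.
Implicit Types f g : Z -> R.

(** O(1) along F; applied to N z times an error, this is the deterministic counterpart of tightness
    at rate 1 / N. *)
Definition bdd f := exists M, \forall z \near F, `|f z| <= M.

Lemma cvg_bdd f (l : R) : f @ F --> l -> bdd f.
Proof.
move=> /cvgrPdist_le/(_ 1 ltr01) H; exists (`|l| + 1); near=> z.
have h : `|l - f z| <= 1 by near: z.
by rewrite -[f z](subKr l) (le_trans (ler_normB _ _))// lerD2l.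
Unshelve. all: by end_near. Qed.

Lemma cvg_fin_sum (I : finType) (P : pred I) (f : I -> Z -> R) (l : I -> R) :
  (forall i, P i -> f i z @[z --> F] --> l i) ->
  \sum_(i | P i) f i z @[z --> F] --> \sum_(i | P i) l i.
Proof.
move=> fl; elim: (index_enum I) => [|i r IH].
  by rewrite big_nil; under eq_fun do rewrite big_nil; exact: cvg_cst.
rewrite big_cons; under eq_fun do rewrite big_cons.
by case: ifPn => // Pi; apply: cvgD => //; exact: fl.
Qed.

Lemma bddD f g : bdd f -> bdd g -> bdd (f \+ g).
Proof.
move=> [M fM] [M' gM]; exists (M + M'); near=> z.
by rewrite /= (le_trans (ler_normD _ _))// lerD//; near: z.
Unshelve. all: by end_near. Qed.

Lemma bddM f g : bdd f -> bdd g -> bdd (f \* g).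
Proof.
move=> [M fM] [M' gM]; exists (M * M'); near=> z.
by rewrite /= normrM ler_pM//; near: z.
Unshelve. all: by end_near. Qed.

Lemma bdd_mul_cvg0 f g : bdd f -> g @ F --> 0 -> (fun z => f z * g z) @ F --> 0.
Proof.
move=> [M fM] /cvgr0Pnorm_le g0; apply/cvgr0Pnorm_le => e e0.
have M10 : 0 < `|M| + 1 by rewrite ltr_wpDl.
have d0 : 0 < e / (`|M| + 1) by rewrite divr_gt0.
near=> z.
have h1 : `|f z| <= M by near: z.
have h2 : `|g z| <= e / (`|M| + 1) by near: z; exact: g0.
rewrite normrM (le_trans (ler_pM (normr_ge0 _) (normr_ge0 _) h1 h2))//.
rewrite mulrCA ler_piMr// ?(ltW e0)// ler_pdivrMr// mul1r.
by rewrite (le_trans (ler_norm M))// lerDl.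
Unshelve. all: by end_near. Qed.

Lemma bdd_scaled_cvg0 (N f : Z -> R) : N @ F --> +oo -> bdd (fun z => N z * f z) -> f @ F --> 0.
Proof.
move=> Ny bf.
have Ni : (fun z => (N z)^-1) @ F --> (0 : R).
  apply/gtr0_cvgV0 => //; exact: (@cvgry_gt _ _ _ _ _ Ny 0).
have := bdd_mul_cvg0 bf Ni; apply: cvg_trans; apply: near_eq_cvg.
have : \forall z \near F, 0 < N z by exact: (@cvgry_gt _ _ _ _ _ Ny 0).
by apply: filterS => z Nz; rewrite mulrAC divff ?mul1r// gt_eqF.
Qed.

End bounded_near.

Section expansions.
Context {R : realType} {J K : nat} {Z : Type} (F : set_system Z) {FF : Filter F}.
Local Notation moments := (@moments R J K).
Variables (N : Z -> R) (th_ : Z -> moments) (th : moments).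
Implicit Types (x : 'I_J.+1) (a : 'I_K.+1).
Hypothesis Ny : N @ F --> +oo.
Hypothesis th_bdd : forall k x a, (k < 3)%N ->
  bdd F (fun z => N z * (th_ z k x a - th k x a)).
Hypothesis th0 : forall x a, 0 < th 0%N x a.

Lemma th_cvg k x a : (k < 3)%N -> th_ z k x a @[z --> F] --> th k x a.
Proof.
move=> k3; have H := bdd_scaled_cvg0 Ny (th_bdd x a k3).
rewrite -[X in _ --> X]add0r -[X in X @ _](funext (fun z => subrK (th k x a) (th_ z k x a))).
by apply: cvgD; [exact: H|exact: cvg_cst].
Qed.

Lemma tpr_gt0 x : 0 < tpr th x.
Proof.
rewrite /tpr (bigD1 ord0)//= ltr_wpDr// sumr_ge0// => a _; exact: ltW.
Qed.

Lemma tprop_gt0 a x : 0 < tprop th a x.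
Proof. by rewrite divr_gt0// tpr_gt0. Qed.

Lemma th0_near : \forall z \near F, forall x a, 0 < th_ z 0%N x a.
Proof.
apply: filter_forall => x; apply: filter_forall => a.
exact: (cvgr_gt _ (@th_cvg 0 x a isT)).
Qed.

Lemma tpr_cvg x : tpr (th_ z) x @[z --> F] --> tpr th x.
Proof. by apply: cvg_fin_sum => a _; exact: th_cvg. Qed.

Lemma tprop_cvg a x : tprop (th_ z) a x @[z --> F] --> tprop th a x.
Proof.
by apply: cvgM; [exact: th_cvg|apply: cvgV; [rewrite gt_eqF ?tpr_gt0|exact: tpr_cvg]].
Qed.

Lemma th0V_cvg x a : (th_ z 0%N x a)^-1 @[z --> F] --> (th 0%N x a)^-1.
Proof. by apply: cvgV; [rewrite gt_eqF|exact: th_cvg]. Qed.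

Lemma tmean_cvg a x : tmean (th_ z) a x @[z --> F] --> tmean th a x.
Proof. by apply: cvgM; [exact: th_cvg|exact: th0V_cvg]. Qed.

Lemma tvar_cvg a x : tvar (th_ z) a x @[z --> F] --> tvar th a x.
Proof.
apply: cvgB; first by apply: cvgM; [exact: th_cvg|exact: th0V_cvg].
rewrite !expr2; under eq_fun do rewrite expr2.
by apply: cvgM; exact: tmean_cvg.
Qed.

(** The cell moment of Y - mu under [th_ z], with mu the cell mean under [th]. It is linear in the
    moments and, divided by the cell mass at z, is the exact error of the cell mean
    ([tmean_dmean]). *)
Definition dmean z x a := th_ z 1%N x a - tmean th a x * th_ z 0%N x a.

Lemma dmeanE z x a : dmean z x a =
  (th_ z 1%N x a - th 1%N x a) - tmean th a x * (th_ z 0%N x a - th 0%N x a).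
Proof.
have E : tmean th a x * th 0%N x a = th 1%N x a by rewrite divfK// gt_eqF.
by rewrite /dmean -E; ring.
Qed.

Lemma dmean_bdd x a : bdd F (fun z => N z * dmean z x a).
Proof.
have := bddD (@th_bdd 1 x a isT) (bddM (cvg_bdd (cvg_cst (- tmean th a x)))
  (@th_bdd 0 x a isT)).
move=> [M HM]; exists M; apply: filterS HM => z /=.
by rewrite dmeanE; congr (`|_| <= _); ring.
Qed.

Lemma tmean_dmean z x a : 0 < th_ z 0%N x a ->
  N z * (tmean (th_ z) a x - tmean th a x) = N z * dmean z x a * (th_ z 0%N x a)^-1.
Proof.
by move=> h; rewrite /dmean {1}/tmean; field; rewrite !gt_eqF.
Qed.

Lemma tmean_bdd x a : bdd F (fun z => N z * (tmean (th_ z) a x - tmean th a x)).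
Proof.
have [M HM] := bddM (dmean_bdd x a) (cvg_bdd (@th0V_cvg x a)).
exists M; near=> z.
have h : forall x a, 0 < th_ z 0%N x a by near: z; exact: th0_near.
by rewrite tmean_dmean//; near: z.
Unshelve. all: by end_near. Qed.

Lemma topt_near : \forall z \near F, forall x a, a \notin topt th x ->
  exists b, tmean (th_ z) a x < tmean (th_ z) b x.
Proof.
apply: filter_forall => x; apply: filter_forall => a.
have [_|aN] := boolP (a \in topt th x); first by near=> z.
have [b ab] : exists b, tmean th a x < tmean th b x.
  by move: aN; rewrite inE/= negb_forall => /existsP[b]; rewrite -ltNge; exists b.
have H : tmean (th_ z) b x - tmean (th_ z) a x @[z --> F] --> tmean th b x - tmean th a x.
  by apply: cvgB; exact: tmean_cvg.
have H0 : 0 < tmean th b x - tmean th a x by rewrite subr_gt0.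
near=> z => _; exists b; rewrite -subr_gt0; near: z.
exact: (cvgr_gt _ H).
Unshelve. all: by end_near. Qed.

(** An optimal cell mean falls short of the maximum by O(1 / N), which is below tau because N tau
    diverges; a suboptimal one stays a fixed distance below while tau vanishes. Optimality refers to
    [th], so ties under P are recovered even from samples of a law that breaks them at order 1 /
    N. *)
Lemma topt_hat_near (tau : Z -> R) : tau @ F --> 0 -> (fun z => N z * tau z) @ F --> +oo ->
  \forall z \near F, forall x a,
    (tq (th_ z) x - tmean (th_ z) a x <= tau z) = (a \in topt th x).
Proof.
move=> tau0 Ntau.
apply: filter_forall => x; apply: filter_forall => a.
have Npos := @cvgry_gt _ _ _ _ _ Ny 0.
have [aO|aN] := boolP (a \in topt th x).
  have H : \forall z \near F, forall b, tmean (th_ z) b x - tmean (th_ z) a x <= tau z.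
    apply: filter_forall => b.
    have [M HM] := tmean_bdd x a; have [M' HM'] := tmean_bdd x b.
    have NM := @cvgry_ge _ _ _ _ _ Ntau (M + M').
    near=> z.
    have Nz : 0 < N z by near: z; exact: Npos.
    have h1 : `|N z * (tmean (th_ z) a x - tmean th a x)| <= M by near: z.
    have h2 : `|N z * (tmean (th_ z) b x - tmean th b x)| <= M' by near: z.
    have h3 : M + M' <= N z * tau z by near: z; exact: NM.
    rewrite -(ler_pM2l Nz) (le_trans _ h3)//.
    have ab : tmean th b x <= tmean th a x by move/toptP: aO.
    rewrite (@le_trans _ _ (N z * (tmean (th_ z) b x - tmean th b x)
       - N z * (tmean (th_ z) a x - tmean th a x)))//.
      by rewrite -mulrBr ler_pM2l//; lra.
    rewrite (le_trans (ler_norm _))// (le_trans (ler_normB _ _))// addrC.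
    exact: lerD.
  apply: filterS H => z H.
  by have [b _ qb] := @maxover_ex R K predT (tmean (th_ z) ^~ x) ord0 isT; rewrite /tq qb H.
have [b ab] : exists b, tmean th a x < tmean th b x.
  by move: aN; rewrite inE/= negb_forall => /existsP[b]; rewrite -ltNge; exists b.
have H : tmean (th_ z) b x - tmean (th_ z) a x - tau z @[z --> F] -->
    tmean th b x - tmean th a x - 0.
  by apply: cvgB => //; apply: cvgB; exact: tmean_cvg.
have H0 : 0 < tmean th b x - tmean th a x - 0 by rewrite subr0 subr_gt0.
near=> z; apply/negP/negP; rewrite -ltNge.
have h : 0 < tmean (th_ z) b x - tmean (th_ z) a x - tau z.
  by near: z; exact: (cvgr_gt _ H).
have := @maxover_ge R K predT (tmean (th_ z) ^~ x) b isT.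
by rewrite -/(tq _ _); lra.
Unshelve. all: by end_near. Qed.

(* A weight W need not converge at rate 1 / N: as the weights sum to 1 over
   cells with a common mean, its error only multiplies errors of cell means. *)
Lemma weighted_expansion (w : 'I_K.+1 -> 'I_J.+1 -> R) (W : Z -> 'I_K.+1 -> 'I_J.+1 -> R) :
  (\forall z \near F, forall x a, a \notin topt th x -> W z a x = 0) ->
  (\forall z \near F, forall x, \sum_a W z a x = 1) ->
  (forall x a, W z a x @[z --> F] --> w a x) ->
  N z * (\sum_x tpr (th_ z) x * \sum_a W z a x * tmean (th_ z) a x
    - \sum_x tpr (th_ z) x * tq th x
    - \sum_x \sum_a w a x / tprop th a x * dmean z x a) @[z --> F] --> 0.
Proof.
move=> W0 W1 Wcvg.
(* Each summand is a bounded factor times one that vanishes. As soon as all cell masses at z are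
   positive, the remainder of the lemma equals this sum exactly. *)
have lim : \sum_x \sum_a (N z * dmean z x a *
    (W z a x / tprop (th_ z) a x - w a x / tprop th a x)) @[z --> F] -->
    \sum_(x : 'I_J.+1) \sum_(a : 'I_K.+1) (0 : R).
  apply: cvg_fin_sum => x _; apply: cvg_fin_sum => a _.
  apply: bdd_mul_cvg0; first exact: dmean_bdd.
  rewrite -(subrr (w a x / tprop th a x)); apply: cvgB; last exact: cvg_cst.
  apply: cvgM; first exact: Wcvg.
  by apply: cvgV; [rewrite gt_eqF// tprop_gt0|exact: tprop_cvg].
rewrite (_ : \sum_x \sum_a 0 = 0) in lim; last first.
  by rewrite big1// => x _; rewrite big1.
apply: cvg_trans lim; apply: near_eq_cvg; near=> z.
have h0 : forall x a, a \notin topt th x -> W z a x = 0 by near: z.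
have h1 : forall x, \sum_a W z a x = 1 by near: z.
have hth : forall x a, 0 < th_ z 0%N x a by near: z; exact: th0_near.
have tp x : 0 < tpr (th_ z) x.
  by rewrite /tpr (bigD1 ord0)//= ltr_wpDr// sumr_ge0// => a _; exact: ltW.
rewrite -sumrB -sumrB mulr_sumr; apply: eq_bigr => x _.
have E : \sum_a W z a x * tmean (th_ z) a x - tq th x =
    \sum_a W z a x * (tmean (th_ z) a x - tmean th a x).
  rewrite -[X in _ - X]mul1r -(h1 x) mulr_suml -sumrB; apply: eq_bigr => a _.
  have [aO|/h0 ->] := boolP (a \in topt th x); last by rewrite !mul0r subrr.
  by rewrite -(topt_max aO) mulrBr.
rewrite -mulrBr E mulr_sumr -sumrB mulr_sumr; apply: eq_bigr => a _.
apply/esym; set k := w a x / tprop th a x.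
rewrite (_ : N z * _ = N z * (tmean (th_ z) a x - tmean th a x) * (W z a x * tpr (th_ z) x)
  - N z * dmean z x a * k); last by ring.
by rewrite tmean_dmean// /tprop; field; rewrite !gt_eqF.
Unshelve. all: by end_near. Qed.

Variable eta : moments.
Hypothesis th_eta : forall k x a, (k < 3)%N ->
  N z * (th_ z k x a - th k x a) @[z --> F] --> eta k x a.

Lemma tmean_deriv x a : N z * (tmean (th_ z) a x - tmean th a x) @[z --> F] -->
  (eta 1%N x a - tmean th a x * eta 0%N x a) / th 0%N x a.
Proof.
have H : (N z * (th_ z 1%N x a - th 1%N x a) -
    tmean th a x * (N z * (th_ z 0%N x a - th 0%N x a))) * (th_ z 0%N x a)^-1 @[z --> F] -->
  (eta 1%N x a - tmean th a x * eta 0%N x a) * (th 0%N x a)^-1.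
  apply: cvgM; last exact: th0V_cvg.
  by apply: cvgB; [exact: th_eta|apply: cvgM; [exact: cvg_cst|exact: th_eta]].
apply: cvg_trans H; apply: near_eq_cvg; near=> z.
have h : forall x a, 0 < th_ z 0%N x a by near: z; exact: th0_near.
by rewrite tmean_dmean// dmeanE; ring.
Unshelve. all: by end_near. Qed.

(** Danskin's formula for a finite maximum. Eventually a maximizer b at z is optimal for [th], and
    all difference quotients are within e of their limits g. If a maximizes g over the optimal set,
    then y a <= y b and g b <= g a, which squeezes y b to within e of g a. *)
Lemma tq_deriv x : N z * (tq (th_ z) x - tq th x) @[z --> F] -->
  maxover (topt th x) (fun a => (eta 1%N x a - tmean th a x * eta 0%N x a) / th 0%N x a).
Proof.
set g := fun a => _; have [a0 a0O] := topt_nonempty th x.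
pose y z a := N z * (tmean (th_ z) a x - tmean th a x).
have Sy : \sum_a `|y z a - g a| @[z --> F] --> \sum_(a : 'I_K.+1) (0 : R).
  apply: cvg_fin_sum => a _; rewrite -[X in _ --> X](normr0 R); apply: cvg_norm.
  by rewrite -(subrr (g a)); apply: cvgB; [exact: tmean_deriv|exact: cvg_cst].
rewrite big1// in Sy.
have Npos := @cvgry_gt _ _ _ _ _ Ny 0.
apply/cvgrPdist_le => e e0; have /cvgr0Pnorm_le/(_ e e0) Se := Sy.
near=> z.
have Nz : 0 < N z by near: z; exact: Npos.
have hS : \sum_a `|y z a - g a| <= e.
  by rewrite (le_trans (ler_norm _))//; near: z.
have h1 a : `|y z a - g a| <= e.
  by apply: le_trans hS; rewrite (bigD1 a)//= lerDl sumr_ge0.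
have hO : forall x a, a \notin topt th x -> exists b, tmean (th_ z) a x < tmean (th_ z) b x.
  by near: z; exact: topt_near.
have [b _ qb] := @maxover_ex R K predT (tmean (th_ z) ^~ x) ord0 isT.
have bO : b \in topt th x.
  apply/negPn/negP => /hO[c bc].
  have := @maxover_ge R K predT (tmean (th_ z) ^~ x) c isT.
  by rewrite qb leNgt bc.
have [a aO ga] := @maxover_ex R K (topt th x) g a0 a0O.
have qE : N z * (tq (th_ z) x - tq th x) = y z b by rewrite /y -(topt_max bO) /tq qb.
have ya : y z a <= y z b.
  rewrite /y (topt_max aO) (topt_max bO) ler_pM2l// lerD2r.
  by have := @maxover_ge R K predT (tmean (th_ z) ^~ x) a isT; rewrite qb.
have gb : g b <= g a by rewrite -ga; exact: maxover_ge.
rewrite qE ga; have := h1 a; have := h1 b; rewrite !ler_norml.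
by move=> /andP[? ?] /andP[? ?]; apply/andP; split; lra.
Unshelve. all: by end_near. Qed.

Lemma Psi_deriv :
  N z * (\sum_x tpr (th_ z) x * tq (th_ z) x - \sum_x tpr th x * tq th x) @[z --> F] -->
  \sum_x (tq th x * \sum_a eta 0%N x a + tpr th x *
    maxover (topt th x) (fun a => (eta 1%N x a - tmean th a x * eta 0%N x a) / th 0%N x a)).
Proof.
(* The product rule for increments is exact when the stratum masses in front of the increments of
   the maxima are those at z. *)
have H : \sum_x (tq th x * \sum_a (N z * (th_ z 0%N x a - th 0%N x a)) +
    tpr (th_ z) x * (N z * (tq (th_ z) x - tq th x))) @[z --> F] -->
  \sum_x (tq th x * \sum_a eta 0%N x a + tpr th x *
    maxover (topt th x) (fun a => (eta 1%N x a - tmean th a x * eta 0%N x a) / th 0%N x a)).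
  apply: cvg_fin_sum => x _; apply: cvgD; apply: cvgM.
  - exact: cvg_cst.
  - by apply: cvg_fin_sum => a _; exact: th_eta.
  - exact: tpr_cvg.
  - exact: tq_deriv.
apply: cvg_trans H; apply: near_eq_cvg; apply: nearW => z.
rewrite -sumrB mulr_sumr; apply: eq_bigr => x _.
by rewrite -mulr_sumr sumrB /tpr; ring.
Qed.

End expansions.

(** * Parameters of a law as functions of clipped cell moments *)

Section moments_of_law.
Context {R : realType} {J K : nat}.
Local Notation O := (obs J K R).
Implicit Types (P Q : probability O R) (x : 'I_J.+1) (a : 'I_K.+1) (o : O).
Variable B0 : R.

(* Clipping Y makes the cell moments bounded under every law and changes nothing
   in the model. *)
Definition clip (y : R) : R := maxr (- B0) (minr y B0).

Lemma clipE y : `|y| <= B0 -> clip y = y.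
Proof. by rewrite ler_norml => /andP[h1 h2]; rewrite /clip min_l// max_r. Qed.

Lemma clip_le y : `|clip y| <= `|B0|.
Proof.
rewrite /clip; have [B00|B00] := leP 0 B0.
  rewrite (ger0_norm B00) ler_norml le_max lexx/= ge_max ge_min lexx orbT andbT.
  by rewrite (le_trans _ B00)// oppr_le0.
rewrite max_l ?normrN//; rewrite ge_min; apply/orP; right.
by rewrite (le_trans (ltW B00))// oppr_ge0 ltW.
Qed.

Lemma measurable_clip : measurable_fun setT clip.
Proof.
by apply: measurable_maxr => //; apply: measurable_minr => //; exact: measurable_id.
Qed.

Definition in_cell x a o : bool := (strat o == x) && (treat o == a).

Lemma measurable_strat : measurable_fun setT (@strat R J K).
Proof. by apply: measurableT_comp; [exact: measurable_fst|exact: measurable_fst]. Qed.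

Lemma measurable_treat : measurable_fun setT (@treat R J K).
Proof. by apply: measurableT_comp; [exact: measurable_snd|exact: measurable_fst]. Qed.

Lemma measurable_outcome : measurable_fun setT (@outcome R J K).
Proof. exact: measurable_snd. Qed.

Lemma measurable_stratum x : measurable (@stratum R J K x).
Proof.
rewrite -[X in measurable X]setTI.
exact: (measurable_strat measurableT (I : measurable [set x])).
Qed.

Lemma measurable_cell x a : measurable (@cell R J K x a).
Proof.
rewrite (_ : cell x a = stratum x `&` (setT `&` @treat R J K @^-1` [set a])).
  apply: measurableI; first exact: measurable_stratum.
  exact: (measurable_treat measurableT (I : measurable [set a])).
by rewrite setTI.
Qed.

Lemma in_cellE x a o : (in_cell x a o)%:R = \1_(cell x a) o :> R.
Proof.
rewrite indicE; congr (_%:R); congr nat_of_bool.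
by apply/andP/idP => [[/eqP ? /eqP ?]|]; rewrite inE//= => -[/eqP ? /eqP ?].
Qed.

Lemma measurable_in_cell x a : measurable_fun setT (fun o => (in_cell x a o)%:R : R).
Proof.
rewrite (_ : (fun o => _) = \1_(cell x a)); last by apply/funext => o; exact: in_cellE.
by apply: measurable_indic; exact: measurable_cell.
Qed.

Lemma cell_sum (c : 'I_J.+1 -> 'I_K.+1 -> R) o :
  \sum_x \sum_a (in_cell x a o)%:R * c x a = c (strat o) (treat o).
Proof.
rewrite (bigD1 (strat o))//= (bigD1 (treat o))//= /in_cell !eqxx mul1r.
rewrite big1 => [|a ane]; last by rewrite eq_sym (negbTE ane) mul0r.
rewrite big1 => [|x xne]; last first.
  by apply: big1 => a _; rewrite eq_sym (negbTE xne) mul0r.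
by rewrite !addr0.
Qed.

Definition cellmom k x a o : R := (in_cell x a o)%:R * clip (outcome o) ^+ k.

(** The added 1 lets the square dominate the zeroth and first powers of the clipped outcome as
    well. *)
Definition mbound : R := (1 + `|B0|) ^+ 2.

Lemma cellmom_le k x a o : (k < 3)%N -> `|cellmom k x a o| <= mbound.
Proof.
move=> k3; have B1 : 1 <= 1 + `|B0| by rewrite lerDl.
rewrite /cellmom normrM normrX -[leRHS]mul1r ler_pM//.
  by case: (in_cell _ _ _); rewrite ?normr1 ?normr0.
apply: (@le_trans _ _ ((1 + `|B0|) ^+ k)).
  by rewrite lerXn2r ?nnegrE ?addr_ge0// (le_trans (clip_le _))// lerDr.
by rewrite ler_weXn2l.
Qed.

Lemma measurable_cellmom k x a : measurable_fun setT (cellmom k x a).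
Proof.
apply: measurable_funM; first exact: measurable_in_cell.
apply: measurable_funX; apply: measurableT_comp; first exact: measurable_clip.
exact: measurable_outcome.
Qed.

Definition mom Q : @moments R J K := fun k x a => \int[Q]_o cellmom k x a o.

Lemma cellmom_integrable Q k x a : (k < 3)%N -> Q.-integrable setT (EFin \o cellmom k x a).
Proof.
move=> k3; apply: (@bounded_integrable _ _ _ Q _ mbound).
  exact: measurable_cellmom.
by move=> o; exact: cellmom_le.
Qed.

(** Linearity of the integral, stated once for affine combinations of all cell moments: stratum
    probabilities, Psi, the influence function and its square all have this shape. *)
Lemma Rintegral_sum_cellmom Q (c : nat -> 'I_J.+1 -> 'I_K.+1 -> R) (e : R) :
  \int[Q]_o (e + \sum_x \sum_a (c 0%N x a * cellmom 0 x a o + c 1%N x a * cellmom 1 x a o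
     + c 2%N x a * cellmom 2 x a o)) =
  e + \sum_x \sum_a (c 0%N x a * mom Q 0 x a + c 1%N x a * mom Q 1 x a
     + c 2%N x a * mom Q 2 x a).
Proof.
have i x a k (k3 : (k < 3)%N) := integrableZR (c k x a) (cellmom_integrable Q x a k3).
have i3 x a : Q.-integrable setT (EFin \o (fun o => c 0%N x a * cellmom 0 x a o +
     c 1%N x a * cellmom 1 x a o + c 2%N x a * cellmom 2 x a o)).
  exact: (integrableDR (integrableDR (i x a 0%N isT) (i x a 1%N isT)) (i x a 2%N isT)).
have isum (I : Type) (r : seq I) (f : I -> O -> R) :
    (forall i, Q.-integrable setT (EFin \o f i)) ->
    Q.-integrable setT (EFin \o (fun o => \sum_(i <- r) f i o)) /\
    \int[Q]_o (\sum_(i <- r) f i o) = \sum_(i <- r) \int[Q]_o f i o.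
  move=> fi; elim: r => [|j r [IH1 IH2]].
    rewrite big_nil; under eq_fun do rewrite big_nil.
    split; first exact: integrable_cstR.
    by rewrite Rintegral_cstT.
  rewrite big_cons -IH2 -(RintegralD measurableT (fi j) IH1); split.
    by under eq_fun do rewrite big_cons; exact: (integrableDR (fi j) IH1).
  by apply: eq_Rintegral => o _; rewrite big_cons.
have is1 x := isum _ (index_enum 'I_K.+1) _ (i3 x).
have is2 := isum _ (index_enum 'I_J.+1) _ (fun x => (is1 x).1).
rewrite (RintegralD measurableT (integrable_cstR Q e) is2.1) Rintegral_cstT is2.2.
congr (_ + _); apply: eq_bigr => x _; rewrite (is1 x).2; apply: eq_bigr => a _.
rewrite (RintegralD measurableT (integrableDR (i x a 0%N isT) (i x a 1%N isT)) (i x a 2%N isT)).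
rewrite (RintegralD measurableT (i x a 0%N isT) (i x a 1%N isT)).
rewrite (RintegralZl _ measurableT (cellmom_integrable Q x a (isT : (0 < 3)%N))).
rewrite (RintegralZl _ measurableT (cellmom_integrable Q x a (isT : (1 < 3)%N))).
by rewrite (RintegralZl _ measurableT (cellmom_integrable Q x a (isT : (2 < 3)%N))).
Qed.

Lemma mom_setE Q x a : fine (Q (cell x a)) = mom Q 0 x a.
Proof.
rewrite /mom /Rintegral; congr fine; rewrite -(setIT (cell x a)) -integral_indic//;
  last exact: measurable_cell.
by apply: eq_integral => o _; rewrite /cellmom expr0 mulr1 in_cellE.
Qed.

Lemma prE Q : pr Q = tpr (mom Q).
Proof.
apply/funext => x; rewrite /pr.
have -> : tpr (mom Q) x = 0 + \sum_x' \sum_a ((x' == x)%:R * mom Q 0 x' a +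
   0 * mom Q 1 x' a + 0 * mom Q 2 x' a).
  rewrite add0r (bigD1 x)//= [X in _ + X]big1 => [|y /negbTE ->]; last first.
    by apply: big1 => a _; rewrite !mul0r !addr0.
  by rewrite addr0; apply: eq_bigr => a _; rewrite eqxx mul1r !mul0r !addr0.
rewrite -(Rintegral_sum_cellmom Q (fun k x' a => if k is 0%N then (x' == x)%:R else 0)).
rewrite /Rintegral; congr fine.
rewrite -(setIT (stratum x)) -integral_indic//; last exact: measurable_stratum.
apply: eq_integral => o _; congr (_%:E); rewrite add0r.
transitivity (\sum_x' \sum_a (in_cell x' a o)%:R * ((x' == x)%:R : R)).
  rewrite (cell_sum (fun x' a => (x' == x)%:R)) indicE; congr (_%:R); congr nat_of_bool.
  by apply/idP/eqP; rewrite inE.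
apply: eq_bigr => x' _; apply: eq_bigr => a _.
by rewrite /cellmom expr0 mulr1 !mul0r !addr0 mulrC.
Qed.

Lemma propE Q : prop Q = tprop (mom Q).
Proof.
by apply/funext => a; apply/funext => x; rewrite /prop /tprop mom_setE -prE.
Qed.

Section in_model.
Variables (eps : R) (Q : probability O R).
Hypothesis QM : in_model B0 eps Q.

Lemma measurable_unbounded : measurable [set o : O | B0 < `|outcome o|].
Proof.
apply: measurable_gt_set; apply: measurableT_comp => //.
exact: measurable_outcome.
Qed.

(** The integrands can differ only on the null event |Y| > B0. This is what permits replacing Y by
    [clip] in the parameters of a law in the model. *)
Lemma model_Rintegral (u v : O -> R) : measurable_fun setT u -> measurable_fun setT v ->
  (forall o, `|outcome o| <= B0 -> u o = v o) -> \int[Q]_o u o = \int[Q]_o v o.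
Proof.
move=> mu mv uv; rewrite /Rintegral; congr fine; apply: ae_eq_integral => //.
- exact/measurable_EFinP.
- exact/measurable_EFinP.
exists [set o | B0 < `|outcome o|]; split.
- exact: measurable_unbounded.
- exact: QM.1.
- move=> o /= ne; rewrite ltNge; apply/negP => oB; apply: ne => _.
  by rewrite uv.
Qed.

Lemma cond_mean_cell (g : R -> R) x a : measurable_fun setT g ->
  cond_mean Q (fun o => g (outcome o)) (cell x a) =
  (\int[Q]_o ((in_cell x a o)%:R * g (clip (outcome o)))) / mom Q 0 x a.
Proof.
move=> mg; rewrite /cond_mean mom_setE; congr (_ / _).
rewrite Rintegral_mkcond.
have E : (fun o => g (outcome o)) \_ (cell x a) = (fun o => (in_cell x a o)%:R * g (outcome o)).
  apply/funext => o; rewrite patchE in_cellE indicE.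
  by case: ifPn => _; rewrite ?mul1r ?mul0r.
rewrite E; apply: model_Rintegral.
- apply: measurable_funM; first exact: measurable_in_cell.
  by apply: measurableT_comp => //; exact: measurable_outcome.
- apply: measurable_funM; first exact: measurable_in_cell.
  apply: measurableT_comp => //; apply: measurableT_comp; first exact: measurable_clip.
  exact: measurable_outcome.
- by move=> o /clipE ->.
Qed.

Lemma meanE : mean Q = tmean (mom Q).
Proof.
apply/funext => a; apply/funext => x.
exact: (@cond_mean_cell (fun y => y)).
Qed.

Lemma qmaxE : qmax Q = tq (mom Q).
Proof. by apply/funext => x; rewrite /qmax meanE. Qed.

Lemma optimalE x : optimal Q x = topt (mom Q) x.
Proof. by rewrite /optimal meanE. Qed.

Lemma varE a x : mom Q 0 x a != 0 -> var Q a x = tvar (mom Q) a x.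
Proof.
move=> m0; rewrite /var (@cond_mean_cell (fun y => (y - mean Q a x) ^+ 2)); last first.
  by apply: measurable_funX; apply: measurable_funB.
rewrite meanE; set mu := tmean _ a x.
have -> : \int[Q]_o ((in_cell x a o)%:R * (clip (outcome o) - mu) ^+ 2) =
    mom Q 2 x a - 2 * mu * mom Q 1 x a + mu ^+ 2 * mom Q 0 x a.
  have i k (c : R) (k3 : (k < 3)%N) := integrableZR c (cellmom_integrable Q x a k3).
  have i2 := cellmom_integrable Q x a (isT : (2 < 3)%N).
  rewrite -(RintegralZl _ measurableT (cellmom_integrable Q x a (isT : (1 < 3)%N))).
  rewrite -(RintegralZl _ measurableT (cellmom_integrable Q x a (isT : (0 < 3)%N))).
  rewrite -(RintegralB measurableT i2 (i 1%N _ isT)).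
  rewrite -(RintegralD measurableT (integrableBR i2 (i 1%N _ isT)) (i 0%N _ isT)).
  by apply: eq_Rintegral => o _; rewrite /cellmom/=; ring.
have E1 : mom Q 1 x a = mu * mom Q 0 x a by rewrite /mu /tmean divfK.
by rewrite /tvar -/mu E1; field.
Qed.

Lemma PsiE : Psi Q = \sum_x tpr (mom Q) x * tq (mom Q) x.
Proof.
rewrite /Psi unlock qmaxE.
have -> : \sum_x tpr (mom Q) x * tq (mom Q) x = 0 + \sum_x \sum_a (tq (mom Q) x * mom Q 0 x a +
   0 * mom Q 1 x a + 0 * mom Q 2 x a).
  rewrite add0r; apply: eq_bigr => x _; rewrite mulrC mulr_sumr.
  by apply: eq_bigr => a _; rewrite !mul0r !addr0.
rewrite -(Rintegral_sum_cellmom Q (fun k x a => if k is 0%N then tq (mom Q) x else 0)).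
rewrite /Rintegral; congr fine; apply: eq_integral => o _; congr (_%:E).
rewrite -(cell_sum (fun x a => tq (mom Q) x)) add0r.
apply: eq_bigr => x _; apply: eq_bigr => a _.
by rewrite /cellmom expr0 mulr1 !mul0r !addr0 mulrC.
Qed.

End in_model.
End moments_of_law.

(** * Estimators as functions of empirical moments *)

Section empirical.
Context {R : realType} {J K : nat}.
Local Notation O := (obs J K R).
Implicit Types (x : 'I_J.+1) (a : 'I_K.+1).

Definition emp (B0 : R) n (s : n.-tuple O) : @moments R J K :=
  fun k x a => n%:R^-1 * \sum_(i < n) cellmom B0 k x a (tnth s i).

Lemma n_stratum_sum (s : seq O) x : n_stratum s x = (\sum_a n_cell s x a)%N.
Proof.
rewrite /n_stratum /n_cell; elim: s => [|o s IH] /=; first by rewrite big1.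
rewrite big_split/= -IH; congr (_ + _)%N.
case: eqP => _ /=; last by rewrite big1.
rewrite (bigD1 (treat o))//= eqxx big1 ?addn0// => a.
by rewrite eq_sym => /negbTE ->.
Qed.

Section identification.
Variables (B0 : R) (n : nat) (s : n.-tuple O).
Hypothesis n0 : (0 < n)%N.
Local Notation emp := (emp B0 s).

Let nR0 : n%:R != 0 :> R. Proof. by rewrite pnatr_eq0 -lt0n. Qed.

Lemma sum_in_cell x a (F : O -> R) :
  \sum_(o <- s | (strat o == x) && (treat o == a)) F o =
  \sum_(i < n) (in_cell x a (tnth s i))%:R * F (tnth s i).
Proof.
rewrite big_mkcond big_tuple; apply: eq_bigr => i _.
by rewrite /in_cell; case: ifP => _; rewrite ?mul1r ?mul0r.
Qed.

Lemma n_cellE x a : (n_cell s x a)%:R = n%:R * emp 0 x a.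
Proof.
rewrite /n_cell -sum1_count natr_sum sum_in_cell /emp mulrA divff// mul1r.
by apply: eq_bigr => i _; rewrite /cellmom expr0.
Qed.

Lemma n_stratumE x : (n_stratum s x)%:R = n%:R * tpr emp x.
Proof.
rewrite /tpr mulr_sumr; under eq_bigr do rewrite -n_cellE.
by rewrite -natr_sum n_stratum_sum.
Qed.

Lemma pr_hatE x : pr_hat s x = tpr emp x.
Proof. by rewrite /pr_hat n_stratumE size_tuple mulrAC divff// mul1r. Qed.

Lemma prop_hatE a x : prop_hat s a x = tprop emp a x.
Proof. by rewrite /prop_hat n_stratumE n_cellE invfM mulrACA divff// mul1r. Qed.

Hypothesis sB : forall i, `|outcome (tnth s i)| <= B0.

Lemma mean_hatE a x : mean_hat s a x = tmean emp a x.
Proof.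
rewrite /mean_hat n_cellE sum_in_cell /tmean.
rewrite (_ : \sum_(i < n) _ = n%:R * emp 1 x a); last first.
  rewrite /emp mulrA divff// mul1r; apply: eq_bigr => i _.
  by rewrite /cellmom clipE.
by rewrite invfM mulrACA divff// mul1r.
Qed.

Lemma var_hatE a x : emp 0 x a != 0 -> var_hat s a x = tvar emp a x.
Proof.
move=> e0; rewrite /var_hat mean_hatE n_cellE sum_in_cell.
set mu := tmean _ a x.
have E1 : emp 1 x a = mu * emp 0 x a by rewrite /mu /tmean divfK.
have S k : n%:R * emp k x a = \sum_(i < n) cellmom B0 k x a (tnth s i).
  by rewrite /emp mulrA divff// mul1r.
rewrite (_ : \sum_(i < n) _ =
   n%:R * (emp 2 x a - 2 * mu * emp 1 x a + mu ^+ 2 * emp 0 x a)); last first.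
  transitivity (\sum_(i < n) (cellmom B0 2 x a (tnth s i) -
      2 * mu * cellmom B0 1 x a (tnth s i) + mu ^+ 2 * cellmom B0 0 x a (tnth s i))).
    by apply: eq_bigr => i _; rewrite /cellmom clipE//; ring.
  by rewrite big_split/= sumrB -!mulr_sumr -!S; ring.
by rewrite /tvar -/mu E1; field; rewrite e0 nR0.
Qed.

End identification.

Section measurability.
Variable n : nat.
Local Notation mf := (measurable_fun [set: n.-tuple O]).

(** Inversion is discontinuous at 0. Writing 1 / f as f times (f^2)^(-1) reduces it to a power
    function on nonnegative reals, and both sides are 0 where f is. *)
Lemma measurable_funVr d (T : measurableType d) (f : T -> R) :
  measurable_fun setT f -> measurable_fun setT (fun t => (f t)^-1).
Proof.
move=> mf; rewrite (_ : (fun t => _) = (fun t => f t * (f t ^+ 2) `^ (-1))).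
  apply: measurable_funM => //.
  by apply: (measurableT_comp (measurable_powR (-1))); exact: measurable_funX.
apply/funext => t; rewrite powR_inv1 ?sqr_ge0//.
have [->|f0] := eqVneq (f t) 0; first by rewrite invr0 mul0r.
by rewrite expr2 invfM mulrA divff// mul1r.
Qed.

Lemma measurable_forall d (T : measurableType d) (I : finType) (b : I -> T -> bool) :
  (forall i, measurable_fun setT (b i)) ->
  measurable_fun setT (fun t => [forall i, b i t]).
Proof.
move=> mb; rewrite (_ : (fun t => _) = (fun t => \big[andb/true]_i b i t)).
  elim: (index_enum I) => [|i r IH].
    by under eq_fun do rewrite big_nil; exact: measurable_cst.
  by under eq_fun do rewrite big_cons /=; exact: measurable_and.
by apply/funext => t; rewrite big_andE; apply: eq_forallb.
Qed.

Lemma measurable_exists d (T : measurableType d) (I : finType) (b : I -> T -> bool) :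
  (forall i, measurable_fun setT (b i)) ->
  measurable_fun setT (fun t => [exists i, b i t]).
Proof.
move=> mb; rewrite (_ : (fun t => _) = (fun t => ~~ [forall i, ~~ b i t])).
  by apply: measurable_neg; apply: measurable_forall => i; exact: measurable_neg.
by apply/funext => t; rewrite negb_forall; apply: eq_existsb => i; rewrite negbK.
Qed.

Lemma measurable_tnth_comp (f : O -> R) i : measurable_fun setT f ->
  mf (fun s => f (tnth s i)).
Proof. by move=> mf0; apply: measurableT_comp => //; exact: measurable_tnth. Qed.

Lemma measurable_in_cell_sum x a (f : n.-tuple O -> O -> R) :
  (forall i, mf (fun s => f s (tnth s i))) ->
  mf (fun s : n.-tuple O => \sum_(o <- s | (strat o == x) && (treat o == a)) f s o).
Proof.
move=> mff; under eq_fun do rewrite sum_in_cell.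
apply: measurable_sum => i; apply: measurable_funM; last exact: mff.
exact: (@measurable_tnth_comp _ i (measurable_in_cell x a)).
Qed.

Lemma measurable_n_cell x a : mf (fun s => (n_cell s x a)%:R : R).
Proof.
rewrite (_ : (fun s => _) = (fun s : n.-tuple O =>
    \sum_(o <- s | (strat o == x) && (treat o == a)) (1 : R))).
  by apply: measurable_in_cell_sum => i; exact: measurable_cst.
by apply/funext => s; rewrite /n_cell -sum1_count natr_sum.
Qed.

Lemma measurable_n_stratum x : mf (fun s => (n_stratum s x)%:R : R).
Proof.
rewrite (_ : (fun s => _) = (fun s : n.-tuple O => \sum_a (n_cell s x a)%:R)).
  by apply: measurable_sum => a; exact: measurable_n_cell.
by apply/funext => s; rewrite -natr_sum n_stratum_sum.
Qed.

Lemma measurable_pr_hat x : mf (fun s => pr_hat s x).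
Proof.
rewrite /pr_hat; under eq_fun do rewrite size_tuple.
by apply: measurable_funM => //; exact: measurable_n_stratum.
Qed.

Lemma measurable_prop_hat a x : mf (fun s => prop_hat s a x).
Proof.
apply: measurable_funM; first exact: measurable_n_cell.
by apply: measurable_funVr; exact: measurable_n_stratum.
Qed.

Lemma measurable_mean_hat a x : mf (fun s => mean_hat s a x).
Proof.
apply: measurable_funM; last by apply: measurable_funVr; exact: measurable_n_cell.
apply: measurable_in_cell_sum => i; exact: (@measurable_tnth_comp _ i measurable_outcome).
Qed.

Lemma measurable_var_hat a x : mf (fun s => var_hat s a x).
Proof.
apply: measurable_funM; last by apply: measurable_funVr; exact: measurable_n_cell.
apply: (@measurable_in_cell_sum x a (fun s o => (outcome o - mean_hat s a x) ^+ 2)) => i.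
apply: measurable_funX; apply: measurable_funB; last exact: measurable_mean_hat.
exact: (@measurable_tnth_comp _ i measurable_outcome).
Qed.

Lemma measurable_sample_mean : mf (fun s => sample_mean s).
Proof.
rewrite /sample_mean; under eq_fun do rewrite size_tuple big_tuple.
apply: measurable_funM => //; apply: measurable_sum => i.
exact: (@measurable_tnth_comp _ i measurable_outcome).
Qed.

Lemma measurable_exceptional : mf (fun s => exceptional s).
Proof.
apply: measurable_exists => x; apply: measurable_exists => a; apply: measurable_or.
  rewrite (_ : (fun s : n.-tuple O => _) =
    (fun s : n.-tuple O => (n_cell s x a)%:R == 0 :> R)).
    by apply: measurable_fun_eqr => //; exact: measurable_n_cell.
  by apply/funext => s; rewrite pnatr_eq0.
by apply: measurable_fun_eqr => //; exact: measurable_var_hat.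
Qed.

(** The supremum is replaced by finitely many comparisons of cell means, a form in which membership
    is visibly measurable. *)
Lemma optimal_hatE (tau : R) (s : seq O) x a : (a \in optimal_hat tau s x) =
  [forall b, mean_hat s b x - mean_hat s a x <= tau].
Proof.
rewrite inE/=; have [[b _ qb] ub] := @maxoverP R _ predT (mean_hat s ^~ x) a isT.
rewrite qb; apply/idP/forallP => [h c|]; last by apply.
by rewrite (le_trans _ h)// lerD2r -qb ub.
Qed.

Lemma measurable_optimal_hat (tau : R) x a : mf (fun s => a \in optimal_hat tau s x).
Proof.
under eq_fun do rewrite optimal_hatE.
apply: measurable_forall => b; apply: measurable_fun_ler => //.
by apply: measurable_funB; exact: measurable_mean_hat.
Qed.

Lemma measurable_w_hat (tau : R) a x : mf (fun s => w_hat tau s a x).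
Proof.
have mq b : mf (fun s => prop_hat s b x / var_hat s b x).
  apply: measurable_funM; first exact: measurable_prop_hat.
  by apply: measurable_funVr; exact: measurable_var_hat.
apply: measurable_funM.
  apply: measurable_funM => //.
  rewrite (_ : (fun s : n.-tuple O => _) =
    (fun s : n.-tuple O => if a \in optimal_hat tau s x then (1 : R) else 0)).
    by apply: measurable_fun_ifT => //; exact: measurable_optimal_hat.
  by apply/funext => s; case: (a \in _).
apply: measurable_funVr; under eq_fun do rewrite big_mkcond.
apply: measurable_sum => b; apply: measurable_fun_ifT => //.
exact: measurable_optimal_hat.
Qed.

Lemma measurable_Psi_eff (tau : nat -> R) : mf (@Psi_eff R J K tau n).
Proof.
apply: measurable_fun_ifT; [exact: measurable_exceptional|exact: measurable_sample_mean|].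
apply: measurable_sum => x; apply: measurable_funM; first exact: measurable_pr_hat.
apply: measurable_sum => a; apply: measurable_funM; first exact: measurable_w_hat.
exact: measurable_mean_hat.
Qed.

Lemma measurable_Psi_rule (d : 'I_J.+1 -> 'I_K.+1) : mf (@Psi_rule R J K d n).
Proof.
apply: measurable_fun_ifT; [exact: measurable_exceptional|exact: measurable_sample_mean|].
apply: measurable_sum => x; apply: measurable_funM; first exact: measurable_pr_hat.
exact: measurable_mean_hat.
Qed.

End measurability.
End empirical.

(** * Remainders in probability *)

Lemma prob_fin_union_le (d : measure_display) (T : measurableType d) (R : realType)
    (P : probability T R) (I : finType) (A : I -> set T) (c : R) :
  (forall i, measurable (A i)) -> (forall i, (P (A i) <= c%:E)%E) ->
  (P [set t | exists i, A i t] <= (#|I|%:R * c)%:E)%E.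
Proof.
move=> mA Ac.
have H (r : seq I) : measurable [set t | exists2 i, i \in r & A i t] /\
    (P [set t | exists2 i, i \in r & A i t] <= ((size r)%:R * c)%:E)%E.
  elim: r => [|i r [IH1 IH2]].
    rewrite (_ : [set t | _] = set0); first by rewrite measure0 mul0r.
    by apply/seteqP; split => t // -[].
  rewrite (_ : [set t | _] = A i `|` [set t | exists2 j, j \in r & A j t]).
    split; first exact: measurableU.
    apply: le_trans (measureU2 P (mA i) IH1) _ => /=.
    by rewrite -natr1 mulrDl mul1r addrC EFinD leeD.
  apply/seteqP; split => t /=.
    move=> [j]; rewrite inE => /orP[/eqP -> ?|jr ?]; first by left.
    by right; exists j.
  move=> [Ai|[j jr Aj]]; first by exists i => //; rewrite mem_head.
  by exists j => //; rewrite inE jr orbT.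
have := (H (enum I)).2; rewrite -cardE.
congr (_ <= _)%E; congr (P _); apply/seteqP; split => t /=; first by case=> i _ ?; exists i.
by case=> i ?; exists i => //; rewrite mem_enum.
Qed.

Section good_samples.
Context {R : realType} {J K : nat}.
Local Notation O := (obs J K R).
Implicit Types (x : 'I_J.+1) (a : 'I_K.+1).
Variables (B0 eps : R) (th : @moments R J K).

(** Samples of all sizes form one type, so that a property of all large good samples becomes
    membership in a single filter. *)
Definition sample : Type := {n : nat & n.-tuple O}.
Definition root_size (z : sample) : R := Num.sqrt (projT1 z)%:R.
Definition semp (z : sample) : @moments R J K := emp B0 (projT2 z).

Definition good (M : R) (z : sample) : Prop :=
  (forall i, `|outcome (tnth (projT2 z) i)| <= B0) /\
  forall k x a, (k < 3)%N -> `|root_size z * (semp z k x a - th k x a)| <= M.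

(* Limits along these filters replace stochastic expansions: see
   [remainder_in_prob]. *)
Definition good_filter (M : R) : set_system sample :=
  [set A | exists N, forall z, (N <= projT1 z)%N -> good M z -> A z].

Global Instance good_filter_filter M : Filter (good_filter M).
Proof.
split.
- by exists 0%N.
- move=> A B [N HA] [N' HB]; exists (maxn N N') => z; rewrite geq_max => /andP[? ?] ?.
  by split; [exact: HA|exact: HB].
- by move=> A B AB [N HA]; exists N => z ? ?; apply: AB; exact: HA.
Qed.

Lemma near_good M : \forall z \near good_filter M, good M z.
Proof. by exists 0%N. Qed.

Lemma near_size M N : \forall z \near good_filter M, (N <= projT1 z)%N.
Proof. by exists N. Qed.

Lemma size_cvg M (f : nat -> R) (A : set_system R) :
  f n @[n --> \oo] --> A -> f (projT1 z) @[z --> good_filter M] --> A.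
Proof.
by move=> fA B /fA [N _ HN]; exists N => z ? ?; exact: HN.
Qed.

Lemma root_size_cvgy M : root_size @ good_filter M --> +oo.
Proof. exact: (@size_cvg M (fun n => Num.sqrt n%:R) _ sqrt_cvgy). Qed.

Lemma semp_bdd M k x a : (k < 3)%N ->
  bdd (good_filter M) (fun z => root_size z * (semp z k x a - th k x a)).
Proof.
by move=> k3; exists M; apply: filterS (near_good M) => z [_]; exact.
Qed.

Variable Q : nat -> probability O R.
Hypothesis QM : \forall n \near \oo, in_model B0 eps (Q n).
Variable B : R.
Hypothesis Qth : \forall n \near \oo, forall k x a, (k < 3)%N ->
  `|Num.sqrt n%:R * (mom B0 (Q n) k x a - th k x a)| <= B.

Let centered n k x a o := cellmom B0 k x a o - mom B0 (Q n) k x a.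

Let bad n (M : R) (i : 'I_3 * 'I_J.+1 * 'I_K.+1) : set (n.-tuple O) :=
  [set s | M - B < `|(Num.sqrt n%:R)^-1 *
    \sum_(j < n) centered n i.1.1 i.1.2 i.2 (tnth s j)|].

Let measurable_centered n k x a : measurable_fun setT (centered n k x a).
Proof. by apply: measurable_funB => //; exact: measurable_cellmom. Qed.

Let measurable_bad n M i : measurable (@bad n M i).
Proof.
apply: measurable_gt_set; apply: measurableT_comp => //.
by apply: measurable_funM => //; exact: measurable_iid_sum.
Qed.

Let unbounded n : set (n.-tuple O) :=
  [set s | exists i, [set o | B0 < `|outcome o|] (tnth s i)].

Let measurable_unb n : measurable (@unbounded n).
Proof.
have -> : @unbounded n = \bigcup_(i in [set: 'I_n])
    ((@tnth _ O)^~ i @^-1` [set o | B0 < `|outcome o|]).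
  by apply/seteqP; split => s /=; [case=> i ?; exists i|case=> i _ ?; exists i].
apply: fin_bigcup_measurable => // i _.
rewrite -[X in measurable X]setTI; apply: measurable_tnth => //.
exact: measurable_unbounded.
Qed.

(** The scaled moment error is the fluctuation around the moments of [Q n] plus the drift of those
    moments away from [th]. The drift is at most B, so exceeding M forces a fluctuation above M -
    B. *)
Let good_or_bad n (s : n.-tuple O) M : (0 < n)%N ->
  (forall k x a, (k < 3)%N ->
    `|Num.sqrt n%:R * (mom B0 (Q n) k x a - th k x a)| <= B) ->
  ~ good M (existT _ n s) -> @unbounded n s \/ exists i, @bad n M i s.
Proof.
move=> n0 QB; have [?|ns] := pselect (@unbounded n s); first by left.
move=> ng; right; apply: contrapT => nb; apply: ng; split.
  by move=> i /=; rewrite leNgt; apply/negP => Bi; apply: ns; exists i.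
move=> k x a k3; have n0R : 0 < n%:R :> R by rewrite ltr0n.
have s0 : 0 < Num.sqrt n%:R :> R by rewrite sqrtr_gt0.
have nsq : n%:R = Num.sqrt n%:R * Num.sqrt n%:R :> R by rewrite -expr2 sqr_sqrtr// ltW.
have h : `|(Num.sqrt n%:R)^-1 * \sum_(j < n) centered n k x a (tnth s j)| <= M - B.
  rewrite leNgt; apply/negP => Hb; apply: nb.
  by exists (Ordinal k3, x, a).
rewrite /root_size /semp /=.
have E : Num.sqrt n%:R * (emp B0 s k x a - th k x a) =
    (Num.sqrt n%:R)^-1 * \sum_(j < n) centered n k x a (tnth s j) +
    Num.sqrt n%:R * (mom B0 (Q n) k x a - th k x a).
  rewrite /centered sumrB sumr_const card_ord -(mulr_natl (mom B0 (Q n) k x a)) /emp.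
  move: nsq s0; set q := Num.sqrt n%:R => -> q0.
  by field; rewrite gt_eqF.
rewrite E (le_trans (ler_normD _ _))//.
have := lerD h (QB k x a k3); rewrite subrK; exact.
Qed.

(** For a tolerance c, a radius M is fixed so that bad samples have probability at most c under
    [Q n]; on large good samples |G| <= e holds surely. M depends on c, hence the convergence is
    assumed along the filter of every M. *)
Lemma remainder_in_prob (G : forall n, n.-tuple O -> R) :
  (forall n, measurable_fun setT (G n)) ->
  (forall M, (fun z : sample => G (projT1 z) (projT2 z)) @ good_filter M --> 0) ->
  forall e : R, 0 < e -> iid_law (Q n) n [set s | e < `|G n s|] @[n --> \oo] --> 0%E.
Proof.
move=> mG G0 e e0.
have mE n : measurable [set s | e < `|G n s|].
  by apply: measurable_gt_set; apply: measurableT_comp => //; exact: mG.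
apply/fine_cvgP; split; first by apply: nearW => n; apply: fin_num_measure; exact: mE.
apply/cvgrPdist_le => c c0; rewrite /=.
pose C : R := mbound B0 + mbound B0.
pose k := #|{: 'I_3 * 'I_J.+1 * 'I_K.+1}|%:R : R.
(* Since L >= 1, L^2 >= L >= k C^2 / c, so Chebyshev at level L, summed over the k cell moments,
   gives at most c. *)
pose L := (k * C ^+ 2) / c + 1.
have L1 : 1 <= L.
  by rewrite lerDr divr_ge0 ?(ltW c0)// mulr_ge0 ?sqr_ge0.
have kL : k * (C ^+ 2 / L ^+ 2) <= c.
  rewrite mulrA ler_pdivrMr ?exprn_gt0 ?(lt_le_trans ltr01)//.
  apply: (@le_trans _ _ (c * L)).
    rewrite (_ : c * L = k * C ^+ 2 + c); first by rewrite lerDl ltW.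
    by rewrite /L; field; rewrite gt_eqF.
  by rewrite ler_wpM2l ?(ltW c0)// expr2 ler_peMl// (le_trans ler01).
pose M := L + B.
have /cvgr0Pnorm_le/(_ e e0) [N HN] := G0 M.
near=> n.
have n0 : (0 < n)%N by near: n; exists 1%N.
have nN : (N <= n)%N by near: n; exists N.
have Qn : in_model B0 eps (Q n) by near: n.
have QB : forall k x a, (k < 3)%N ->
  `|Num.sqrt n%:R * (mom B0 (Q n) k x a - th k x a)| <= B by near: n.
rewrite sub0r normrN ger0_norm ?fine_ge0//.
have fE : iid_law (Q n) n [set s | e < `|G n s|] \is a fin_num by apply: fin_num_measure; exact: mE.
rewrite -lee_fin fineK//.
have mbadU : measurable [set s | exists i, @bad n M i s].
  have -> : [set s | exists i, @bad n M i s] =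
      \bigcup_(i in [set: 'I_3 * 'I_J.+1 * 'I_K.+1]) @bad n M i.
    by apply/seteqP; split => s /=; [case=> i ?; exists i|case=> i _ ?; exists i].
  apply: fin_bigcup_measurable => [|i _]; [exact: finite_finset|exact: measurable_bad].
have sub : [set s | e < `|G n s|] `<=` @unbounded n `|` [set s | exists i, @bad n M i s].
  move=> s /= es; apply: good_or_bad => // gs.
  by have := HN (existT _ n s) nN gs; rewrite leNgt es.
apply: (@le_trans _ _ (iid_law (Q n) n (@unbounded n `|` [set s | exists i, @bad n M i s]))).
  apply: le_measure sub; rewrite inE; [exact: mE|].
  by apply: measurableU; [exact: measurable_unb|exact: mbadU].
apply: le_trans (measureU2 (iid_law (Q n) n) (@measurable_unb n) mbadU) _ => /=.
rewrite /unbounded (iid_null n (measurable_unbounded B0) Qn.1) add0e.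
apply: le_trans (prob_fin_union_le (c := C ^+ 2 / L ^+ 2) (@measurable_bad n M) _) _.
  move=> i; have LE : M - B = L by rewrite /M addrK.
  rewrite /bad LE.
  have cC o : `|centered n i.1.1 i.1.2 i.2 o| <= C.
    rewrite /centered (le_trans (ler_normB _ _))// lerD//; first exact: cellmom_le.
    apply: Rintegral_bounded; first exact: measurable_cellmom.
    by move=> o'; exact: cellmom_le.
  have c0' : \int[Q n]_o centered n i.1.1 i.1.2 i.2 o = 0.
    rewrite /centered (RintegralB measurableT
      (cellmom_integrable B0 (Q n) i.1.2 i.2 (ltn_ord i.1.1)) (integrable_cstR _ _)).
    by rewrite Rintegral_cstT /mom subrr.
  exact: (iid_chebyshev (@measurable_centered n i.1.1 i.1.2 i.2) cC n0
    (lt_le_trans ltr01 L1) c0').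
by rewrite lee_fin.
Unshelve. all: by end_near. Qed.

End good_samples.

(** * Limit laws of the estimators *)

Section influence.
Context {R : realType} {J K : nat}.
Local Notation O := (obs J K R).
Implicit Types (x : 'I_J.+1) (a : 'I_K.+1) (m : @moments R J K).
Variables (B0 eps : R) (P : probability O R).
Hypothesis PM : in_model B0 eps P.
Hypothesis prop_gt0 : forall x a, 0 < prop P a x.
Hypothesis pr_gt0 : forall x, 0 < pr P x.
Local Notation th := (mom B0 P).

Lemma mom0_gt0 x a : 0 < th 0%N x a.
Proof.
have := mulr_gt0 (prop_gt0 x a) (pr_gt0 x).
by rewrite (propE B0) (prE B0) /tprop divfK// gt_eqF// -prE.
Qed.

Variable w : 'I_K.+1 -> 'I_J.+1 -> R.

(** Coefficients of the powers of Y in q + (w / pi)(Y - mu), which is the influence function on a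
    cell up to the constant - Psi. The zero quadratic coefficient matches the shape of
    [Rintegral_sum_cellmom]. *)
Definition coef (k : nat) x a : R :=
  match k with
  | 0 => tq th x - w a x / tprop th a x * tmean th a x
  | 1 => w a x / tprop th a x
  | _ => 0
  end.

Definition infl_lin m : R := \sum_x \sum_a (coef 0 x a * m 0%N x a + coef 1 x a * m 1%N x a
  + coef 2 x a * m 2%N x a).

(* The influence function with weights w, as an affine function of the cell
   moments; [psi_kappa] agrees with it only where |Y| <= B0. *)
Definition infl (o : O) : R := - Psi P + infl_lin (fun k x a => cellmom B0 k x a o).

Lemma infl_integral (Q : probability O R) : \int[Q]_o infl o = - Psi P + infl_lin (mom B0 Q).
Proof. exact: Rintegral_sum_cellmom. Qed.

Lemma infl_linE m : infl_lin m = \sum_x tpr m x * tq th x +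
  \sum_x \sum_a w a x / tprop th a x * (m 1%N x a - tmean th a x * m 0%N x a).
Proof.
rewrite /infl_lin -big_split/=; apply: eq_bigr => x _.
rewrite /tpr mulr_suml -big_split/=; apply: eq_bigr => a _.
by rewrite mul0r addr0; ring.
Qed.

Lemma infl_mean0 : \int[P]_o infl o = 0.
Proof.
rewrite infl_integral infl_linE (PsiE PM) [X in _ + (_ + X)]big1 ?addr0 ?addNr// => x _.
apply: big1 => a _; rewrite /tmean divfK ?subrr ?mulr0// gt_eqF//.
exact: mom0_gt0.
Qed.

Lemma measurable_infl : measurable_fun setT infl.
Proof.
apply: measurable_funD => //; apply: measurable_sum => x; apply: measurable_sum => a.
apply: measurable_funD; first apply: measurable_funD; apply: measurable_funM => //;
  exact: measurable_cellmom.
Qed.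

Definition infl_bound : R := `|Psi P| + \sum_x \sum_a
  (`|coef 0 x a| + `|coef 1 x a| + `|coef 2 x a|) * mbound B0.

Lemma infl_le o : `|infl o| <= infl_bound.
Proof.
rewrite /infl (le_trans (ler_normD _ _))// normrN lerD2l.
rewrite (le_trans (ler_norm_sum _ _ _))//; apply: ler_sum => x _.
rewrite (le_trans (ler_norm_sum _ _ _))//; apply: ler_sum => a _.
move: (coef 0 x a) (coef 1 x a) (coef 2 x a) => c0 c1 c2.
rewrite !mulrDl; apply: le_trans (ler_normD _ _) _; apply: lerD.
  by apply: le_trans (ler_normD _ _) _; apply: lerD;
    rewrite normrM ler_wpM2l// cellmom_le.
by rewrite normrM ler_wpM2l// cellmom_le.
Qed.

Lemma infl_emp n (s : n.-tuple O) : (0 < n)%N ->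
  \sum_(i < n) infl (tnth s i) = n%:R * (- Psi P + infl_lin (emp B0 s)).
Proof.
move=> n0; have nR0 : n%:R != 0 :> R by rewrite pnatr_eq0 -lt0n.
rewrite /infl big_split/= sumr_const card_ord -(mulr_natl (- Psi P)) mulrDr; congr (_ + _).
rewrite /infl_lin exchange_big mulr_sumr; apply: eq_bigr => x _.
rewrite exchange_big mulr_sumr; apply: eq_bigr => a _.
rewrite !big_split/= -!mulr_sumr.
have E k : \sum_(i < n) cellmom B0 k x a (tnth s i) = n%:R * emp B0 s k x a.
  by rewrite /emp mulrA divff// mul1r.
by rewrite !E; ring.
Qed.

Definition infl_var : R := fine 'V_P[fun o => qmax P (strat o)] +
  \sum_x tpr th x * \sum_a w a x ^+ 2 * (tvar th a x / tprop th a x).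

Lemma variance_stratum :
  fine 'V_P[fun o => qmax P (strat o)] = \sum_x tpr th x * (tq th x - Psi P) ^+ 2.
Proof.
have -> : \sum_x tpr th x * (tq th x - Psi P) ^+ 2 =
    0 + \sum_x \sum_a ((tq th x - Psi P) ^+ 2 * mom B0 P 0 x a +
   0 * mom B0 P 1 x a + 0 * mom B0 P 2 x a).
  rewrite add0r; apply: eq_bigr => x _; rewrite mulrC mulr_sumr.
  by apply: eq_bigr => a _; rewrite !mul0r !addr0.
rewrite -(Rintegral_sum_cellmom B0 P
  (fun k x a => if k is 0%N then (tq th x - Psi P) ^+ 2 else 0)).
rewrite /variance unlock -/(Psi P) unlock /Rintegral; congr fine.
apply: eq_integral => o _; congr (_%:E); rewrite add0r.
transitivity (\sum_x \sum_a (in_cell x a o)%:R * (tq th x - Psi P) ^+ 2).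
  rewrite (cell_sum (fun x a => (tq th x - Psi P) ^+ 2)) expr2 -(qmaxE PM).
  by [].
apply: eq_bigr => x _; apply: eq_bigr => a _.
by rewrite /cellmom expr0 mulr1 !mul0r !addr0 mulrC.
Qed.

Lemma inflE o : infl o = tq th (strat o) - Psi P +
  w (treat o) (strat o) / tprop th (treat o) (strat o) *
  (clip B0 (outcome o) - tmean th (treat o) (strat o)).
Proof.
pose f x a := tq th x +
  w a x / tprop th a x * (clip B0 (outcome o) - tmean th a x).
rewrite /infl /infl_lin (_ : \sum_x _ = \sum_x \sum_a (in_cell x a o)%:R * f x a).
  by rewrite (cell_sum f) /f; ring.
apply: eq_bigr => x _; apply: eq_bigr => a _.
by rewrite /cellmom /coef /f; ring.
Qed.

(** On each cell the square is a quadratic polynomial in Y with coefficients c. Its cross term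
    vanishes because Y - mu has mean zero there, which leaves the variance between strata plus the
    variance within cells. *)
Lemma infl_sqr_integral : \int[P]_o (infl o ^+ 2) = infl_var.
Proof.
pose k x a := w a x / tprop th a x.
pose q x := tq th x - Psi P.
pose c (j : nat) x a : R := match j with
  | 0 => (q x - k x a * tmean th a x) ^+ 2
  | 1 => 2 * k x a * (q x - k x a * tmean th a x)
  | _ => k x a ^+ 2
  end.
have -> : \int[P]_o (infl o ^+ 2) = \int[P]_o (0 + \sum_x \sum_a
    (c 0%N x a * cellmom B0 0 x a o + c 1%N x a * cellmom B0 1 x a o +
     c 2%N x a * cellmom B0 2 x a o)).
  apply: eq_Rintegral => o _; rewrite inflE -/(q _) -/(k _ _).
  rewrite -(cell_sum (fun x a => (q x + k x a * (clip B0 (outcome o) - tmean th a x)) ^+ 2)).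
  rewrite add0r; apply: eq_bigr => x _; apply: eq_bigr => a _.
  by rewrite /cellmom /c; ring.
rewrite Rintegral_sum_cellmom add0r /infl_var variance_stratum -big_split/=.
apply: eq_bigr => x _.
rewrite [X in _ = _ * _ + X]mulr_sumr /tpr mulr_suml -big_split/=; apply: eq_bigr => a _.
have m0 : th 0%N x a != 0 by rewrite gt_eqF// mom0_gt0.
have tp : tpr th x != 0 by rewrite -prE gt_eqF.
have E1 : th 1%N x a = tmean th a x * th 0%N x a by rewrite /tmean divfK.
have E2 : th 2%N x a = (tvar th a x + tmean th a x ^+ 2) * th 0%N x a.
  by rewrite /tvar subrK divfK.
rewrite -/(tpr th x) E1 E2 /k /c -/(q x) /tprop; field.
by rewrite m0 tp.
Qed.

End influence.

Section mean_derivative.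
Context {R : realType} {J K : nat}.
Local Notation O := (obs J K R).
Implicit Types (x : 'I_J.+1) (a : 'I_K.+1).
Variables (B0 eps : R) (P : probability O R).
Hypothesis PM : in_model B0 eps P.
Hypothesis prop_gt0 : forall x a, 0 < prop P a x.
Hypothesis pr_gt0 : forall x, 0 < pr P x.
Local Notation th := (mom B0 P).

(** By [local_mean], the derivative of the cell moments along a path with score h. *)
Definition score_mom (h : O -> R) : @moments R J K :=
  fun k x a => \int[P]_o (cellmom B0 k x a o * h o).

(** The right side is the quotient rule for the cell mean, so [mean_dot] is the derivative of the
    cell mean along a path with score h. In the definition the propensity cancels against the
    stratum probability, leaving the cell mass. *)
Lemma mean_dotE h a x : tangent P h ->
  mean_dot P h a x =
  (score_mom h 1%N x a - tmean th a x * score_mom h 0%N x a) / th 0%N x a.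
Proof.
move=> hP; have mh := tangent_measurable hP; have ih := tangent_integrable hP.
have i k (k3 : (k < 3)%N) :
    P.-integrable setT (EFin \o (fun o => cellmom B0 k x a o * h o)).
  apply: (@le_integrableR _ _ _ _ _ (fun o => mbound B0 * h o)).
  - by apply: measurable_funM => //; exact: measurable_cellmom.
  - move=> o; rewrite [leLHS]normrM [leRHS]normrM; apply: ler_wpM2r => //.
    by apply: le_trans (ler_norm _); exact: cellmom_le.
  - exact: integrableZR.
have m0 : th 0%N x a != 0 by rewrite gt_eqF// (mom0_gt0 _ prop_gt0 pr_gt0).
have tp : tpr th x != 0 by rewrite -prE gt_eqF.
have E : \int[P]_(o in stratum x) (resid P a o * h o) =
    (tprop th a x)^-1 * (score_mom h 1%N x a - tmean th a x * score_mom h 0%N x a).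
  rewrite -(RintegralZl _ measurableT (i 0%N isT)).
  rewrite -(RintegralB measurableT (i 1%N isT) (integrableZR _ (i 0%N isT))).
  rewrite -(RintegralZl _ measurableT
    (integrableBR (i 1%N isT) (integrableZR _ (i 0%N isT)))).
  rewrite Rintegral_mkcond.
  have -> : (fun o => resid P a o * h o) \_ (stratum x) = (fun o =>
      (tprop th a x)^-1 * ((in_cell x a o)%:R * outcome o * h o -
         tmean th a x * (in_cell x a o)%:R * h o)).
    apply/funext => o; rewrite patchE; case: ifPn => [|/negP so].
      rewrite inE /stratum/= => so; rewrite /resid /in_cell so eqxx (propE B0) (meanE PM).
      by case: (treat o == a) => /=; ring.
    rewrite /in_cell; case: eqP => [so'|_] /=; last first.
      by rewrite mulr0 !mul0r subrr mulr0.
    by case: so; rewrite inE.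
  apply: (model_Rintegral PM).
  - apply: measurable_funM => //; apply: measurable_funB.
      by apply: measurable_funM => //; apply: measurable_funM;
        [exact: measurable_in_cell|exact: measurable_outcome].
    by apply: measurable_funM => //; apply: measurable_funM => //; exact: measurable_in_cell.
  - apply: measurable_funM => //; apply: measurable_funB.
      by apply: measurable_funM => //; exact: measurable_cellmom.
    by apply: measurable_funM => //; apply: measurable_funM => //; exact: measurable_cellmom.
  - by move=> o oB; rewrite /= /cellmom clipE// expr0 expr1 mulr1 mulrA.
rewrite /mean_dot /cond_mean E -/(pr P x) (prE B0) /tprop.
by field; rewrite m0 tp.
Qed.

End mean_derivative.

(** * Estimators averaging cell means with convergent weights *)

Section linear_estimator.
Context {R : realType} {J K : nat}.
Local Notation O := (obs J K R).
Implicit Types (x : 'I_J.+1) (a : 'I_K.+1).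
Variables (B0 eps : R) (P : probability O R).
Hypothesis PM : in_model B0 eps P.
Hypothesis prop_gt0 : forall x a, 0 < prop P a x.
Hypothesis pr_gt0 : forall x, 0 < pr P x.
Local Notation th := (mom B0 P).
Variables (w : 'I_K.+1 -> 'I_J.+1 -> R) (T : forall n, n.-tuple O -> R).
Variable W : sample (R := R) (J := J) (K := K) -> 'I_K.+1 -> 'I_J.+1 -> R.
Hypothesis mT : forall n, measurable_fun setT (@T n).
Local Notation good_filter := (good_filter B0 th).
Local Notation semp := (semp B0).
Hypothesis TW : forall M, \forall z \near good_filter M,
  T (projT2 z) = \sum_x tpr (semp z) x * \sum_a W z a x * tmean (semp z) a x.
Hypothesis W0 : forall M, \forall z \near good_filter M,
  forall x a, a \notin topt th x -> W z a x = 0.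
Hypothesis W1 : forall M, \forall z \near good_filter M, forall x, \sum_a W z a x = 1.
Hypothesis Wcvg : forall M x a, W z a x @[z --> good_filter M] --> w a x.

Let mom_gt0 := @mom0_gt0 _ _ _ B0 P prop_gt0 pr_gt0.

Definition linear_rem n (s : n.-tuple O) : R :=
  Num.sqrt n%:R * (T s - Psi P) -
  (Num.sqrt n%:R)^-1 * \sum_(i < n) infl B0 P w (tnth s i).

(** The influence function is affine in the cell moments, so its sample average is its value at the
    empirical moments. What remains is exactly the quantity in [weighted_expansion]. *)
Lemma linear_rem_cvg0 M :
  (fun z => linear_rem (projT2 z)) @ good_filter M --> 0.
Proof.
have H := weighted_expansion (FF := good_filter_filter B0 th M) (root_size_cvgy B0 th M)
  (@semp_bdd _ _ _ B0 th M) mom_gt0 (W0 M) (W1 M) (Wcvg M).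
apply: cvg_trans H; apply: near_eq_cvg; near=> z.
have n0 : (0 < projT1 z)%N by near: z; exact: near_size.
have Tz : T (projT2 z) = \sum_x tpr (semp z) x * \sum_a W z a x * tmean (semp z) a x.
  by near: z; exact: TW.
rewrite /linear_rem (infl_emp _ _ _ _ n0) Tz -/(semp z) infl_linE /root_size /dmean.
set A := \sum_x tpr (semp z) x * \sum_a _.
set B := \sum_x tpr (semp z) x * tq th x.
set C := \sum_x \sum_a _.
have s0 : 0 < Num.sqrt (projT1 z)%:R :> R by rewrite sqrtr_gt0 ltr0n.
have sE : (projT1 z)%:R = Num.sqrt (projT1 z)%:R ^+ 2 :> R by rewrite sqr_sqrtr.
move: sE s0; set q := Num.sqrt _ => -> q0.
by field; rewrite gt_eqF.
Unshelve. all: by end_near. Qed.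

Lemma linear_asymptotically_linear (psi : O -> R) : measurable_fun setT psi ->
  (forall o, `|outcome o| <= B0 -> psi o = infl B0 P w o) ->
  asymptotically_linear P T psi.
Proof.
move=> mpsi psiE.
have mG n : measurable_fun setT (fun s : n.-tuple O => Num.sqrt n%:R * (T s - Psi P)
    - (Num.sqrt n%:R)^-1 * \sum_(i < n) psi (tnth s i)).
  apply: measurable_funB; apply: measurable_funM => //; last exact: measurable_iid_sum.
  by apply: measurable_funB => //; exact: mT.
split=> // e e0.
apply: (@remainder_in_prob _ _ _ B0 eps th (fun=> P) _ 0 _ _ mG) => //.
- by apply: nearW.
- by apply: nearW => n k x a _; rewrite subrr mulr0 normr0.
move=> M; apply: cvg_trans (linear_rem_cvg0 M); apply: near_eq_cvg; near=> z.
have zB : good B0 th M z by near: z; exact: near_good.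
rewrite /linear_rem; congr (_ - _ * _); apply: eq_bigr => i _.
by rewrite psiE//; exact: zB.1.
Unshelve. all: by end_near. Qed.

Section local_limit.
Variables (h : O -> R) (path : R -> probability O R).
Hypotheses (hP : tangent P h) (hpath : dqm_path B0 eps P h path).
Local Notation Q := (local_law path).
Local Notation eta := (score_mom B0 P h).
Local Notation imean n := (\int[Q n]_o infl B0 P w o).

Definition local_shift : R :=
  \sum_x pr P x * (\sum_a w a x * mean_dot P h a x
    - maxover (optimal P x) (mean_dot P h ^~ x)).

Let sqrty : (Num.sqrt n%:R : R) @[n --> \oo] --> +oo := sqrt_cvgy.

Lemma local_in_model : \forall n \near \oo, in_model B0 eps (Q n).
Proof.
have [e e0 [Hm _ _]] := hpath; near=> n; apply: Hm.
rewrite invr_ge0 sqrtr_ge0/=; near: n.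
exact: (cvgr_lt _ (@sqrt_inv_cvg0 R) _ e0).
Unshelve. all: by end_near. Qed.

Lemma local_mom k x a : (k < 3)%N ->
  Num.sqrt n%:R * (mom B0 (Q n) k x a - th k x a) @[n --> \oo] --> eta k x a.
Proof.
move=> k3; apply: (local_mean hP hpath (measurable_cellmom B0 k x a)) => o.
exact: (cellmom_le _ _ _ _ k3).
Qed.

Lemma local_mom_bdd k x a : (k < 3)%N ->
  bdd \oo (fun n => Num.sqrt n%:R * (mom B0 (Q n) k x a - th k x a)).
Proof. by move=> k3; exact: (cvg_bdd (@local_mom k x a k3)). Qed.

Lemma local_Rintegral (u : O -> R) (M : R) : measurable_fun setT u ->
  (forall o, `|u o| <= M) -> \int[Q n]_o u o @[n --> \oo] --> \int[P]_o u o.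
Proof.
move=> mu uM; have /cvg_bdd H := local_mean hP hpath mu uM.
have H0 := bdd_scaled_cvg0 sqrty H.
rewrite -[X in _ --> X]add0r.
rewrite -[X in X @ _](funext (fun n => subrK (\int[P]_o u o) (\int[Q n]_o u o))).
by apply: cvgD; [exact: H0|exact: cvg_cst].
Qed.

(** The linearization and Psi both move by q(x) times the change of the stratum mass; these terms
    cancel, and only weighted mean minus maximum survives. *)
Lemma local_shiftE : local_shift = infl_lin B0 P w eta -
  \sum_x (tq th x * \sum_a eta 0%N x a + tpr th x * maxover (topt th x)
    (fun a => (eta 1%N x a - tmean th a x * eta 0%N x a) / th 0%N x a)).
Proof.
rewrite infl_linE -big_split/= -sumrB; apply: eq_bigr => x _.
have -> : mean_dot P h ^~ x =
    fun a => (eta 1%N x a - tmean th a x * eta 0%N x a) / th 0%N x a.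
  by apply/funext => a; rewrite (mean_dotE PM prop_gt0 pr_gt0).
rewrite (optimalE PM) (prE B0); set m := maxover _ _.
have -> : \sum_a w a x * mean_dot P h a x = (tpr th x)^-1 *
    \sum_a w a x / tprop th a x * (eta 1%N x a - tmean th a x * eta 0%N x a).
  rewrite mulr_sumr; apply: eq_bigr => a _; rewrite (mean_dotE PM prop_gt0 pr_gt0)//.
  have := mom_gt0 x a; have : tpr th x != 0 by rewrite -prE gt_eqF.
  by rewrite /tprop => t0 m0; field; rewrite t0 gt_eqF.
have t0 : tpr th x != 0 by rewrite -prE gt_eqF.
set S := \sum_a _ / _ * _; rewrite -/(tpr eta x).
by field.
Qed.

(** The influence function has mean zero under P and is affine in the moments, so sqrt n times its
    mean under [Q n] tends to its linear part at the derivatives of the moments. Psi moves by its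
    directional derivative, and the difference is [local_shift]. *)
Lemma local_bias_cvg0 :
  Num.sqrt n%:R * imean n - Num.sqrt n%:R * (Psi (Q n) - Psi P) - local_shift
  @[n --> \oo] --> 0.
Proof.
rewrite -(subrr local_shift); apply: cvgB; last exact: cvg_cst.
rewrite local_shiftE; apply: cvgB.
  have H : \sum_x \sum_a (coef B0 P w 0 x a *
        (Num.sqrt n%:R * (mom B0 (Q n) 0%N x a - th 0%N x a)) +
      coef B0 P w 1 x a * (Num.sqrt n%:R * (mom B0 (Q n) 1%N x a - th 1%N x a)) +
      coef B0 P w 2 x a * (Num.sqrt n%:R * (mom B0 (Q n) 2%N x a - th 2%N x a)))
      @[n --> \oo] --> infl_lin B0 P w eta.
    apply: cvg_fin_sum => x _; apply: cvg_fin_sum => a _.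
    apply: cvgD; first apply: cvgD;
      (apply: cvgM; [exact: cvg_cst|exact: local_mom]).
  apply: cvg_trans H; apply: near_eq_cvg; apply: nearW => n.
  have -> : imean n = infl_lin B0 P w (mom B0 (Q n)) - infl_lin B0 P w th.
    by have := infl_mean0 PM prop_gt0 pr_gt0 w; rewrite !infl_integral; lra.
  rewrite /infl_lin -sumrB mulr_sumr; apply: eq_bigr => x _.
  rewrite -sumrB mulr_sumr; apply: eq_bigr => a _.
  by generalize (coef B0 P w 0 x a) (coef B0 P w 1 x a) (coef B0 P w 2 x a) => *; ring.
have H := Psi_deriv (FF := eventually_filter) sqrty local_mom_bdd mom_gt0 local_mom.
apply: cvg_trans H; apply: near_eq_cvg; near=> n.
have Qn : in_model B0 eps (Q n) by near: n; exact: local_in_model.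
by rewrite (PsiE PM) (PsiE Qn).
Unshelve. all: by end_near. Qed.

Lemma linear_local_cvg : 0 < infl_var B0 P w ->
  local_cvg path T (normal_law local_shift (infl_var B0 P w)).
Proof.
(* Centering at the mean under [Q n] rather than P gives the triangular array exact mean zero; the
   mean removed here is accounted for by [local_bias_cvg0]. *)
move=> V0; pose psi n o := infl B0 P w o - imean n.
have mi := measurable_infl B0 P w.
have ib := infl_le B0 P w.
have iQ n : (Q n).-integrable setT (EFin \o infl B0 P w).
  exact: (@bounded_integrable _ _ _ _ _ _ mi ib).
have iQ2 n : (Q n).-integrable setT (EFin \o (fun o => infl B0 P w o ^+ 2)).
  apply: (@bounded_integrable _ _ _ _ _ (infl_bound B0 P w ^+ 2)).
    exact: measurable_funX.
  by move=> o; rewrite normrX lerXn2r ?nnegrE// (le_trans _ (ib o)).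
have mu0 : imean n @[n --> \oo] --> 0.
  by rewrite -(infl_mean0 PM prop_gt0 pr_gt0 w); exact: (local_Rintegral mi ib).
have mpsi n : measurable_fun setT (psi n) by apply: measurable_funB.
apply: (@clt_slutsky _ _ _ Q psi (infl_bound B0 P w + infl_bound B0 P w)) => //.
- move=> n o; rewrite /psi (le_trans (ler_normB _ _))// lerD//.
  exact: Rintegral_bounded.
- move=> n; rewrite /psi (RintegralB measurableT (iQ n) (integrable_cstR _ _)).
  by rewrite Rintegral_cstT subrr.
- have H : \int[Q n]_o (infl B0 P w o ^+ 2) - imean n ^+ 2 @[n --> \oo] -->
      infl_var B0 P w - 0 ^+ 2.
    apply: cvgB; last by under eq_fun do rewrite expr2; rewrite expr2; exact: cvgM.
    rewrite -(infl_sqr_integral PM prop_gt0 pr_gt0 w).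
    apply: (@local_Rintegral _ (infl_bound B0 P w ^+ 2)); first exact: measurable_funX.
    by move=> o; rewrite normrX lerXn2r ?nnegrE// (le_trans _ (ib o)).
  rewrite expr0n subr0 in H; apply: cvg_trans H; apply: near_eq_cvg.
  apply: nearW => n; rewrite /psi.
  transitivity (\int[Q n]_o (infl B0 P w o ^+ 2 + (- (2 * imean n) * infl B0 P w o +
      imean n ^+ 2))); last by apply: eq_Rintegral => o _; ring.
  rewrite (RintegralD measurableT (iQ2 n)
    (integrableDR (integrableZR _ (iQ n)) (integrable_cstR _ _))).
  rewrite (RintegralD measurableT (integrableZR _ (iQ n)) (integrable_cstR _ _)).
  by rewrite (RintegralZl _ measurableT (iQ n)) Rintegral_cstT; ring.
- by move=> n; apply: measurable_funM => //; apply: measurable_funB => //; exact: mT.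
have momB : exists B, \forall n \near \oo, forall k x a, (k < 3)%N ->
    `|Num.sqrt n%:R * (mom B0 (Q n) k x a - th k x a)| <= B.
  (* Each scaled moment drift is eventually below the size of its limit plus 1; summing over all
     indices gives one bound for all of them. *)
  exists (\sum_(k < 3) \sum_x \sum_a (`|eta k x a| + 1)).
  have H : \forall n \near \oo, forall (k : 'I_3) x a,
      `|Num.sqrt n%:R * (mom B0 (Q n) k x a - th k x a)| <= `|eta k x a| + 1.
    apply: filter_forall => k; apply: filter_forall => x; apply: filter_forall => a.
    have /cvgrPdist_le/(_ 1 ltr01) H := @local_mom k x a (ltn_ord k).
    apply: filterS H => n H.
    rewrite -lerBlDl; apply: le_trans H; rewrite distrC.
    exact: le_trans (ler_norm _) (ler_dist_dist _ _).
  apply: filterS H => n H k x a k3.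
  apply: le_trans (H (Ordinal k3) x a) _.
  have term (I : finType) (f : I -> R) i : (forall j, 0 <= f j) -> f i <= \sum_j f j.
    by move=> f0; rewrite (bigD1 i)//= lerDl sumr_ge0.
  apply: le_trans (term _ _ (Ordinal k3) _); last first.
    by move=> k'; do 2![apply: sumr_ge0 => ? _]; rewrite addr_ge0.
  apply: le_trans (term _ _ x _); last by move=> x'; apply: sumr_ge0 => ? _; rewrite addr_ge0.
  by apply: (term _ (fun a => `|eta k x a| + 1)) => a'; rewrite addr_ge0.
have [B HB] := momB.
move=> e e0; apply: (@remainder_in_prob _ _ _ B0 eps th Q local_in_model B HB _ _ _ e e0).
  move=> n; apply: measurable_funB.
    by apply: measurable_funM => //; apply: measurable_funB => //; exact: mT.
  apply: measurable_funD => //; apply: measurable_funM => //.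
  by apply: measurable_iid_sum.
move=> M.
(* The total error splits into the linearization remainder, which vanishes on good samples, and a
   deterministic centering error that depends on the sample size only. *)
have H : linear_rem (projT2 z) + (Num.sqrt (projT1 z)%:R * imean (projT1 z) -
    Num.sqrt (projT1 z)%:R * (Psi (Q (projT1 z)) - Psi P) - local_shift)
    @[z --> good_filter M] --> 0 + 0.
  apply: cvgD; first exact: linear_rem_cvg0.
  exact: (@size_cvg _ _ _ B0 th M _ _ local_bias_cvg0).
rewrite addr0 in H; apply: cvg_trans H; apply: near_eq_cvg; near=> z.
have n0 : (0 < projT1 z)%N by near: z; exact: near_size.
rewrite /linear_rem /psi sumrB sumr_const card_ord -(mulr_natl (imean _)).
have s0 : 0 < Num.sqrt (projT1 z)%:R :> R by rewrite sqrtr_gt0 ltr0n.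
have sE : (projT1 z)%:R = Num.sqrt (projT1 z)%:R ^+ 2 :> R by rewrite sqr_sqrtr.
set S := \sum_(i < _) _; set q := Num.sqrt _; set m := imean _.
move: sE s0; rewrite -/q => -> q0.
by field; rewrite gt_eqF.
Unshelve. all: by end_near. Qed.

End local_limit.

End linear_estimator.

(** * Fixed rules, the efficient estimator and the sign of the shift *)

Section instances.
Context {R : realType} {J K : nat}.
Local Notation O := (obs J K R).
Implicit Types (x : 'I_J.+1) (a : 'I_K.+1).
Variables (B0 eps : R) (P : probability O R).
Hypothesis PM : in_model B0 eps P.
Hypothesis prop_gt0 : forall x a, 0 < prop P a x.
Hypothesis pr_gt0 : forall x, 0 < pr P x.
Hypothesis var_gt0 : forall x a, 0 < var P a x.
Local Notation th := (mom B0 P).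
Local Notation good_filter := (good_filter B0 th).
Local Notation semp := (semp B0).

Let mom_gt0 := @mom0_gt0 _ _ _ B0 P prop_gt0 pr_gt0.

Let varE' a x : var P a x = tvar th a x.
Proof. by rewrite (varE PM)// gt_eqF. Qed.

Let tvar_gt0 a x : 0 < tvar th a x. Proof. by rewrite -varE'. Qed.

Let th0_semp M := th0_near (FF := good_filter_filter B0 th M) (root_size_cvgy B0 th M)
  (@semp_bdd _ _ _ B0 th M) mom_gt0.

Let tprop_semp M := tprop_cvg (FF := good_filter_filter B0 th M) (root_size_cvgy B0 th M)
  (@semp_bdd _ _ _ B0 th M) mom_gt0.

Let tvar_semp M := tvar_cvg (FF := good_filter_filter B0 th M) (root_size_cvgy B0 th M)
  (@semp_bdd _ _ _ B0 th M) mom_gt0.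

Let tvar_near M : \forall z \near good_filter M, forall x a, 0 < tvar (semp z) a x.
Proof.
apply: filter_forall => x; apply: filter_forall => a.
exact: (cvgr_gt _ (@tvar_semp M a x) _ (tvar_gt0 a x)).
Qed.

(** Cell masses and cell variances have positive limits, so a large good sample is never exceptional
    and the fallback value does not occur. Its outcomes also lie within B0, where clipping changes
    nothing. *)
Lemma near_hat M : \forall z \near good_filter M,
  [/\ tpr (semp z) = pr_hat (projT2 z), tprop (semp z) = prop_hat (projT2 z),
      tmean (semp z) = mean_hat (projT2 z), tvar (semp z) = var_hat (projT2 z) &
      ~~ exceptional (projT2 z)].
Proof.
near=> z.
have n0 : (0 < projT1 z)%N by near: z; exact: near_size.
have gz : good B0 th M z by near: z; exact: near_good.
have e0 : forall x a, 0 < semp z 0%N x a by near: z; exact: th0_semp.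
have v0 : forall x a, 0 < tvar (semp z) a x by near: z; exact: tvar_near.
have vE a x : var_hat (projT2 z) a x = tvar (semp z) a x.
  by apply: (var_hatE n0 gz.1); rewrite gt_eqF// e0.
split; last 1 first.
- rewrite negb_exists; apply/forallP => x.
  rewrite negb_exists; apply/forallP => a; rewrite negb_or vE (gt_eqF (v0 x a)) andbT.
  by rewrite -(pnatr_eq0 R) (n_cellE B0 _ n0) mulf_neq0 ?pnatr_eq0 -?lt0n// gt_eqF// e0.
- by apply/funext => x; rewrite (pr_hatE B0 _ n0).
- by apply/funext => a; apply/funext => x; rewrite (prop_hatE B0 _ n0).
- by apply/funext => a; apply/funext => x; rewrite (mean_hatE n0 gz.1).
- by apply/funext => a; apply/funext => x; rewrite vE.
Unshelve. all: by end_near. Qed.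

Section rule.
Variable d : 'I_J.+1 -> 'I_K.+1.
Hypothesis dP : optimal_rule P d.
(** A fixed rule is the case of weights that do not depend on the sample. *)
Let w a x : R := (a == d x)%:R.

Lemma sum_rule (f : 'I_K.+1 -> R) x : \sum_a w a x * f a = f (d x).
Proof.
rewrite (bigD1 (d x))//= /w eqxx mul1r big1 ?addr0// => a /negbTE ->.
by rewrite mul0r.
Qed.

Lemma infl_var_rule : infl_var B0 P w = V_rule P d.
Proof.
rewrite /infl_var /V_rule (prE B0); congr (_ + _); apply: eq_bigr => x _; congr (_ * _).
rewrite /cvar varE' (propE B0) -(sum_rule (fun a => tvar th a x / tprop th a x)).
by apply: eq_bigr => a _; rewrite expr2 -mulrA /w; case: eqP => _; rewrite ?mul1r ?mul0r.
Qed.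

Lemma V_rule_gt0 : 0 < V_rule P d.
Proof.
rewrite ltr_wpDl//; first by rewrite fine_ge0// variance_ge0.
rewrite (bigD1 ord0)//= ltr_wpDr//.
  by apply: sumr_ge0 => x _; rewrite ltW// mulr_gt0// divr_gt0.
by rewrite mulr_gt0// divr_gt0.
Qed.

(** For a score in the cone, the treatment chosen by d attains the maximum in [local_shift]. *)
Lemma rule_shift h : C_rule P d h -> local_shift P w h = 0.
Proof.
move=> [_ hd]; apply: big1 => x _; rewrite (sum_rule (mean_dot P h ^~ x)).
have [a aO E] := maxover_ex (mean_dot P h ^~ x) (dP x).
have := maxover_ge (mean_dot P h ^~ x) (dP x); have := hd x a aO.
rewrite E => h1 h2; suff -> : mean_dot P h (d x) x = mean_dot P h a x.
  by rewrite subrr mulr0.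
by apply/eqP; rewrite eq_le h2.
Qed.

Lemma Psi_rule_regular :
  regular_along B0 eps P (Psi_rule d) (C_rule P d) (normal_law 0 (V_rule P d)).
Proof.
move=> h hd path hpath; rewrite -(rule_shift hd) -infl_var_rule.
apply: (@linear_local_cvg _ _ _ _ _ _ PM prop_gt0 pr_gt0 w _ (fun=> w) _ _ _ _ _ _ _ hd.1 hpath).
- by move=> n; exact: measurable_Psi_rule.
- move=> M; apply: filterS (near_hat M) => z [trE _ tmE _ /negbTE ez].
  rewrite /Psi_rule ez trE tmE; apply: eq_bigr => x _.
  by rewrite (sum_rule (mean_hat (projT2 z) ^~ x)).
- move=> M; apply: nearW => z x a aN; rewrite /w; case: eqP => // ad.
  by move: aN; rewrite ad -(optimalE PM) dP.
- move=> M; apply: nearW => z x.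
  by have := sum_rule (fun=> 1) x; under eq_bigr do rewrite mulr1.
- by move=> M x a; exact: cvg_cst.
- by rewrite infl_var_rule V_rule_gt0.
Qed.

End rule.

(** The inverse of c_a(x); [wstar] is thus precision weighting over the optimal treatments. *)
Let prec a x : R := tprop th a x / tvar th a x.

Let prec_gt0 a x : 0 < prec a x.
Proof. by rewrite divr_gt0// -(propE B0). Qed.

Let sprec x : R := \sum_(b in topt th x) prec b x.

Let sprec_gt0 x : 0 < sprec x.
Proof.
have [a aO] := topt_nonempty th x; rewrite /sprec (bigD1 a)//= ltr_wpDr//.
by apply: sumr_ge0 => b _; exact: ltW.
Qed.

Let wstarE a x : wstar P a x = (a \in topt th x)%:R * prec a x / sprec x.
Proof.
have cE b : (cvar P b x)^-1 = prec b x by rewrite /cvar varE' (propE B0) invf_div.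
rewrite /wstar (optimalE PM); case: ifP => _; last by rewrite !mul0r.
by rewrite mul1r cE /sprec; congr (_ / _); apply: eq_bigr => b _; exact: cE.
Qed.

Lemma wstar_ge0 a x : 0 <= wstar P a x.
Proof. by rewrite wstarE -mulrA mulr_ge0// divr_ge0// ltW. Qed.

Lemma wstar_gt0 a x : a \in optimal P x -> 0 < wstar P a x.
Proof. by rewrite (optimalE PM) wstarE => ->; rewrite mul1r; exact: divr_gt0. Qed.

Lemma sum_wstar_mul (f : 'I_K.+1 -> R) x :
  \sum_a wstar P a x * f a = \sum_(a in optimal P x) wstar P a x * f a.
Proof.
rewrite [RHS]big_mkcond; apply: eq_bigr => a _.
by rewrite /wstar; case: ifP => // _; rewrite mul0r.
Qed.

Lemma sum_wstar x : \sum_(a in optimal P x) wstar P a x = 1.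
Proof.
rewrite -[RHS](divff (lt0r_neq0 (sprec_gt0 x))) /sprec mulr_suml (optimalE PM).
by apply: eq_bigr => a aO; rewrite wstarE aO mul1r.
Qed.

(** The usual computation for inverse-variance weights: w^2 c = w / sprec for every optimal
    treatment, and the weights sum to 1, leaving 1 / sprec. *)
Lemma infl_var_wstar : infl_var B0 P (wstar P) = V_kappa P.
Proof.
rewrite /infl_var /V_kappa (prE B0); congr (_ + _); apply: eq_bigr => x _; congr (_ * _).
have -> : \sum_(a in optimal P x) prop P a x / var P a x = sprec x.
  by rewrite (optimalE PM); apply: eq_bigr => a _; rewrite varE' (propE B0).
transitivity (\sum_(a in optimal P x) wstar P a x / sprec x).
  rewrite [RHS]big_mkcond; apply: eq_bigr => a _; rewrite (optimalE PM) wstarE.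
  have [_|_] := boolP (a \in topt th x); last by rewrite !mul0r expr0n mul0r.
  have v0 := lt0r_neq0 (tvar_gt0 a x); have s0 := lt0r_neq0 (sprec_gt0 x).
  have p0 : tprop th a x != 0 by rewrite -(propE B0) gt_eqF.
  by rewrite !mul1r /prec; field; rewrite p0 v0 s0.
by rewrite -mulr_suml sum_wstar mul1r.
Qed.

Lemma V_kappa_gt0 : 0 < V_kappa P.
Proof.
have tg : 0 < \sum_x pr P x * (\sum_(a in optimal P x) prop P a x / var P a x)^-1.
  have E x : \sum_(a in optimal P x) prop P a x / var P a x = sprec x.
    by rewrite (optimalE PM); apply: eq_bigr => a _; rewrite varE' (propE B0).
  rewrite (bigD1 ord0)//= ltr_wpDr//; last by rewrite E divr_gt0.
  by apply: sumr_ge0 => x _; rewrite E ltW// divr_gt0.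
by rewrite ltr_wpDl// fine_ge0// variance_ge0.
Qed.

Lemma wstar_shift h : local_shift P (wstar P) h = delta P h.
Proof.
by apply: eq_bigr => x _; rewrite (sum_wstar_mul (mean_dot P h ^~ x)).
Qed.

Lemma psi_kappaE o : `|outcome o| <= B0 -> psi_kappa P o = infl B0 P (wstar P) o.
Proof.
move=> oB; rewrite inflE (clipE oB) /psi_kappa (qmaxE PM) (bigD1 (treat o))//=.
rewrite big1 => [|a ane]; last by rewrite /resid eq_sym (negbTE ane) !mul0r mulr0.
by rewrite /resid eqxx (propE B0) (meanE PM) addr0 div1r mulrA.
Qed.

Lemma measurable_psi_kappa : measurable_fun setT (psi_kappa P).
Proof.
have ms (f : 'I_J.+1 -> R) : measurable_fun setT (fun o : O => f (strat o)).
  apply: (@measurableT_comp _ _ _ _ _ _ f); last exact: measurable_strat.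
  by move=> _ Y _; exact: I.
have mt (f : 'I_K.+1 -> R) : measurable_fun setT (fun o : O => f (treat o)).
  apply: (@measurableT_comp _ _ _ _ _ _ f); last exact: measurable_treat.
  by move=> _ Y _; exact: I.
apply: measurable_funD; first exact: (ms (fun x => qmax P x - Psi P)).
apply: measurable_sum => a; apply: measurable_funM; first exact: (ms (wstar P a)).
apply: measurable_funM; last first.
  by apply: measurable_funB; [exact: measurable_outcome|exact: (ms (mean P a))].
apply: measurable_funM; first exact: (mt (fun b => (b == a)%:R)).
exact: (ms (fun x => (prop P a x)^-1)).
Qed.

Section efficient.
Variable tau : nat -> R.
Hypothesis tau_cvg0 : tau n @[n --> \oo] --> 0.
Hypothesis sqrt_tau_cvgy : Num.sqrt n%:R * tau n @[n --> \oo] --> +oo.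

Let W (z : sample (R := R) (J := J) (K := K)) a x : R :=
  w_hat (tau (projT1 z)) (projT2 z) a x.

Lemma near_w_hat M : \forall z \near good_filter M, forall a x,
  W z a x = (a \in topt th x)%:R * (tprop (semp z) a x / tvar (semp z) a x) /
    \sum_(b in topt th x) tprop (semp z) b x / tvar (semp z) b x.
Proof.
have H := topt_hat_near (FF := good_filter_filter B0 th M) (root_size_cvgy B0 th M)
  (@semp_bdd _ _ _ B0 th M) mom_gt0 (@size_cvg _ _ _ B0 th M _ _ tau_cvg0)
  (@size_cvg _ _ _ B0 th M _ _ sqrt_tau_cvgy).
near=> z => a x.
have [_ prE' mE' vE' _] : [/\ tpr (semp z) = pr_hat (projT2 z),
      tprop (semp z) = prop_hat (projT2 z),
      tmean (semp z) = mean_hat (projT2 z), tvar (semp z) = var_hat (projT2 z) &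
      ~~ exceptional (projT2 z)] by near: z; exact: near_hat.
have Hz : forall x a, (tq (semp z) x - tmean (semp z) a x <= tau (projT1 z)) =
    (a \in topt th x) by near: z.
have O b : (b \in optimal_hat (tau (projT1 z)) (projT2 z) x) = (b \in topt th x).
  by rewrite -Hz inE /tq mE'.
rewrite /W /w_hat O prE' vE'; congr (_ / _).
exact: eq_bigl.
Unshelve. all: by end_near. Qed.

Lemma near_sum_w_hat M : \forall z \near good_filter M, forall x, \sum_a W z a x = 1.
Proof.
near=> z => x.
have Wz : forall a x, W z a x = (a \in topt th x)%:R *
    (tprop (semp z) a x / tvar (semp z) a x) /
    \sum_(b in topt th x) tprop (semp z) b x / tvar (semp z) b x.
  by near: z; exact: near_w_hat.
have e0 : forall x a, 0 < semp z 0%N x a by near: z; exact: th0_semp.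
have v0 : forall x a, 0 < tvar (semp z) a x by near: z; exact: tvar_near.
have q0 a : 0 < tprop (semp z) a x / tvar (semp z) a x.
  rewrite divr_gt0// divr_gt0// /tpr (bigD1 a)//= ltr_wpDr// sumr_ge0// => b _.
  exact: ltW.
set S := \sum_(b in topt th x) tprop (semp z) b x / tvar (semp z) b x.
have S0 : 0 < S.
  have [a aO] := topt_nonempty th x; rewrite /S (bigD1 a)//= ltr_wpDr//.
  by apply: sumr_ge0 => b _; exact: ltW.
transitivity (S / S); last by rewrite divff// gt_eqF.
rewrite {1}/S mulr_suml [RHS]big_mkcond; apply: eq_bigr => a _.
by rewrite Wz -/S; case: ifP => _; rewrite ?mul1r ?mul0r.
Unshelve. all: by end_near. Qed.

(** Once the estimated optimal set coincides with the true one, the weights are continuous functions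
    of cell moments; before that they may jump. *)
Lemma w_hat_cvg M x a : W z a x @[z --> good_filter M] --> wstar P a x.
Proof.
have q b : tprop (semp z) b x / tvar (semp z) b x @[z --> good_filter M] --> prec b x.
  apply: cvgM; first exact: tprop_semp.
  by apply: cvgV; [exact: lt0r_neq0|exact: tvar_semp].
have H : (a \in topt th x)%:R * (tprop (semp z) a x / tvar (semp z) a x) /
    \sum_(b in topt th x) tprop (semp z) b x / tvar (semp z) b x
    @[z --> good_filter M] --> wstar P a x.
  rewrite wstarE; apply: cvgM; first by apply: cvgM; [exact: cvg_cst|exact: q].
  apply: cvgV; first exact: lt0r_neq0.
  by apply: cvg_fin_sum => b _; exact: q.
apply: cvg_trans H; apply: near_eq_cvg.
by apply: filterS (near_w_hat M) => z Wz; rewrite Wz.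
Qed.

Let T_W M : \forall z \near good_filter M, Psi_eff tau (projT2 z) =
  \sum_x tpr (semp z) x * \sum_a W z a x * tmean (semp z) a x.
Proof.
apply: filterS (near_hat M) => z [trE _ tmE _ /negbTE ez].
by rewrite /Psi_eff ez trE tmE.
Qed.

Let W_opt M : \forall z \near good_filter M, forall x a, a \notin topt th x -> W z a x = 0.
Proof.
by apply: filterS (near_w_hat M) => z Wz x a /negbTE aN; rewrite Wz aN !mul0r.
Qed.

Lemma Psi_eff_asymptotically_linear :
  asymptotically_linear P (Psi_eff tau) (psi_kappa P).
Proof.
apply: (linear_asymptotically_linear PM prop_gt0 pr_gt0 _ T_W W_opt near_sum_w_hat
  w_hat_cvg measurable_psi_kappa psi_kappaE) => n.
exact: measurable_Psi_eff.
Qed.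

Lemma Psi_eff_local_cvg h path : tangent P h -> dqm_path B0 eps P h path ->
  local_cvg path (Psi_eff tau) (normal_law (delta P h) (V_kappa P)).
Proof.
move=> hP hpath; rewrite -wstar_shift -infl_var_wstar.
apply: (linear_local_cvg PM prop_gt0 pr_gt0 _ T_W W_opt near_sum_w_hat w_hat_cvg hP hpath).
- by move=> n; exact: measurable_Psi_eff.
- by rewrite infl_var_wstar V_kappa_gt0.
Qed.

End efficient.

Section shift_sign.
Variable h : O -> R.
Local Notation g x := (mean_dot P h ^~ x).
Local Notation m x := (maxover (optimal P x) (g x)).

(** The weighted mean of how far each optimal treatment falls short of the largest derivative. The
    weights sum to 1, so [delta] is minus the average of the gaps over strata. *)
Let gap x : R := \sum_(a in optimal P x) wstar P a x * (m x - mean_dot P h a x).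

Let term_ge0 x a : a \in optimal P x -> 0 <= wstar P a x * (m x - mean_dot P h a x).
Proof. by move=> aO; rewrite mulr_ge0 ?wstar_ge0// subr_ge0 (maxover_ge (g x)). Qed.

Let gap_ge0 x : 0 <= gap x.
Proof. by apply: sumr_ge0 => a; exact: term_ge0. Qed.

Lemma deltaE : delta P h = - \sum_x pr P x * gap x.
Proof.
rewrite -sumrN; apply: eq_bigr => x _; rewrite -mulrN /gap; congr (_ * _).
under [X in _ = - X]eq_bigr do rewrite mulrBr.
by rewrite sumrB -mulr_suml sum_wstar mul1r opprB.
Qed.

Lemma delta_le0 : delta P h <= 0.
Proof. by rewrite deltaE oppr_le0 sumr_ge0// => x _; rewrite mulr_ge0// ltW. Qed.

(** A sum of nonnegative terms vanishes only termwise. Strata and optimal treatments carry strictly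
    positive weights, so every shortfall is zero and all derivatives in a stratum equal their
    maximum. *)
Lemma delta_eq0 : tangent P h -> delta P h = 0 <-> H_kappa P h.
Proof.
move=> hP; split=> [/eqP|[_ gE]].
  rewrite deltaE oppr_eq0 psumr_eq0 => [/allP d0|x _]; last by rewrite mulr_ge0// ltW.
  split=> // x; suff gm a : a \in optimal P x -> mean_dot P h a x = m x.
    by move=> a b aO bO; rewrite !gm.
  move=> aO; have := d0 x (mem_index_enum x); rewrite mulf_eq0 gt_eqF//= psumr_eq0.
    move=> /allP/(_ a (mem_index_enum a)); rewrite aO mulf_eq0 gt_eqF ?wstar_gt0//=.
    by rewrite subr_eq0 => /eqP.
  by move=> b; exact: term_ge0.
rewrite deltaE big1 ?oppr0// => x _; rewrite /gap big1 ?mulr0// => a aO.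
have [b bO ->] := maxover_ex (g x) aO.
by rewrite (gE x b a bO aO) subrr mulr0.
Qed.

End shift_sign.
End instances.

Theorem corollary9 (R : realType) (J K : nat) (B0 eps eta : R)
  (P : probability (obs J K R) R) (tau : nat -> R)
  (eps_gt0 : 0 < eps)
  (P_model : in_model B0 eps P)
  (eta_gt0 : 0 < eta)
  (prop_ge : forall x a, eps + eta <= prop P a x)
  (pr_gt0 : forall x, 0 < pr P x)
  (var_gt0 : forall x a, 0 < var P a x)
  (tau_noninc : nonincreasing_seq tau)
  (tau_cvg0 : tau n @[n --> \oo] --> 0)
  (sqrt_tau_cvgy : Num.sqrt n%:R * tau n @[n --> \oo] --> +oo) :
  [/\ asymptotically_linear P (Psi_eff tau) (psi_kappa P),
      regular_along B0 eps P (Psi_eff tau) (H_kappa P)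
        (normal_law 0 (V_kappa P)),
      forall d, optimal_rule P d ->
        regular_along B0 eps P (Psi_rule d) (C_rule P d)
          (normal_law 0 (V_rule P d)) &
      forall h, tangent P h ->
        [/\ forall path, dqm_path B0 eps P h path ->
              local_cvg path (Psi_eff tau)
                (normal_law (delta P h) (V_kappa P)),
            delta P h <= 0 &
            delta P h = 0 <-> H_kappa P h]].
Proof.
have prop_gt0 x a : 0 < prop P a x.
  by apply: lt_le_trans (prop_ge x a); rewrite addr_gt0.
have local := Psi_eff_local_cvg P_model prop_gt0 pr_gt0 var_gt0 tau_cvg0 sqrt_tau_cvgy.
have delta0 h := delta_eq0 P_model prop_gt0 pr_gt0 var_gt0 (h := h).
split.
- exact: (Psi_eff_asymptotically_linear P_model).
(* Regularity with variance [V_kappa] is the general local limit at scores where the shift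
   vanishes. *)
- move=> h hH path hpath; have [_ /(_ hH) <-] := delta0 h hH.1.
  exact: local hH.1 hpath.
- by move=> d dP; exact: (Psi_rule_regular P_model).
move=> h hP; split; last exact: delta0.
- by move=> path hpath; exact: local.
- exact: (delta_le0 P_model).
Qed.
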